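(* Let $k$ be a positive integer and let $P(z_1,z_2)$ be a plurisubharmonic, non-pluriharmonic polynomial on $\mathbb{C}^2$ that is homogeneous of degree $2k$ and has no pluriharmonic terms. Assume that $\omega(P)$ possesses Property (B). Then: 1) There exist a subharmonic, homogeneous polynomial $U$ on $\mathbb{C}$ and a holomorphic homogeneous polynomial $F$ on $\mathbb{C}^2$ such that $P(z_1,z_2)=U(F(z_1,z_2))$; and 2) Let $L_1,\dots,L_N$ be the complex lines passing through $0\in\mathbb{C}^2$ that constitute $F^{-1}\{0\}$. There exists a $C^\infty$-smooth function $H\geq 0$ on $\mathbb{C}^2$ such that the following hold: (a) $H^{-1}\{0\}=\bigcup_{j=1}^N L_j$. (b) $P-\delta H$ is plurisubharmonic on $\mathbb{C}^2$ for every $\delta$ with $0<\delta\leq 1$.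
   Context: The polynomials $P$ and $U$ are real-valued polynomials in the variables and their conjugates. ''No pluriharmonic terms'' means that no holomorphic or antiholomorphic monomials occur in $P$. A function $Q$ is homogeneous of degree $d$ if $Q(tz)=t^{d}Q(z)$ for all $z$ and all $t>0$. $\omega(P):=\{z\in\mathbb{C}^2:$ the complex Hessian of $P$ at $z$ is not strictly positive definite$\}$. Property (B): there exists a (non-constant) entire function $\mathcal{H}$ on $\mathbb{C}^2$ such that $P$ is harmonic along the smooth part of every level-curve of $\mathcal{H}$, i.e. $\omega(P)=\mathbb{C}^2$ and is foliated by these level-curves. *)

(* Defs.v *)
From HB Require Import structures.
From mathcomp Require Import all_boot all_order all_algebra.
From mathcomp.real_closed Require Import complex.
From mathcomp Require Import all_classical all_reals all_analysis.
From mathcomp.multinomials Require Import(coercions) mpoly.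

Set Implicit Arguments.
Unset Strict Implicit.
Unset Printing Implicit Defensive.

Import Order.TTheory GRing.Theory Num.Theory.
Import numFieldNormedType.Exports.

Local Open Scope classical_set_scope.
Local Open Scope ring_scope.
Local Open Scope complex_scope.

(* The library gives these structures to an abstract [K : numFieldType]
   through [K^o]; unification does not find them on the concrete type [R[i]]. *)
#[non_forgetful_inheritance]
HB.instance Definition _ (R : rcfType) := PseudoPointedMetric.copy R[i] R[i]^o.
#[non_forgetful_inheritance]
HB.instance Definition _ (R : rcfType) := GRing.ComAlgebra.copy R[i] R[i]^o.
#[non_forgetful_inheritance]
HB.instance Definition _ (R : rcfType) := Vector.copy R[i] R[i]^o.
#[non_forgetful_inheritance]
HB.instance Definition _ (R : rcfType) := NormedModule.copy R[i] R[i]^o.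

(* The variables of [p] are, in this order, z1, z2, conj z1, conj z2. *)
Definition is_real_poly2 (R : realType) (p : mpoly.mpoly 4 R[i])
    (P : R[i] * R[i] -> R) : Prop :=
  forall z : R[i] * R[i],
    (P z)%:C = mpoly.meval (tnth [tuple z.1; z.2; z.1^*; z.2^*]) p.

(* The variables of [u] are, in this order, w and conj w. *)
Definition is_real_poly1 (R : realType) (u : mpoly.mpoly 2 R[i])
    (U : R[i] -> R) : Prop :=
  forall w : R[i], (U w)%:C = mpoly.meval (tnth [tuple w; w^*]) u.

Definition is_holo_poly2 (R : realType) (f : mpoly.mpoly 2 R[i])
    (F : R[i] * R[i] -> R[i]) : Prop :=
  forall z : R[i] * R[i], F z = mpoly.meval (tnth [tuple z.1; z.2]) f.

(* Every monomial z^a (conj z)^b of [p] has |a| > 0 and |b| > 0. *)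
Definition no_pluriharmonic_terms (R : realType)
    (p : mpoly.mpoly 4 R[i]) : Prop :=
  forall m : mpoly.multinom 4, mpoly.mcoeff m p != 0 ->
    (0 < m (inord 0) + m (inord 1))%N /\ (0 < m (inord 2) + m (inord 3))%N.

Definition homogeneous (R : realType) (V W : lmodType R[i]) (d : nat)
    (Q : V -> W) : Prop :=
  forall (t : R) (z : V), 0 < t -> Q (t%:C *: z) = t%:C ^+ d *: Q z.

Section RealCalculus.
Context {R : realType} {V : normedModType R[i]}.

Definition rline (f : V -> R) (v z : V) : R -> R :=
  fun t => f (z + t%:C *: v).

Definition rderivable (f : V -> R) (v z : V) : Prop :=
  derivable (rline f v z) 0 1.

Definition rderive (v : V) (f : V -> R) (z : V) : R := 'D_1 (rline f v z) 0.

(* Meant for open D. On a finite-dimensional V, continuity of all iterated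
   real directional derivatives of order at most n is C^n smoothness. *)
Fixpoint Ck_on (D : set V) (n : nat) (f : V -> R) : Prop :=
  (forall z, D z -> {for z, continuous f}) /\
  match n with
  | 0 => True
  | n'.+1 => forall v : V,
      (forall z, D z -> rderivable f v z) /\ Ck_on D n' (rderive v f)
  end.

Definition smooth (f : V -> R) : Prop := forall n, Ck_on setT n f.

Definition cderive (v : V) (f : V -> R[i]) (z : V) : R[i] :=
  rderive v (fun x => complex.Re (f x)) z
    +i* rderive v (fun x => complex.Im (f x)) z.

(* For v the j-th basis vector: d/dz_j and d/d(conj z_j). *)
Definition wirtinger (v : V) (f : V -> R[i]) (z : V) : R[i] :=
  (cderive v f z - 'i * cderive ('i *: v) f z) / 2%:R.

Definition wirtinger_bar (v : V) (f : V -> R[i]) (z : V) : R[i] :=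
  (cderive v f z + 'i * cderive ('i *: v) f z) / 2%:R.

End RealCalculus.

Section Subharmonicity.
Context {R : realType}.
Local Notation C := R[i].
Local Notation mu := (@lebesgue_measure R).

Definition harmonic_on (D : set C) (u : C -> R) : Prop :=
  Ck_on D 2 u /\
  forall z, D z -> rderive (1 : C) (rderive (1 : C) u) z
    + rderive ('i : C) (rderive ('i : C) u) z = 0.

Definition usc (T : topologicalType) (u : T -> R) : Prop :=
  lower_semicontinuous (fun z => (- u z)%:E).

(* The integral makes sense in [-oo, +oo[: an upper semicontinuous function
   is measurable and bounded above on circles. *)
Definition subharmonic (u : C -> R) : Prop :=
  usc u /\
  forall (a : C) (r : R), 0 < r ->
    ((2 * pi * u a)%:E <=
     \int[mu]_(t in `[0%R, (2 * pi)%R])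
       (u (a + r%:C * (cos t +i* sin t)))%:E)%E.

Definition plurisubharmonic (u : C * C -> R) : Prop :=
  usc u /\
  forall a b : C * C, subharmonic (fun w : C => u (a + w *: b)).

Definition pluriharmonic (u : C * C -> R) : Prop :=
  forall a b : C * C, harmonic_on setT (fun w : C => u (a + w *: b)).

Definition basis2 (j : 'I_2) : C * C := if j == ord0 then (1, 0) else (0, 1).

(* Entry (j, k) is d^2 u / dz_j d(conj z_k). *)
Definition complex_hessian (u : C * C -> R) (z : C * C) : 'M[C]_2 :=
  \matrix_(j < 2, k < 2)
    wirtinger (basis2 j) (wirtinger_bar (basis2 k) (fun x => (u x)%:C)) z.

Definition positive_definite (n : nat) (A : 'M[C]_n) : Prop :=
  forall v : 'rV[C]_n, v != 0 ->
    0 < \sum_(j < n) \sum_(k < n) A j k * v 0 j * (v 0 k)^*.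

Definition omega (P : C * C -> R) : set (C * C) :=
  [set z | ~ positive_definite (complex_hessian P z)].

End Subharmonicity.

Section Holomorphic.
Context {R : realType}.
Local Notation C := R[i].

(* Differentiability is over the complex field. Continuity of the derivatives
   is the usual C^1 convention; it holds automatically for complex
   differentiable maps on open sets. *)
Definition holomorphic_on (V W : normedModType C) (D : set V)
    (f : V -> W) : Prop :=
  forall z, D z ->
    differentiable f z /\ forall v : V, {for z, continuous ('D_v f)}.

Definition unit_disc : set C := [set w | `|w| < 1].

(* [phi] is a holomorphic parametrization, by the unit disc, of a relatively
   open piece of S, with continuous inverse [psi]. The smooth part of
   S is the union of the images of all such [phi]. *)
Definition local_parametrization (S : set (C * C)) (phi : C -> C * C) : Prop :=
  [/\ holomorphic_on unit_disc phi,
      forall w, unit_disc w -> 'D_1 phi w != 0 &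
      exists (W : set (C * C)) (psi : C * C -> C),
        [/\ open W, phi @` unit_disc = S `&` W,
            {within S `&` W, continuous psi} &
            forall w, unit_disc w -> psi (phi w) = w]].

Definition harmonic_along_smooth_part (P : C * C -> R) (S : set (C * C)) :
    Prop :=
  forall phi, local_parametrization S phi ->
    harmonic_on unit_disc (fun w => P (phi w)).

Definition propertyB (P : C * C -> R) : Prop :=
  omega P = [set: C * C] /\
  exists h : C * C -> C,
    [/\ holomorphic_on [set: C * C] h,
        ~ (exists c, forall z, h z = c) &
        forall c, harmonic_along_smooth_part P (h @^-1` [set c])].

Definition is_line_through_0 (L : set (C * C)) : Prop :=
  exists2 v : C * C, v != 0 & L = range (fun w : C => w *: v).

End Holomorphic.

(* Main.v *)
Require Import Defs.
From HB Require Import structures.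
From mathcomp Require Import all_boot all_order all_algebra.
From mathcomp.real_closed Require Import complex.
From mathcomp Require Import all_classical all_reals all_analysis.
From mathcomp.multinomials Require Import(coercions, canonicals) mpoly.
From mathcomp Require Import separable.
From mathcomp Require Import ring lra zify.

Set Implicit Arguments.
Unset Strict Implicit.
Unset Printing Implicit Defensive.

Import Order.TTheory GRing.Theory Num.Theory.
Import numFieldNormedType.Exports.

Local Open Scope classical_set_scope.
Local Open Scope ring_scope.
Local Open Scope complex_scope.
Local Notation Re := complex.Re.
Local Notation Im := complex.Im.
Import Normc.
Local Notation "z ^J" := (conjc z) (at level 1, format "z ^J").
Local Notation Ci := (Complex 0 1).

(** The idea of the proof. Write P(z) = p(z, conj z) and treat p(z, w) as a
polynomial in four independent variables; an identity that holds for w = conj z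
on a box holds for all z and w ([polarize]).

Geometry. Suppose that dh/dz2 does not vanish at a point. Near it the level
curves of the entire function h are the graphs of g(., c), with g holomorphic in
both variables ([implicit_function], [inverse_frechet]). On such a graph P is
harmonic, so its tangent vector is isotropic for the Levi form of P; this form is
semidefinite, so the tangent vector lies in its kernel ([leaf_levi],
[levi_kernel]). The kernel equation expresses the slope of the leaves as a
quotient M1 / M2 of second derivatives of p. The slope is holomorphic along each
leaf and from leaf to leaf, so after polarization M1 / M2 does not depend on w.
Since p has no pluriharmonic terms, w-derivatives can be integrated from w = 0,
and the z-gradient of p(., w) has a direction that depends on z alone
([gradients_proportional_near]). As h is not constant, this applies to h or to h
with its variables exchanged. Hence the gradients of p(., w) and p(., w') are
parallel at every z, for all w and w' ([parallel_of_propertyB]).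

Algebra. Let p_a be the part of p of degree a in z. Its z-polynomials, for all a
and w, are binary forms with parallel gradients. If q and F are two such forms,
of degrees a and d, then the Wronskian of q^d and F^a vanishes, so q^d = c F^a;
for F of minimal positive degree, F divides q, and induction gives q = c F^n
([primitive_form]). As p is Hermitian, the dependence on w is through the
conjugate of F as well, and P = U(F) with U(s) the sum of gamma_n s^n conj(s)^(D-n)
([form_decomposition]). Along a line through 0 on which F(w y) = w^d, P is
U(w^d), so U is subharmonic.

Bump. Here the Laplacian means d^2 / ds d(conj s). That of U, called N, is a
nonnegative form in s and conj s; it vanishes exactly on finitely many real lines s = xi conj(s), on which
the bump must be superharmonic although it is positive. With S the product of
the s - xi conj(s) over the sigma distinct roots xi of N, dehomogenized, put
  h = |s|^(2E) - B |s|^(2E - 2 sigma) |S|^2 + B^2 |s|^(2E - 4 sigma) |S|^4.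
Then h >= 3/4 |s|^(2E), and on the zero lines, where S vanishes to first order,
the Laplacian of h is negative once B is large. By compactness of the circle
a multiple c h has Laplacian at most |s|^(2j) N, and dividing by (1 + |s|^2)^j
removes the factor |s|^(2j): this weight only lowers the Laplacian, since
2E >= j ([exists_bump]). If Ht is the result, then H = Ht o F works, because
P - delta H = (U - delta Ht) o F and N - delta (Laplacian of Ht) >= 0 for
delta <= 1 ([psh_form]). *)

(** * Derivatives of complex-valued functions of a real variable *)

Section curve_derivatives.
Context {R : realType}.
Local Notation C := R[i].

Lemma ReD (x y : C) : Re (x + y) = Re x + Re y. Proof. by case: x => ? ?; case: y. Qed.
Lemma ImD (x y : C) : Im (x + y) = Im x + Im y. Proof. by case: x => ? ?; case: y. Qed.
Lemma ReN (x : C) : Re (- x) = - Re x. Proof. by case: x. Qed.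
Lemma ImN (x : C) : Im (- x) = - Im x. Proof. by case: x. Qed.
Lemma ReM (x y : C) : Re (x * y) = Re x * Re y - Im x * Im y.
Proof. by case: x => ? ?; case: y. Qed.
Lemma ImM (x y : C) : Im (x * y) = Re x * Im y + Im x * Re y.
Proof. by case: x => ? ?; case: y. Qed.
Lemma ReJ (x : C) : Re x^J = Re x. Proof. by case: x. Qed.
Lemma ImJ (x : C) : Im x^J = - Im x. Proof. by case: x. Qed.
Definition ReImE := (ReD, ImD, ReN, ImN, ReM, ImM, ReJ, ImJ).

Lemma complexP (x y : C) : Re x = Re y -> Im x = Im y -> x = y.
Proof. by case: x => a b; case: y => c d /= -> ->. Qed.

Implicit Types (f g : R -> C) (t : R) (k l : C).

Lemma conjD (x y : C) : (x + y)^J = x^J + y^J. Proof. exact: rmorphD. Qed.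
Lemma conjN (x : C) : (- x)^J = - x^J. Proof. exact: rmorphN. Qed.
Lemma conjM (x y : C) : (x * y)^J = x^J * y^J. Proof. exact: rmorphM. Qed.
Lemma conjX (x : C) n : (x ^+ n)^J = x^J ^+ n. Proof. exact: rmorphXn. Qed.
Lemma conj_nat n : (n%:R : C)^J = n%:R. Proof. exact: rmorph_nat. Qed.
Lemma conj1 : (1 : C)^J = 1. Proof. exact: rmorph1. Qed.
Lemma conj0 : (0 : C)^J = 0. Proof. exact: rmorph0. Qed.
Lemma conjV (x : C) : (x^-1)^J = (x^J)^-1. Proof. exact: fmorphV. Qed.
Lemma conjR (x : R) : (x%:C)^J = x%:C :> C. Proof. exact: conjc_real. Qed.
Lemma conj_sum (I : Type) (r : seq I) (P : pred I) (F : I -> C) :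
  (\sum_(i <- r | P i) F i)^J = \sum_(i <- r | P i) conjc (F i).
Proof. exact: rmorph_sum. Qed.
Definition conjE := (conjD, conjN, conjM, conjX, conj_nat, conj1, conj0, conjV, conjR, @conjcK R).

(** Real and imaginary parts are differentiated separately, so that real calculus
applies to curves in the complex plane. *)
Definition cder (f : R -> C) (t : R) (l : C) : Prop :=
  is_derive t 1 (fun s => Re (f s)) (Re l) /\
  is_derive t 1 (fun s => Im (f s)) (Im l).

Lemma cder_cst (c : C) t : cder (fun=> c) t 0.
Proof. by split; exact: is_derive_cst. Qed.

Lemma cder_real t : cder (fun s => s%:C) t 1.
Proof. by split; [exact: is_derive_id|exact: is_derive_cst]. Qed.

Lemma cderD f g t k l : cder f t k -> cder g t l ->
  cder (fun s => f s + g s) t (k + l).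
Proof.
move=> [fr fi] [gr gi]; split; rewrite !ReImE.
  rewrite (_ : (fun s => _) = (fun s => Re (f s)) + (fun s => Re (g s))).
    exact: is_deriveD.
  by apply/funext => s; rewrite ReImE.
rewrite (_ : (fun s => _) = (fun s => Im (f s)) + (fun s => Im (g s))).
  exact: is_deriveD.
by apply/funext => s; rewrite ReImE.
Qed.

Lemma cderM f g t k l : cder f t k -> cder g t l ->
  cder (fun s => f s * g s) t (k * g t + f t * l).
Proof.
move=> [fr fi] [gr gi]; split.
  rewrite (_ : (fun s => _) = (fun s => Re (f s)) * (fun s => Re (g s))
     - (fun s => Im (f s)) * (fun s => Im (g s))); last first.
    by apply/funext => s; rewrite ReImE.
  apply: is_derive_eq; rewrite !ReImE /GRing.scale /=; ring.
rewrite (_ : (fun s => _) = (fun s => Re (f s)) * (fun s => Im (g s))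
     + (fun s => Im (f s)) * (fun s => Re (g s))); last first.
  by apply/funext => s; rewrite ReImE.
apply: is_derive_eq; rewrite !ReImE /GRing.scale /=; ring.
Qed.

Lemma cderJ f t l : cder f t l -> cder (fun s => (f s)^J) t l^J.
Proof.
move=> [fr fi]; split.
  by rewrite ReJ; under eq_fun do rewrite ReJ.
rewrite ImJ; under eq_fun do rewrite ImJ.
exact: is_deriveN.
Qed.

Lemma cderN f t l : cder f t l -> cder (fun s => - f s) t (- l).
Proof.
by move=> [fr fi]; split; rewrite !ReImE;
  under eq_fun do rewrite ReImE; exact: is_deriveN.
Qed.

Lemma cderB f g t k l : cder f t k -> cder g t l ->
  cder (fun s => f s - g s) t (k - l).
Proof. by move=> df dg; apply: cderD => //; exact: cderN. Qed.

Lemma cder_ext f g t l : f =1 g -> cder f t l -> cder g t l.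
Proof. by move=> /funext ->. Qed.

Lemma cder_eq f t l l' : cder f t l -> l = l' -> cder f t l'.
Proof. by move=> ? <-. Qed.

Lemma cder_near f g t l : (\forall s \near t, f s = g s) ->
  cder f t l -> cder g t l.
Proof.
move=> fg [fr fi]; split.
  by apply: near_eq_is_derive fr; near=> s; rewrite (near fg s).
by apply: near_eq_is_derive fi; near=> s; rewrite (near fg s).
Unshelve. all: by end_near. Qed.

Lemma cder_uniq f t k l : cder f t k -> cder f t l -> k = l.
Proof.
move=> [fr fi] [gr gi]; apply: complexP.
  by rewrite -(@derive_val _ _ _ _ _ _ _ fr) (@derive_val _ _ _ _ _ _ _ gr).
by rewrite -(@derive_val _ _ _ _ _ _ _ fi) (@derive_val _ _ _ _ _ _ _ gi).
Qed.

Lemma cder_comp f (g : R -> R) (t dg : R) l :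
  is_derive t 1 g dg -> cder f (g t) l -> cder (fun s => f (g s)) t (l * dg%:C).
Proof.
move=> gd [fr fi]; split; rewrite !ReImE /= !mulr0.
  rewrite subr0 mulrC.
  by have := @is_derive1_comp _ (fun s => Re (f s)) g t _ _ fr gd;
    rewrite /comp => hh; apply: is_derive_eq; rewrite /GRing.scale /= mulrC.
rewrite add0r mulrC.
by have := @is_derive1_comp _ (fun s => Im (f s)) g t _ _ fi gd;
    rewrite /comp => hh; apply: is_derive_eq; rewrite /GRing.scale /= mulrC.
Qed.

Lemma cderV f t l : f t != 0 -> cder f t l ->
  cder (fun s => (f s)^-1) t (- l / f t ^+ 2).
Proof.
move=> f0 df.
have n0 : forall x : C, x != 0 -> Re x ^+ 2 + Im x ^+ 2 != 0.
  move=> x; apply: contra => /eqP h; apply/eqP; apply: complexP => /=; nra.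
pose n (s : R) : R := Re (f s) ^+ 2 + Im (f s) ^+ 2.
case: (df) => fr fi.
have dn : is_derive t 1 n (2 * (Re (f t) * Re l + Im (f t) * Im l)).
  rewrite (_ : n = (fun s => Re (f s)) ^+ 2 + (fun s => Im (f s)) ^+ 2).
    by apply: is_derive_eq; rewrite /GRing.scale /= expr1; ring.
  by apply/funext => s.
have dV := @is_deriveV _ n t _ 1 (n0 _ f0) dn.
have dnV : cder (fun s => (n s)^-1%:C) t (- (n t)^-2 * (2 * (Re (f t) * Re l + Im (f t) * Im l)))%:C.
  by split; [exact: dV | exact: is_derive_cst].
have E : forall x : C, x^-1 = x^J * ((Re x ^+ 2 + Im x ^+ 2)^-1)%:C.
  move=> [a b]; apply: complexP => /=; ring.
have F : forall x : C, x * x^J = (Re x ^+ 2 + Im x ^+ 2)%:C.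
  by move=> [a b]; apply: complexP => /=; ring.
have F2 : forall x y : C, (2 * (Re x * Re y + Im x * Im y))%:C = x * y^J + x^J * y.
  by move=> [a b] [c d]; apply: complexP => /=; ring.
apply: (@cder_ext (fun s => (f s)^J * (n s)^-1%:C)) => [s|]; first by rewrite E.
apply: cder_eq (cderM (cderJ df) dnV) _.
have nE : (n t)%:C = f t * (f t)^J by rewrite F.
have f1 : (f t)^J != 0 by rewrite conjc_eq0.
have -> : (- (n t) ^- 2 * (2 * (Re (f t) * Re l + Im (f t) * Im l)))%:C =
    - (n t)%:C ^- 2 * (f t * l^J + (f t)^J * l).
  by rewrite -F2 -rmorphXn -fmorphV -rmorphN -rmorphM.
rewrite -[X in _ * X + _](_ : ((n t)%:C)^-1 = _); last by rewrite fmorphV.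
rewrite nE.
by field; rewrite f0 f1.
Qed.

Lemma cderX f t l n : cder f t l ->
  cder (fun s => f s ^+ n) t (n%:R * f t ^+ n.-1 * l).
Proof.
move=> df; elim: n => [|n ih]; first by rewrite !mul0r; exact: cder_cst.
apply: (@cder_ext (fun s => f s * f s ^+ n)) => [s|]; first by rewrite exprS.
apply: cder_eq (cderM df ih) _; case: n {ih} => [|n] /=.
  by rewrite expr0; ring.
by rewrite !exprS -[n.+2%:R]natr1; ring.
Qed.

Lemma cder_sum (I : Type) (r : seq I) (P : pred I) (f : I -> R -> C) t (l : I -> C) :
  (forall i, P i -> cder (f i) t (l i)) ->
  cder (fun s => \sum_(i <- r | P i) f i s) t (\sum_(i <- r | P i) l i).
Proof.
move=> df; elim: r => [|i r ih].
  by rewrite big_nil; apply: cder_ext (cder_cst 0 t) => s; rewrite big_nil.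
rewrite big_cons; case: ifP => Pi.
  by apply: cder_ext (cderD (df i Pi) ih) => s; rewrite big_cons Pi.
by apply: cder_ext ih => s; rewrite big_cons Pi.
Qed.

Lemma is_deriveP (g : R -> R) (t l : R) : is_derive t 1 g l <->
  forall e : R, 0 < e -> exists2 d : R, 0 < d &
    forall h : R, `|h| < d -> `|g (t + h) - g t - h * l| <= e * `|h|.
Proof.
split.
  move=> [dg gl] e e0.
  move: dg; rewrite /derivable => /cvg_ex[m gm].
  have ml : m = l by rewrite -gl /derive; apply/esym/cvg_lim.
  move: gm; rewrite {}ml => /cvgrPdist_le /(_ e e0).
  rewrite near_withinE => /nbhs_ballP[d /= d0 H]; exists d => // h hd.
  have [->|h0] := eqVneq h 0; first by rewrite addr0 mul0r !subrr normr0 mulr0.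
  have := H h; rewrite /ball /= sub0r normrN => /(_ hd h0).
  rewrite /GRing.scale /= mulr1 => H1.
  rewrite distrC (_ : _ - _ = (l - h^-1 * (g (h + t) - g t)) * h); last first.
    by rewrite [t + h]addrC; field.
  by rewrite normrM ler_wpM2r.
move=> H.
have cv : (fun h => h^-1 *: ((g \o shift t) (h *: 1) - g t)) @ (0 : R)^' --> l.
  apply/cvgrPdist_le => e e0; rewrite near_withinE.
  have [d d0 Hd] := H _ e0.
  apply/nbhs_ballP; exists d => //= h; rewrite /ball /= sub0r normrN => hd h0.
  have := Hd _ hd; rewrite /GRing.scale /= mulr1 => H1.
  rewrite -(@ler_pM2r _ `|h|) ?normr_gt0//; apply: le_trans H1.
  rewrite -normrM -normrN.
  have -> // : - ((l - h^-1 * (g (h + t) - g t)) * h) = g (t + h) - g t - h * l.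
  by rewrite [t + h]addrC; field.
split; first by apply/cvg_ex; exists l.
by rewrite /derive; apply/cvg_lim.
Qed.

Lemma normc_ge0 (x : C) : 0 <= normc x.
Proof. by case: x => a b; exact: sqrtr_ge0. Qed.

Lemma normE (x : C) : `|x| = (normc x)%:C. Proof. by case: x. Qed.

Lemma normcD (x y : C) : normc (x + y) <= normc x + normc y.
Proof. exact: le_normcD. Qed.

Lemma normcB (x y : C) : normc (x - y) = normc (y - x).
Proof. by rewrite -normcN opprB. Qed.

Lemma normc_tri (z x y : C) : normc (x - y) <= normc (x - z) + normc (z - y).
Proof. by apply: le_trans (normcD _ _); rewrite addrA subrK. Qed.

Lemma normcR (x : R) : normc x%:C = `|x|.
Proof. by rewrite /= expr0n addr0 sqrtr_sqr. Qed.

Lemma normcX (x : C) n : normc (x ^+ n) = normc x ^+ n.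
Proof. by elim: n => [|n ih]; rewrite ?expr0 ?normc1// !exprS normcM ih. Qed.

Lemma Re_le_normc (x : C) : `|Re x| <= normc x.
Proof.
by case: x => a b /=; rewrite -sqrtr_sqr ler_wsqrtr// lerDl sqr_ge0.
Qed.

Lemma Im_le_normc (x : C) : `|Im x| <= normc x.
Proof.
by case: x => a b /=; rewrite -sqrtr_sqr ler_wsqrtr// lerDr sqr_ge0.
Qed.

Lemma normc_le_ReIm (x : C) : normc x <= `|Re x| + `|Im x|.
Proof.
rewrite -(ler_pXn2r (n := 2)) ?nnegrE ?normc_ge0 ?addr_ge0//.
case: x => a b /=; rewrite sqr_sqrtr ?addr_ge0 ?sqr_ge0//.
rewrite sqrrD -mulr_natl.
have : 0 <= `|a| * `|b| by rewrite mulr_ge0.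
have := real_normK (num_real a); have := real_normK (num_real b); lra.
Qed.

Lemma normc_conj (x : C) : normc x^J = normc x.
Proof. by case: x => a b /=; rewrite sqrrN. Qed.

Lemma normc_sqr (x : C) : normc x ^+ 2 = Re x ^+ 2 + Im x ^+ 2.
Proof. by case: x => a b /=; rewrite sqr_sqrtr ?addr_ge0 ?sqr_ge0. Qed.

Lemma mulcJ (x : C) : x * x^J = (normc x ^+ 2)%:C.
Proof.
by rewrite normc_sqr; case: x => a b; apply: complexP => /=; ring.
Qed.

Lemma normc_gt0 (x : C) : (0 < normc x) = (x != 0).
Proof.
rewrite lt_neqAle normc_ge0 andbT eq_sym; congr negb.
by apply/eqP/eqP => [/eq0_normc//|->]; rewrite normc0.
Qed.

Lemma normc_i : normc (Complex 0 1 : C) = 1.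
Proof. by rewrite /= expr0n add0r expr1n sqrtr1. Qed.

Lemma cderP f t l : cder f t l <->
  forall e : R, 0 < e -> exists2 d : R, 0 < d &
    forall h : R, `|h| < d -> normc (f (t + h) - f t - h%:C * l) <= e * `|h|.
Proof.
split.
  move=> [/is_deriveP fr /is_deriveP fi] e e0.
  have [d1 d10 H1] := fr _ (divr_gt0 e0 (ltr0n _ 2)).
  have [d2 d20 H2] := fi _ (divr_gt0 e0 (ltr0n _ 2)).
  exists (Num.min d1 d2); first by rewrite lt_min d10.
  move=> h; rewrite lt_min => /andP[/H1 {}H1 /H2 {}H2].
  apply: le_trans (normc_le_ReIm _) _; rewrite !ReImE /= !mul0r subr0 addr0.
  by apply: le_trans (lerD H1 H2) _; rewrite -mulrDl -splitr.
move=> H; split; apply/is_deriveP => e /H[d d0 Hd]; exists d => // h /Hd.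
  move/(le_trans (Re_le_normc _)); rewrite !ReImE /= mul0r subr0; exact.
move/(le_trans (Im_le_normc _)); rewrite !ReImE /= mul0r addr0; exact.
Qed.

Lemma cder_cont f t l : cder f t l -> forall e : R, 0 < e -> exists2 d : R, 0 < d &
    forall h : R, `|h| < d -> normc (f (t + h) - f t) <= e.
Proof.
move=> /cderP H e e0; have [d d0 Hd] := H 1 ltr01.
have L0 : 0 < 1 + normc l by rewrite ltr_pwDl// normc_ge0.
exists (Num.min d (e / (1 + normc l))); first by rewrite lt_min d0 divr_gt0.
move=> h; rewrite lt_min ltr_pdivlMr// => /andP[/Hd {}Hd he].
rewrite -[_ - _](subrK (h%:C * l)); apply: le_trans (normcD _ _) _.
rewrite normcM normcR; apply: le_trans (ltW he).
by rewrite mulrDr mulr1 lerD2r -[leRHS]mul1r.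
Qed.

(** Induction along the ring structure: it suits statements about evaluation, which
is a morphism, better than induction on monomials. *)
Lemma mpoly_ring_ind (K : comNzRingType) n (P : mpoly.mpoly n K -> Prop) :
  (forall c, P (mpoly.mpolyC n c)) -> (forall i, P (mpoly.mpolyX K (mpoly.mnm1 i))) ->
  (forall p q, P p -> P q -> P (p + q)) -> (forall p q, P p -> P q -> P (p * q)) ->
  forall p, P p.
Proof.
move=> PC PX PD PM; elim/mpoly.mpolyind => [|c m p _ _ Pp].
  by have := PC 0; rewrite raddf0.
apply: PD => //; rewrite -mpoly.mul_mpolyC; apply: (PM) => //.
rewrite mpoly.mpolyXE_id; elim/big_rec: _ => [|i q _ Pq].
  exact: (PC 1).
apply: (PM) => //; elim: (m i) => [|k ih]; first by rewrite expr0; exact: (PC 1).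
by rewrite exprS; apply: (PM).
Qed.

Lemma leibnizr (a b c d e : C) : a * e * b + c * (d * e) = (a * b + c * d) * e.
Proof. by ring. Qed.

Lemma leibnizl (a b c d e : C) : e * a * b + c * (e * d) = e * (a * b + c * d).
Proof. by ring. Qed.

Lemma cder_mpoly n (p : mpoly.mpoly n C) (x : 'I_n -> R -> C) t (dx : 'I_n -> C) :
  (forall i, cder (x i) t (dx i)) ->
  cder (fun s => mpoly.meval (x ^~ s) p) t
    (\sum_i mpoly.meval (x ^~ t) (mpoly.mderiv i p) * dx i).
Proof.
move=> dxx; elim/mpoly_ring_ind: p => [c|i|p q dp dq|p q dp dq].
- rewrite big1 => [|i _]; last by rewrite mpoly.mderivC mpoly.meval0 mul0r.
  by apply: cder_ext (cder_cst c t) => s; rewrite mpoly.mevalC.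
- rewrite (bigD1 i)//= big1 ?addr0 => [|j ji].
    rewrite mpoly.mderivX mpoly.mnm1E eqxx scale1r.
    rewrite (_ : mpoly.mnm_sub _ _ = mpoly.mnm0); last first.
      by apply/mpoly.mnmP => j; rewrite mpoly.mnmBE mpoly.mnm0E subnn.
    rewrite mpoly.mpolyX0 mpoly.meval1 mul1r.
    by apply: cder_ext (dxx i) => s; rewrite mpoly.mevalXU.
  by rewrite mpoly.mderivX mpoly.mnm1E eq_sym (negbTE ji) scale0r mpoly.meval0 mul0r.
- apply: cder_eq; first by apply: cder_ext (cderD dp dq) => s; rewrite mpoly.mevalD.
  rewrite -big_split; apply: eq_bigr => i _.
  by rewrite mpoly.mderivD mpoly.mevalD mulrDl.
- apply: cder_eq; first by apply: cder_ext (cderM dp dq) => s; rewrite mpoly.mevalM.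
  rewrite mulr_suml mulr_sumr -big_split; apply: eq_bigr => i _ /=.
  by rewrite mpoly.mderivM mpoly.mevalD !mpoly.mevalM; exact: leibnizr.
Qed.

End curve_derivatives.

(** * Means over circles *)

Section circle_means.
Context {R : realType}.
Local Notation C := R[i].
Implicit Types (t s : R).

Lemma derive_continuous (f df : R -> R) : (forall x : R, is_derive x 1 f (df x)) ->
  continuous f.
Proof.
move=> H x; apply: differentiable_continuous; apply/derivable1_diffP.
by case: (H x).
Qed.

Section under.
Variable b : R.
Hypothesis b0 : 0 < b.
Local Notation mu := (@lebesgue_measure R).
Local Notation D := (`[0, b]%classic : set R).

Lemma cont_integrable (f : R -> R) : continuous f -> mu.-integrable D (EFin \o f).
Proof.
move=> cf; apply: continuous_compact_integrable; first exact: segment_compact.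
exact: continuous_subspaceT.
Qed.

Lemma Rint_cst (c : R) : (\int[mu]_(t in D) c)%R = c * b.
Proof.
rewrite Rintegral_cst//.
congr (_ * _); apply: (congr1 fine (y := b%:E)).
by apply: (etrans (lebesgue_measure_itv _)); rewrite /= lte_fin b0 oppr0 adde0.
Qed.

(** Differentiation under the integral sign; the bound on f1 that is uniform for
bounded s is what dominated convergence asks for. *)
Lemma derive_Rint (f f1 : R -> R -> R) :
  (forall s t, is_derive s 1 (f^~ t) (f1 s t)) ->
  (forall s, continuous (f s)) ->
  (forall r : R, exists M : R, forall s t, `|s| <= r -> `|f1 s t| <= M) ->
  forall s, is_derive s 1 (fun s => \int[mu]_(t in D) f s t)%R
     (\int[mu]_(t in D) f1 s t)%R.
Proof.
move=> df cf bf1 s.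
have [M HM] := bf1 (`|s| + 1).
have sI : (`]s - 1, s + 1[%classic : set R) s.
  by rewrite /= in_itv /=; lra.
have M0 : 0 <= M by apply: le_trans (HM s 0 _); rewrite // lerDl.
have d1 : forall x y, partial1of2 f x y = f1 x y.
  by move=> x y; rewrite partial1of2E; exact: derive_val.
have int : forall x : R, (`]s - 1, s + 1[%classic : set R) x -> mu.-integrable D (EFin \o f x).
  by move=> x _; exact: cont_integrable.
have der : forall x y : R, (`]s - 1, s + 1[%classic : set R) x -> D y -> derivable (f ^~ y) x 1.
  by move=> x y _ _; case: (df x y).
have bnd : forall x y, (`]s - 1, s + 1[%classic : set R) x -> D y -> `|partial1of2 f x y| <= cst M y.
  move=> x y; rewrite /= in_itv /= => xs _; rewrite d1; apply: HM.
  have /ltW : `|x - s| < 1 by rewrite ltr_distl; lra.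
  by rewrite -lerBlDl; apply: le_trans; exact: lerB_dist.
have iM : mu.-integrable D (EFin \o cst M).
  by apply: cont_integrable; exact: cst_continuous.
have H1 := @derivable_under_integral R _ _ mu f D (measurable_itv _) s _ _ sI int der (cst M) (fun=> M0) iM bnd.
have H2 := @differentiation_under_integral R _ _ mu f D (measurable_itv _) s _ _ sI int der (cst M) (fun=> M0) iM bnd.
apply: DeriveDef; first exact: H1.
rewrite -derive1E H2; apply: eq_Rintegral => y _; exact: d1.
Qed.

Lemma Rint_FTC (q dq : R -> R) : (forall t, is_derive t 1 q (dq t)) -> continuous dq ->
  (\int[mu]_(t in D) dq t)%R = q b - q 0.
Proof.
move=> dq1 cq; rewrite /Rintegral (@continuous_FTC2 _ dq q)//.
- exact: continuous_subspaceT.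
- have cqq := derive_continuous dq1; split.
  + by move=> x _; case: (dq1 x).
  + by apply: cvg_at_right_filter; exact: cqq.
  + by apply: cvg_at_left_filter; exact: cqq.
- by move=> x _; rewrite derive1E; exact: derive_val.
Qed.

End under.

(** The radial mean I(s) of f has s I'(s) = J(s), and J'(s) is the mean of m1. Polar
coordinates give s * m1 = s^2 * (Laplacian) - dq, where dq is a t-derivative of
a periodic function and integrates to 0. So J and then I are nondecreasing. *)
Lemma circle_mean (b r : R) (f f1 m1 q dq : R -> R -> R) :
  0 < b -> 0 < r ->
  (forall s t, is_derive s 1 (f^~ t) (f1 s t)) ->
  (forall s t, is_derive s 1 (fun s => s * f1 s t) (m1 s t)) ->
  (forall s t, is_derive t 1 (q s) (dq s t)) ->
  (forall s, continuous (f s)) -> (forall s, continuous (f1 s)) ->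
  (forall s, continuous (m1 s)) -> (forall s, continuous (dq s)) ->
  (forall r : R, exists M : R, forall s t, `|s| <= r -> `|f1 s t| <= M) ->
  (forall r : R, exists M : R, forall s t, `|s| <= r -> `|m1 s t| <= M) ->
  (forall s, q s b = q s 0) ->
  (forall s t, 0 <= s <= r -> 0 <= s * m1 s t + dq s t) ->
  ((\int[@lebesgue_measure R]_(t in `[0, b]) f 0 t)%R <= \int[@lebesgue_measure R]_(t in `[0, b]) f r t)%R.
Proof.
move=> b0 r0 df dm dq1 cf cf1 cm1 cdq bf1 bm1 qb lap.
set mu := @lebesgue_measure R.
(* J s = s I'(s), where I is the mean of f over the circle of radius s *)
pose J s := (\int[mu]_(t in `[0, b]) (s * f1 s t))%R.
have cm s : continuous (fun t => s * f1 s t).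
  by move=> t; apply: cvgM; [exact: cvg_cst|exact: cf1].
have dI := derive_Rint b df cf bf1.
have dJ : forall s, is_derive s 1 J (\int[mu]_(t in `[0, b]) m1 s t)%R.
  exact: (derive_Rint b dm cm bm1).
have JE s : J s = s * (\int[mu]_(t in `[0, b]) f1 s t)%R.
  by rewrite /J RintegralZl//; exact: cont_integrable.
have dJ0 s : 0 < s <= r -> 0 <= (\int[mu]_(t in `[0, b]) m1 s t)%R.
  move=> /andP[s0 sr]; rewrite -(pmulr_rge0 _ s0) -RintegralZl//; last exact: cont_integrable.
  have := Rint_FTC b0 (dq1 s) (cdq s); rewrite qb subrr => q0.
  have -> : (\int[mu]_(t in `[0, b]) (s * m1 s t) =
    \int[mu]_(t in `[0, b]) (s * m1 s t + dq s t))%R.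
    rewrite RintegralD//; first by rewrite q0 addr0.
    - by apply: cont_integrable => t; apply: cvgM; [exact: cvg_cst|exact: cm1].
    - exact: cont_integrable.
  by apply: Rintegral_ge0 => t _; apply: lap; rewrite ltW.
have J0 s : 0 < s <= r -> 0 <= J s.
  move=> /andP[s0 sr].
  have [|c] := MVT s0 (fun x _ => dJ x).
    by apply: continuous_subspaceT; exact: derive_continuous dJ.
  rewrite in_itv /= => /andP[c0 cs]; rewrite [J 0]JE mul0r !subr0 => ->.
  by rewrite mulr_ge0 ?(ltW s0)// dJ0// c0 (le_trans (ltW cs)).
have [|c] := MVT r0 (fun x _ => dI x).
  by apply: continuous_subspaceT; exact: derive_continuous dI.
rewrite in_itv /= => /andP[c0 cr] E; rewrite -subr_ge0 E mulr_ge0 ?subr_ge0 ?(ltW r0)//.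
by rewrite -(pmulr_rge0 _ c0) -JE J0// c0 ltW.
Qed.

End circle_means.

(** * Smooth expressions *)

Section smooth_expressions.
Context {R : realType} {T : Type} {I : finType}.
Local Notation C := R[i].
Variable X : I -> T -> C.

(** Expressions in given complex coordinates X i and their conjugates, with the one
kind of inverse that never vanishes. The class is closed under differentiation,
which makes smoothness of its members an induction, and it contains both
polynomials and the bump constructed below. *)
Inductive sm : (T -> C) -> Prop :=
| sm_cst c : sm (fun=> c)
| sm_X i : sm (X i)
| sm_conj f : sm f -> sm (fun z => (f z)^J)
| sm_add f g : sm f -> sm g -> sm (fun z => f z + g z)
| sm_mul f g : sm f -> sm g -> sm (fun z => f z * g z)
| sm_inv f : sm f -> sm (fun z => (1 + f z * (f z)^J)^-1).

Lemma sm_ext f g : f =1 g -> sm f -> sm g.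
Proof. by move=> /funext ->. Qed.

Lemma sm_opp f : sm f -> sm (fun z => - f z).
Proof.
move=> sf; apply: sm_ext (sm_mul (sm_cst (-1)) sf) => z; exact: mulN1r.
Qed.

Lemma sm_exp f n : sm f -> sm (fun z => f z ^+ n).
Proof.
move=> sf; elim: n => [|n ih]; first exact: (sm_ext _ (sm_cst 1)).
by apply: sm_ext (sm_mul sf ih) => z; rewrite exprS.
Qed.

Lemma sm_sum (J : Type) (r : seq J) (P : pred J) (f : J -> T -> C) :
  (forall j, sm (f j)) -> sm (fun z => \sum_(j <- r | P j) f j z).
Proof.
move=> sf; elim: r => [|j r ih].
  by apply: sm_ext (sm_cst 0) => z; rewrite big_nil.
case Pj: (P j); last by apply: sm_ext ih => z; rewrite big_cons Pj.
by apply: sm_ext (sm_add (sf j) ih) => z; rewrite big_cons Pj.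
Qed.

Lemma sm_mpoly n (p : mpoly.mpoly n C) (x : 'I_n -> T -> C) :
  (forall i, sm (x i)) -> sm (fun z => mpoly.meval (x ^~ z) p).
Proof.
move=> sx; elim/mpoly_ring_ind: p => [c|i|p q dp dq|p q dp dq].
- by apply: sm_ext (sm_cst c) => s; rewrite mpoly.mevalC.
- by apply: sm_ext (sx i) => s; rewrite mpoly.mevalXU.
- by apply: sm_ext (sm_add dp dq) => s; rewrite mpoly.mevalD.
- by apply: sm_ext (sm_mul dp dq) => s; rewrite mpoly.mevalM.
Qed.

(** D and D' are the derivatives in the coordinates and in their conjugates. *)
Definition has_der (f : T -> C) (D D' : I -> T -> C) : Prop :=
  forall (x : R -> T) (t : R) (dx : I -> C),
    (forall i, cder (fun s => X i (x s)) t (dx i)) ->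
    cder (fun s => f (x s)) t
      (\sum_i (D i (x t) * dx i + D' i (x t) * conjc (dx i))).

Lemma pos1 (w : C) : 1 + w * w^J != 0.
Proof.
rewrite mulcJ -[1]/(1%:C) -rmorphD /=; apply/eqP => -[] h.
have := sqr_ge0 (normc w); lra.
Qed.

Lemma pos1_ge1 (w : C) : 1 <= normc (1 + w * w^J).
Proof.
rewrite mulcJ; have -> : 1 + (normc w ^+ 2)%:C = (1 + normc w ^+ 2)%:C by rewrite rmorphD.
by rewrite normcR ger0_norm ?lerDl ?addr_ge0 ?sqr_ge0.
Qed.

Lemma sm_der f : sm f -> exists D D', [/\ forall i, sm (D i), forall i, sm (D' i) & has_der f D D'].
Proof.
elim=> [c|i|{}f _ [D [D' [sD sD' df]]]|{}f g sf [D [D' [sD sD' df]]] sg [E [E' [sE sE' dg]]]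
  |{}f g sf [D [D' [sD sD' df]]] sg [E [E' [sE sE' dg]]]|{}f sf [D [D' [sD sD' df]]]].
- exists (fun _ _ => 0), (fun _ _ => 0); split=> [i|i|x t dx _]; try exact: sm_cst.
  by rewrite big1 => [|i _]; [exact: cder_cst | rewrite !mul0r addr0].
- exists (fun j _ => (j == i)%:R), (fun _ _ => 0); split=> [j|j|x t dx dxx]; try exact: sm_cst.
  rewrite (bigD1 i)//= big1 => [|j /negbTE ->]; last by rewrite !mul0r addr0.
  by rewrite eqxx mul1r mul0r !addr0.
- exists (fun i z => (D' i z)^J), (fun i z => (D i z)^J); split=> [i|i|x t dx dxx]; try exact: sm_conj.
  apply: cder_eq (cderJ (df x t dx dxx)) _; rewrite conj_sum; apply: eq_bigr => i _.
  by rewrite !conjE; ring.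
- exists (fun i z => D i z + E i z), (fun i z => D' i z + E' i z).
  split=> [i|i|x t dx dxx]; try exact: sm_add.
  apply: cder_eq (cderD (df x t dx dxx) (dg x t dx dxx)) _.
  by rewrite -big_split; apply: eq_bigr => i _ /=; ring.
- exists (fun i z => D i z * g z + f z * E i z), (fun i z => D' i z * g z + f z * E' i z).
  split=> [i|i|x t dx dxx]; try by apply: sm_add; apply: sm_mul.
  apply: cder_eq (cderM (df x t dx dxx) (dg x t dx dxx)) _.
  by rewrite mulr_suml mulr_sumr -big_split; apply: eq_bigr => i _ /=; ring.
- pose N z := 1 + f z * (f z)^J.
  exists (fun i z => - (D i z * (f z)^J + f z * (D' i z)^J) * ((N z)^-1 * (N z)^-1)),
         (fun i z => - (D' i z * (f z)^J + f z * (D i z)^J) * ((N z)^-1 * (N z)^-1)).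
  have sN : sm (fun z => (N z)^-1) by exact: sm_inv.
  split=> [i|i|x t dx dxx].
  + apply: sm_mul; last exact: sm_mul.
    by apply: sm_opp; apply: sm_add; apply: sm_mul => //; apply: sm_conj.
  + apply: sm_mul; last exact: sm_mul.
    by apply: sm_opp; apply: sm_add; apply: sm_mul => //; apply: sm_conj.
  + have dfx := df x t dx dxx.
    have dN := cderD (cder_cst 1 t) (cderM dfx (cderJ dfx)).
    apply: cder_eq (cderV (pos1 _) dN) _.
    rewrite add0r conj_sum mulr_suml mulr_sumr -big_split -sumrN mulr_suml.
    apply: eq_bigr => i _ /=; rewrite -/(N _) !conjE expr2 invfM; ring.
Qed.

Lemma sm_bounded f : sm f -> forall r : R, exists M : R,
  forall z, (forall i, normc (X i z) <= r) -> normc (f z) <= M.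
Proof.
move=> + r; elim=> [c|i|{}f _ [M H]|{}f g sf [M H] sg [M' H']
  |{}f g sf [M H] sg [M' H']|{}f sf [M H]].
- by exists (normc c).
- by exists r.
- by exists M => z /H; rewrite normc_conj.
- exists (M + M') => z hz; apply: le_trans (normcD _ _) _; apply: lerD; auto.
- exists (M * M') => z hz; rewrite normcM; apply: ler_pM; rewrite ?normc_ge0; auto.
- exists 1 => z _; rewrite normcV invf_le1 ?pos1_ge1//.
  by apply: lt_le_trans (pos1_ge1 _).
Qed.

Lemma sm_cont f : sm f -> forall z (e : R), 0 < e -> exists2 d : R, 0 < d &
  forall z', (forall i, normc (X i z' - X i z) < d) -> normc (f z' - f z) < e.
Proof.
move=> + z; elim=> [c|i|{}f _ H|{}f g sf H sg H'|{}f g sf H sg H'|{}f sf H] e e0.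
- by exists 1 => // z' _; rewrite subrr normc0.
- by exists e.
- have [d d0 Hd] := H e e0; exists d => // z' /Hd.
  by rewrite -conjN -conjD normc_conj.
- have [d d0 Hd] := H _ (divr_gt0 e0 (ltr0n _ 2)).
  have [d' d0' Hd'] := H' _ (divr_gt0 e0 (ltr0n _ 2)).
  exists (Num.min d d'); first by rewrite lt_min d0.
  move=> z' hz; rewrite opprD addrACA; apply: le_lt_trans (normcD _ _) _.
  rewrite (splitr e); apply: ltrD; [apply: Hd|apply: Hd'] => i.
    by have := hz i; rewrite lt_min => /andP[].
  by have := hz i; rewrite lt_min => /andP[].
- have K0 : 0 < 1 + normc (f z) + normc (g z).
    by have := normc_ge0 (f z); have := normc_ge0 (g z); lra.
  pose e1 := Num.min 1 (e / (1 + normc (f z) + normc (g z))).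
  have e10 : 0 < e1 by rewrite lt_min ltr01 divr_gt0.
  have [d d0 Hd] := H _ e10.
  have [d' d0' Hd'] := H' _ e10.
  exists (Num.min d d'); first by rewrite lt_min d0.
  move=> z' hz.
  have h1 : normc (f z' - f z) < e1.
    by apply: Hd => i; have := hz i; rewrite lt_min => /andP[].
  have h2 : normc (g z' - g z) < e1.
    by apply: Hd' => i; have := hz i; rewrite lt_min => /andP[].
  have -> : f z' * g z' - f z * g z = (f z' - f z) * (g z' - g z) +
     (f z' - f z) * g z + f z * (g z' - g z) by ring.
  have E1 : e1 <= 1 by rewrite ge_min lexx.
  have E2 : e1 * (1 + normc (f z) + normc (g z)) <= e.
    by rewrite -ler_pdivlMr// ge_min lexx orbT.
  apply: le_lt_trans (normcD _ _) _; apply: le_lt_trans (lerD (normcD _ _) (lexx _)) _.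
  rewrite !normcM.
  have := normc_ge0 (f z); have := normc_ge0 (g z).
  have := normc_ge0 (f z' - f z); have := normc_ge0 (g z' - g z).
  move: h1 h2 E1 E2; set x := normc (f z' - f z); set y := normc (g z' - g z).
  set a := normc (f z); set c := normc (g z); move: e1 {e10 Hd Hd' hz K0} => e1.
  nra.
- have K0 : 0 < 1 + 2 * normc (f z) by have := normc_ge0 (f z); lra.
  pose e1 := Num.min 1 (e / (1 + 2 * normc (f z))).
  have e10 : 0 < e1 by rewrite lt_min ltr01 divr_gt0.
  have [d d0 Hd] := H _ e10.
  exists d => // z' /Hd h1.
  have E1 : e1 <= 1 by rewrite ge_min lexx.
  have E2 : e1 * (1 + 2 * normc (f z)) <= e.
    by rewrite -ler_pdivlMr// ge_min lexx orbT.
  set N := 1 + f z' * (f z')^J; set M := 1 + f z * (f z)^J.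
  have -> : N^-1 - M^-1 = (M - N) * (N^-1 * M^-1).
    by field; rewrite !pos1.
  rewrite normcM; apply: (@le_lt_trans _ _ (normc (M - N) * 1)).
    rewrite ler_wpM2l ?normc_ge0// normcM !normcV mulr_ile1 ?invr_ge0 ?normc_ge0//.
    - by rewrite invf_le1 ?pos1_ge1//; apply: lt_le_trans (pos1_ge1 _).
    - by rewrite invf_le1 ?pos1_ge1//; apply: lt_le_trans (pos1_ge1 _).
  rewrite mulr1 normcB.
  have -> : N - M = (f z' - f z) * (f z' - f z)^J +
     (f z' - f z) * (f z)^J + f z * (f z' - f z)^J.
    by rewrite /N /M !conjE; ring.
  apply: le_lt_trans (normcD _ _) _; apply: le_lt_trans (lerD (normcD _ _) (lexx _)) _.
  rewrite !normcM !normc_conj.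
  have := normc_ge0 (f z).
  have := normc_ge0 (f z' - f z).
  move: h1 E1 E2; set x := normc (f z' - f z).
  set a := normc (f z); move: e1 {e10 Hd K0} => e1.
  nra.
Qed.

End smooth_expressions.

Lemma sm_comp (R : realType) (T S : Type) (I J : finType) (X : I -> T -> R[i])
    (Y : J -> S -> R[i]) (tau : S -> T) (f : T -> R[i]) :
  (forall i, sm Y (fun s => X i (tau s))) -> sm X f -> sm Y (fun s => f (tau s)).
Proof.
move=> sX; elim=> [c|i|{}f _|{}f g _ H _ H'|{}f g _ H _ H'|{}f _ H].
- exact: sm_cst.
- exact: sX.
- exact: (@sm_conj _ _ _ Y (fun s => f (tau s))).
- exact: (@sm_add _ _ _ Y (fun s => f (tau s)) (fun s => g (tau s))).
- exact: (@sm_mul _ _ _ Y (fun s => f (tau s)) (fun s => g (tau s))).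
- exact: (@sm_inv _ _ _ Y (fun s => f (tau s))).
Qed.

(** * Wirtinger derivatives and subharmonicity in one variable *)

Section one_variable.
Context {R : realType}.
Local Notation C := R[i].
Local Notation mu := (@lebesgue_measure R).

Definition Xid : unit -> C -> C := fun _ z => z.
Definition sm1 := sm Xid.

(** A and B are df/dz and df/d(conj z), characterized by the chain rule along real
curves; this form composes without any discussion of differentials. *)
Definition wirt (f A B : C -> C) : Prop :=
  forall (x : R -> C) (t : R) (dx : C), cder x t dx ->
    cder (fun s => f (x s)) t (A (x t) * dx + B (x t) * dx^J).

Lemma sm1_wirt f : sm1 f -> exists A B, [/\ sm1 A, sm1 B & wirt f A B].
Proof.
move=> /sm_der[D [D' [sD sD' df]]]; exists (D tt), (D' tt); split => // x t dx dxx.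
have := df x t (fun=> dx) (fun=> dxx).
by rewrite (big_pred1 tt)//; case.
Qed.

(** The directions 1 and i determine both coefficients. *)
Lemma wirt_uniq f A B A' B' : wirt f A B -> wirt f A' B' -> A =1 A' /\ B =1 B'.
Proof.
move=> h h'.
have line (a v : C) : cder (fun s => a + s%:C * v) 0 v.
  apply: cder_eq (cderD (cder_cst a 0) (cderM (cder_real 0) (cder_cst v 0))) _.
  by rewrite add0r mulr0 addr0 mul1r.
have E a v : A a * v + B a * v^J = A' a * v + B' a * v^J.
  have := cder_uniq (h _ _ _ (line a v)) (h' _ _ _ (line a v)).
  by rewrite mul0r addr0.
have i2 : (Ci : C) * Ci = -1 by rewrite -expr2 sqr_i.
have ij : (Ci : C)^J = - Ci by apply: complexP => /=; rewrite ?oppr0.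
have EA a : A a = A' a.
  have := E a 1; have := E a Ci; rewrite ij conj1 !mulr1 => e1 e2.
  have : 2 * A a = 2 * A' a.
    have -> : 2 * A a = (A a + B a) - Ci * (A a * Ci + B a * - Ci).
      transitivity ((A a + B a) - (Ci * Ci) * (A a - B a)); last by ring.
      by rewrite i2; ring.
    rewrite e1 e2.
    transitivity ((A' a + B' a) - (Ci * Ci) * (A' a - B' a)); first by ring.
    by rewrite i2; ring.
  by move/(mulfI _) => -> //; rewrite pnatr_eq0.
by split=> // a; have := E a 1; rewrite EA => /addrI; rewrite conj1 !mulr1.
Qed.

Lemma wirt_conj f A B : wirt f A B ->
  wirt (fun z => (f z)^J) (fun z => (B z)^J) (fun z => (A z)^J).
Proof.
move=> h x t dx dxx; apply: cder_eq (cderJ (h x t dx dxx)) _.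
by rewrite !conjE addrC.
Qed.

Lemma wirt_ext f A B g A' B' : f =1 g -> A =1 A' -> B =1 B' -> wirt f A B -> wirt g A' B'.
Proof. by move=> /funext -> /funext -> /funext ->. Qed.

(** For real f the conjugate of df/dz is df/d(conj z). *)
Lemma wirt_real (u : C -> R) A B : wirt (fun z => (u z)%:C) A B ->
  wirt (fun z => (u z)%:C) A (fun z => (A z)^J).
Proof.
move=> h; have [_ BE] := wirt_uniq h (wirt_ext (fun z => conjR (u z)) (frefl _) (frefl _) (wirt_conj h)).
exact: wirt_ext h.
Qed.

Lemma wirtD f A B g A' B' : wirt f A B -> wirt g A' B' ->
  wirt (fun z => f z + g z) (fun z => A z + A' z) (fun z => B z + B' z).
Proof.
move=> h h' x t dx dxx; apply: cder_eq (cderD (h x t dx dxx) (h' x t dx dxx)) _.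
by ring.
Qed.

Lemma wirtM f A B g A' B' : wirt f A B -> wirt g A' B' ->
  wirt (fun z => f z * g z) (fun z => A z * g z + f z * A' z)
    (fun z => B z * g z + f z * B' z).
Proof.
move=> h h' x t dx dxx; apply: cder_eq (cderM (h x t dx dxx) (h' x t dx dxx)) _.
by ring.
Qed.

Lemma wirt_cst c : wirt (fun=> c) (fun=> 0) (fun=> 0).
Proof. by move=> x t dx dxx; apply: cder_eq (cder_cst c t) _; ring. Qed.

Lemma wirt_id : wirt id (fun=> 1) (fun=> 0).
Proof. by move=> x t dx dxx; apply: cder_eq dxx _; ring. Qed.

Lemma wirt_comp f A B g A' : wirt f A B -> wirt g A' (fun=> 0) ->
  wirt (fun z => f (g z)) (fun z => A (g z) * A' z) (fun z => B (g z) * (A' z)^J).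
Proof.
move=> h h' x t dx dxx; apply: cder_eq (h _ t _ (h' x t dx dxx)) _.
by rewrite mul0r addr0 conjE; ring.
Qed.

Definition cis (t : R) : C := cos t +i* sin t.

Lemma cder_cis t : cder cis t (Ci * cis t).
Proof.
split; rewrite !ReImE /=.
  by rewrite mul0r mul1r sub0r; exact: is_derive_cos.
by rewrite mul0r mul1r add0r; exact: is_derive_sin.
Qed.

Lemma cisJ t : cis t * (cis t)^J = 1.
Proof.
by apply: complexP => /=; have := cos2Dsin2 t; [move=> <-; ring | move=> _; ring].
Qed.

Lemma normc_cis t : normc (cis t) = 1.
Proof. by rewrite /normc /= cos2Dsin2 sqrtr1. Qed.

Lemma cder_continuous (f : R -> C) : (forall t, exists l, cder f t l) ->
  continuous (fun t => Re (f t)).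
Proof.
move=> H; have /choice[l Hl] := H.
apply: (derive_continuous (df := fun t => Re (l t))) => t.
by case: (Hl t).
Qed.

(** Here Cc = d^2 u / dz d(conj z) is a quarter of the Laplacian; polar coordinates
reduce the claim to [circle_mean]. *)
Lemma submean_of_lap (u : C -> R) (A A1 Cc : C -> C) (a : C) (r : R) : 0 < r ->
  sm1 (fun z => (u z)%:C) -> sm1 A -> sm1 A1 -> sm1 Cc ->
  wirt (fun z => (u z)%:C) A (fun z => (A z)^J) -> wirt A A1 Cc ->
  (forall z, normc (z - a) <= r -> 0 <= Re (Cc z)) ->
  2 * pi * u a <= (\int[mu]_(t in `[0, 2 * pi]) u (a + r%:C * cis t))%R.
Proof.
move=> r0 su sA sA1 sC du dA lap.
have pi2 : 0 < 2 * pi :> R by rewrite mulr_gt0// pi_gt0.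
pose z (s t : R) : C := a + s%:C * cis t.
have dzs s t : cder (z ^~ t) s (cis t).
  apply: cder_eq (cderD (cder_cst a s) (cderM (cder_real s) (cder_cst (cis t) s))) _.
  by ring.
have dzt s t : cder (z s) t (s%:C * (Ci * cis t)).
  apply: cder_eq (cderD (cder_cst a t) (cderM (cder_cst s%:C t) (cder_cis t))) _.
  by ring.
have ij : (Ci : C)^J = - Ci by apply: complexP => /=; rewrite ?oppr0.
have ii : (Ci : C) * Ci = -1 by rewrite -expr2 sqr_i.
have Re2 (w : C) : Re (w + w^J) = 2 * Re w by rewrite !ReImE; ring.
have n2 : normc (2 : C) = 2.
  have -> : (2 : C) = (2 : R)%:C by rewrite rmorph_nat.
  by rewrite normcR ger0_norm.
pose f1 s t := Re (2 * (A (z s t) * cis t)).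
pose m1 s t := Re (2 * (A (z s t) * cis t) + s%:C * (2 * ((A1 (z s t) * cis t + Cc (z s t) * (cis t)^J) * cis t))).
pose q s t := Re (2 * (A (z s t) * (s%:C * (Ci * cis t)))).
pose dq s t := Re (2 * ((A1 (z s t) * (s%:C * (Ci * cis t)) + Cc (z s t) * (s%:C * (Ci * cis t))^J) * (s%:C * (Ci * cis t))
   + A (z s t) * (s%:C * (Ci * (Ci * cis t))))).
have Ez0 t : z 0 t = a by rewrite /z mul0r addr0.
have dAs s t := dA _ _ _ (dzs s t).
have dAt s t := dA _ _ _ (dzt s t).
have bnd (g : C -> C) : sm1 g -> forall r : R, exists M, 0 <= M /\ forall s t, `|s| <= r -> normc (g (z s t)) <= M.
  move=> sg r1; have [M HM] := sm_bounded sg (normc a + r1).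
  exists `|M|; split=> // s t hs; apply: le_trans (ler_norm _); apply: HM; case.
  apply: le_trans (normcD _ _) _; rewrite lerD2l normcM normcR normc_cis mulr1//.
have E0 : (\int[mu]_(t in `[0%R, (2 * pi)%R]) u (z 0 t))%R = 2 * pi * u a.
  transitivity ((\int[mu]_(t in `[0%R, (2 * pi)%R]) (u a))%R).
    by apply: eq_Rintegral => t _; rewrite Ez0.
  by rewrite Rint_cst// mulrC.
rewrite -E0.
apply: (@circle_mean R (2 * pi) r (fun s t => u (z s t)) f1 m1 q dq pi2 r0).
- move=> s t; have [h _] := du _ _ _ (dzs s t).
  apply: (is_derive_eq h); rewrite /f1 -conjM Re2 !ReImE /=; ring.
- move=> s t.
  have h2 : cder (fun s => 2 * (A (z s t) * cis t)) s (2 * ((A1 (z s t) * cis t + Cc (z s t) * (cis t)^J) * cis t)).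
    apply: cder_eq (cderM (cder_cst 2 s) (cderM (dAs s t) (cder_cst (cis t) s))) _; ring.
  have [h _] := cderM (cder_real s) h2.
  rewrite (_ : (fun s0 => s0 * f1 s0 t) = (fun s0 => Re (s0%:C * (2 * (A (z s0 t) * cis t))))); last first.
    by apply/funext => s0; rewrite /f1 [in RHS]ReM /= mul0r subr0.
  by apply: (is_derive_eq h); rewrite /m1 mul1r.
- move=> s t.
  have dE : cder (fun t => s%:C * (Ci * cis t)) t (s%:C * (Ci * (Ci * cis t))).
    apply: cder_eq (cderM (cder_cst s%:C t) (cderM (cder_cst Ci t) (cder_cis t))) _; ring.
  have [h _] := cderM (cder_cst 2 t) (cderM (dAt s t) dE).
  by apply: (is_derive_eq h); rewrite /dq mul0r add0r.
- move=> s; apply: (cder_continuous (f := fun t => (u (z s t))%:C)) => t.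
  by eexists; exact: du (dzt s t).
- move=> s; apply: cder_continuous => t; eexists.
  exact: cderM (cder_cst 2 t) (cderM (dAt s t) (cder_cis t)).
- move=> s; apply: cder_continuous => t.
  have [B1 [B2 [_ _ dA1]]] := sm1_wirt sA1.
  have [B3 [B4 [_ _ dC]]] := sm1_wirt sC.
  have k1 := dA1 _ _ _ (dzt s t); have k2 := dC _ _ _ (dzt s t).
  eexists; exact: (cderD (cderM (cder_cst 2 t) (cderM (dAt s t) (cder_cis t)))
    (cderM (cder_cst s%:C t) (cderM (cder_cst 2 t) (cderM (cderD (cderM k1 (cder_cis t)) (cderM k2 (cderJ (cder_cis t)))) (cder_cis t))))).
- move=> s; apply: cder_continuous => t.
  have [B1 [B2 [_ _ dA1]]] := sm1_wirt sA1.
  have [B3 [B4 [_ _ dC]]] := sm1_wirt sC.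
  have k1 := dA1 _ _ _ (dzt s t); have k2 := dC _ _ _ (dzt s t).
  have dE : cder (fun t => s%:C * (Ci * cis t)) t (s%:C * (Ci * (Ci * cis t))).
    apply: cder_eq (cderM (cder_cst s%:C t) (cderM (cder_cst Ci t) (cder_cis t))) _; ring.
  have dE2 : cder (fun t => s%:C * (Ci * (Ci * cis t))) t (s%:C * (Ci * (Ci * (Ci * cis t)))).
    apply: cder_eq (cderM (cder_cst s%:C t) (cderM (cder_cst Ci t) (cderM (cder_cst Ci t) (cder_cis t)))) _; ring.
  eexists; exact: (cderM (cder_cst 2 t) (cderD (cderM (cderD (cderM k1 dE) (cderM k2 (cderJ dE))) dE) (cderM (dAt s t) dE2))).
- move=> r1; have [M [M0 HM]] := bnd A sA r1; exists (2 * M) => s t hs.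
  apply: le_trans (Re_le_normc _) _; rewrite !normcM normc_cis mulr1.
  by rewrite n2 ler_pM2l//; exact: HM.
- move=> r1; have [M [M0 HM]] := bnd A sA r1; have [M1 [M10 HM1]] := bnd A1 sA1 r1.
  have [M2 [M20 HM2]] := bnd Cc sC r1.
  exists (2 * M + r1 * (2 * (M1 + M2))) => s t hs.
  apply: le_trans (Re_le_normc _) _; apply: le_trans (normcD _ _) _.
  rewrite !normcM normc_cis !mulr1 n2 normcR; apply: lerD; first by rewrite ler_pM2l//; exact: HM.
  apply: ler_pM => //; first by rewrite mulr_ge0// normc_ge0.
  rewrite ler_pM2l//; apply: le_trans (normcD _ _) _.
  by rewrite !normcM normc_conj normc_cis !mulr1; apply: lerD; [exact: HM1|exact: HM2].
- move=> s; rewrite /q /z /cis.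
  by rewrite (mulr_natl pi 2) cos2pi sin2pi cos0 sin0.
- move=> s t /andP[s0 sr].
  have lz : 0 <= Re (Cc (z s t)).
    apply: lap; rewrite /z addrC addKr normcM normcR normc_cis mulr1 ger0_norm//.
  have -> : s * m1 s t + dq s t = 4 * s ^+ 2 * Re (Cc (z s t)).
    have -> : s * m1 s t = Re (s%:C * (2 * (A (z s t) * cis t) + s%:C * (2 * ((A1 (z s t) * cis t + Cc (z s t) * (cis t)^J) * cis t)))).
      by rewrite [in RHS]ReM /= mul0r subr0.
    have -> : 4 * s ^+ 2 * Re (Cc (z s t)) = Re ((4 * s ^+ 2)%:C * Cc (z s t)).
      by rewrite [in RHS]ReM /= mul0r subr0.
    rewrite /dq -ReD; congr Re.
    have -> : (4 * s ^+ 2)%:C = 4 * s%:C ^+ 2 * (cis t * (cis t)^J).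
      by rewrite cisJ mulr1 rmorphM rmorphXn rmorph_nat.
    rewrite !conjE ij.
    set c := cis t; set cj := c^J; set A' := A _; set A1' := A1 _; set C' := Cc _; set s' := s%:C.
    transitivity (s' * (2 * (A' * c) + s' * (2 * ((A1' * c + C' * cj) * c))) + 2 * ((Ci * Ci) * (A1' * s'^+2 * c ^+2 - C' * s' ^+ 2 * (cj * c) + A' * s' * c))).
      by ring.
    by rewrite ii; ring.
  by rewrite !mulr_ge0// sqr_ge0.
Qed.

Lemma nbhs_normc (z : C) (d : R) : 0 < d -> nbhs z [set z' | normc (z' - z) < d].
Proof.
move=> d0; apply/nbhs_ballP; exists d%:C => /=; first by rewrite ltcR.
by move=> y; rewrite -ball_normE /ball_ /= normE ltcR normcB.
Qed.

Lemma nbhs_normcP (z : C) (V : set C) : nbhs z V ->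
  exists2 d : R, 0 < d & forall z', normc (z' - z) < d -> V z'.
Proof.
move=> /nbhs_ballP[e /= e0 H]; have eR : e = (Re e)%:C.
  by apply: complexP => //=; move: e0; rewrite ltcE => /andP[/eqP].
exists (Re e); first by move: e0; rewrite eR ltcR.
move=> z' hz; apply: H; rewrite -ball_normE /ball_ /= normE eR ltcR normcB; exact: hz.
Qed.

Lemma nbhs_normc2 (z : C * C) (d : R) : 0 < d ->
  nbhs z [set z' | normc (z'.1 - z.1) < d /\ normc (z'.2 - z.2) < d].
Proof.
move=> d0; exists ([set w | normc (w - z.1) < d], [set w | normc (w - z.2) < d]).
  by split; exact: nbhs_normc.
by move=> [w1 w2] [].
Qed.

Lemma nbhs_normc2P (z : C * C) (V : set (C * C)) : nbhs z V ->
  exists2 d : R, 0 < d & forall z', normc (z'.1 - z.1) < d -> normc (z'.2 - z.2) < d -> V z'.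
Proof.
move=> [[V1 V2] /= [/nbhs_normcP[d d0 Hd] /nbhs_normcP[d' d0' Hd']] HV].
exists (Num.min d d'); first by rewrite lt_min d0.
move=> z'; rewrite !lt_min => /andP[h1 _] /andP[_ h2].
by apply: HV; split; [exact: Hd|exact: Hd'].
Qed.

Lemma usc_of_eps (V : topologicalType) (u : V -> R) :
  (forall z (e : R), 0 < e -> \forall z' \near z, `|u z' - u z| < e) -> usc u.
Proof.
move=> H z a; rewrite lte_fin => az; have e0 : 0 < - u z - a by rewrite subr_gt0.
exists [set z' | `|u z' - u z| < - u z - a]; first exact: H.
by move=> y /=; rewrite ltr_norml lte_fin => /andP[_]; lra.
Qed.

Lemma usc_sm1 (u : C -> R) : sm1 (fun z => (u z)%:C) -> usc u.
Proof.
move=> su; apply: usc_of_eps => z e e0; have [d d0 Hd] := sm_cont su z e0.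
near=> z'; have : normc (z' - z) < d by near: z'; exact: nbhs_normc.
move=> h; have := Hd z' (fun=> h); rewrite -rmorphB normcR; exact.
Unshelve. all: by end_near. Qed.

Lemma circle_integral (u : C -> R) (a : C) (r : R) : sm1 (fun z => (u z)%:C) ->
  (\int[mu]_(t in `[0%R, (2 * pi)%R]) (u (a + r%:C * (cos t +i* sin t)))%:E =
   ((\int[mu]_(t in `[0%R, (2 * pi)%R]) u (a + r%:C * cis t))%R)%:E)%E.
Proof.
move=> su; rewrite /Rintegral fineK//; apply: integrable_fin_num => //.
apply: (@cont_integrable _ _ (fun t => u (a + r%:C * cis t))).
apply: (cder_continuous (f := fun t => (u (a + r%:C * cis t))%:C)) => t.
have [A [B [_ _ du]]] := sm1_wirt su.
eexists; apply: (du (fun t => a + r%:C * cis t)).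
exact: (cderD (cder_cst a t) (cderM (cder_cst r%:C t) (cder_cis t))).
Qed.

Lemma subharmonic_of_lap (u : C -> R) A A1 Cc :
  sm1 (fun z => (u z)%:C) -> sm1 A -> sm1 A1 -> sm1 Cc ->
  wirt (fun z => (u z)%:C) A (fun z => (A z)^J) -> wirt A A1 Cc ->
  (forall z, 0 <= Re (Cc z)) -> subharmonic u.
Proof.
move=> su sA sA1 sC du dA lap; split; first exact: usc_sm1.
move=> a r r0; rewrite circle_integral// lee_fin.
by apply: (submean_of_lap r0 su sA sA1 sC du dA) => z _; exact: lap.
Qed.

(** If Cc were negative at a, then -u - e |z - a|^2 would satisfy the sub-mean value
inequality on a small disc, against the inequality for u: the two means would
differ by e r^2. *)
Lemma lap_of_subharmonic (u : C -> R) A A1 Cc :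
  sm1 (fun z => (u z)%:C) -> sm1 A -> sm1 A1 -> sm1 Cc ->
  wirt (fun z => (u z)%:C) A (fun z => (A z)^J) -> wirt A A1 Cc ->
  subharmonic u -> forall z, 0 <= Re (Cc z).
Proof.
move=> su sA sA1 sC du dA [_ sub] a; rewrite leNgt; apply/negP => neg.
set e := - Re (Cc a) / 2; have e0 : 0 < e by rewrite /e; lra.
have [d d0 Hd] := sm_cont sC a e0.
pose r := d / 2; have r0 : 0 < r by rewrite divr_gt0.
(* near a the Laplacian of v is positive *)
pose v (z : C) : R := - u z - e * normc (z - a) ^+ 2.
have sza : sm1 (fun z => z - a) by exact: (sm_add (sm_X Xid tt) (sm_cst Xid (- a))).
have E z : (v z)%:C = - (u z)%:C + (- e%:C) * ((z - a) * (z - a)^J).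
  by rewrite mulcJ /v rmorphB rmorphN rmorphM; ring.
have sv : sm1 (fun z => (v z)%:C).
  apply: sm_ext (fun z => esym (E z)) _; apply: sm_add; first exact: sm_opp.
  by apply: sm_mul; [exact: sm_cst|apply: sm_mul => //; exact: sm_conj].
pose A' z := - A z + (- e%:C) * (z - a)^J.
pose A1' z := - A1 z.
pose C' z := - Cc z + (- e%:C).
have dza : wirt (fun z => z - a) (fun=> 1) (fun=> 0).
  by apply: wirt_ext (wirtD wirt_id (wirt_cst (- a))) => // z; rewrite addr0.
have dzaJ : wirt (fun z => (z - a)^J) (fun=> 0) (fun=> 1).
  by apply: wirt_ext (wirt_conj dza) => // z; rewrite ?conj0 ?conj1.
have dopp (f F G : C -> C) : wirt f F G -> wirt (fun z => - f z) (fun z => - F z) (fun z => - G z).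
  move=> h; apply: wirt_ext (wirtM (wirt_cst (-1)) h) => z; ring.
have dv : wirt (fun z => (v z)%:C) A' (fun z => (A' z)^J).
  apply: wirt_real.
  apply: (wirt_ext (fun z => esym (E z)) _ (frefl _) (wirtD (dopp _ _ _ du) (wirtM (wirt_cst (- e%:C)) (wirtM dza dzaJ)))).
  by move=> z; rewrite /A'; ring.
have dA' : wirt A' A1' C'.
  apply: wirt_ext (wirtD (dopp _ _ _ dA) (wirtM (wirt_cst (- e%:C)) dzaJ)) => // z; rewrite /A1' /C'; ring.
have sA' : sm1 A'.
  apply: sm_add; first exact: sm_opp.
  by apply: sm_mul; [exact: sm_cst|exact: sm_conj].
have sA1' : sm1 A1' by exact: sm_opp.
have sC' : sm1 C' by apply: sm_add; [exact: sm_opp|exact: sm_cst].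
have := submean_of_lap r0 sv sA' sA1' sC' dv dA'.
have lap z : normc (z - a) <= r -> 0 <= Re (C' z).
  move=> hz; have : normc (Cc z - Cc a) < e.
    by apply: Hd; case; apply: le_lt_trans hz _; rewrite /r; lra.
  move=> /(le_lt_trans (Re_le_normc _)); rewrite ltr_norml ReD ReN /C' ReD !ReN /= /e; lra.
move=> /(_ _ lap); rewrite leNgt => /negP; apply.
have := sub a r r0; rewrite circle_integral// lee_fin => sub1.
have pi2 : 0 < 2 * pi :> R by rewrite mulr_gt0// pi_gt0.
have cu : continuous (fun t => u (a + r%:C * cis t)).
  apply: (cder_continuous (f := fun t => (u (a + r%:C * cis t))%:C)) => t.
  eexists; apply: (du (fun t => a + r%:C * cis t)).
  exact: (cderD (cder_cst a t) (cderM (cder_cst r%:C t) (cder_cis t))).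
rewrite (_ : (\int[mu]_(t in `[0%R, (2 * pi)%R]) v (a + r%:C * cis t))%R =
   (\int[mu]_(t in `[0%R, (2 * pi)%R]) (- (e * r ^+ 2) - u (a + r%:C * cis t)))%R); last first.
  apply: eq_Rintegral => t _; rewrite /v addrC; congr (_ - _).
  by rewrite addrC addKr normcM normcR normc_cis mulr1 ger0_norm// ltW.
rewrite RintegralB//; last 2 first.
- by apply: cont_integrable; exact: cst_continuous.
- exact: cont_integrable.
rewrite Rint_cst// /v subrr normc0 expr0n /= mulr0 subr0.
have : 0 < e * r ^+ 2 * (2 * pi) by rewrite mulr_gt0// mulr_gt0// exprn_gt0.
move: sub1; nra.
Qed.

End one_variable.

(** * Smooth functions on C^2 *)

Section two_variables.
Context {R : realType}.
Local Notation C := R[i].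

Definition X2 : bool -> C * C -> C := fun b z => if b then z.1 else z.2.
Definition sm2 := sm X2.

Lemma sm2_bool f : sm2 f -> exists D D' E E', [/\ sm2 D, sm2 D', sm2 E, sm2 E' &
  forall (x y : R -> C) t dx dy, cder x t dx -> cder y t dy ->
    cder (fun s => f (x s, y s)) t
      (D (x t, y t) * dx + D' (x t, y t) * dx^J + E (x t, y t) * dy + E' (x t, y t) * dy^J)].
Proof.
move=> /sm_der[D [D' [sD sD' df]]]; exists (D true), (D' true), (D false), (D' false).
split=> // x y t dx dy dxx dyy.
have := df (fun s => (x s, y s)) t (fun b => if b then dx else dy).
rewrite big_bool /= addrA; apply; case; exact.
Qed.

Lemma sm2_nbhs f : sm2 f -> forall z (e : R), 0 < e -> \forall z' \near z, normc (f z' - f z) < e.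
Proof.
move=> sf z e e0; have [d d0 Hd] := sm_cont sf z e0.
near=> z'; have : normc (z'.1 - z.1) < d /\ normc (z'.2 - z.2) < d.
  by near: z'; exact: nbhs_normc2.
by move=> [h1 h2]; apply: Hd; case.
Unshelve. all: by end_near. Qed.

Lemma continuous_of_eps (V : topologicalType) (u : V -> R) z :
  (forall (e : R), 0 < e -> \forall z' \near z, `|u z' - u z| < e) ->
  {for z, continuous u}.
Proof.
move=> H; apply/cvgrPdist_lt => e e0; near=> z'; rewrite distrC; near: z'; exact: H.
Unshelve. all: by end_near. Qed.

Lemma sm2_near f : sm2 (fun z => (f z)%:C) -> forall z (e : R), 0 < e -> \forall z' \near z, `|f z' - f z| < e.
Proof.
move=> sf z e e0; near=> z'; rewrite -normcR rmorphB; near: z'.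
exact: (sm2_nbhs sf).
Unshelve. all: by end_near. Qed.

Lemma sm2_usc f : sm2 (fun z => (f z)%:C) -> usc f.
Proof. by move=> sf; apply: usc_of_eps => z e; exact: sm2_near. Qed.

Lemma sm2_Re f : sm2 f -> sm2 (fun z => (Re (f z))%:C).
Proof.
move=> sf; apply: sm_ext (sm_mul (sm_add sf (sm_conj sf)) (sm_cst X2 2^-1)) => z.
have -> : f z + (f z)^J = 2 * (Re (f z))%:C.
  by case: (f z) => a b; apply: complexP => /=; ring.
by rewrite mulrC mulrA mulVf ?mul1r// pnatr_eq0.
Qed.

(** Directional derivatives stay in the class, so induction on the order applies. *)
Lemma sm2_smooth (f : C * C -> R) : sm2 (fun z => (f z)%:C) -> smooth f.
Proof.
move=> + n; elim: n f => [|n ih] f sf /=.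
  by split=> // z _; apply: continuous_of_eps; exact: sm2_near.
split; first by move=> z _; apply: continuous_of_eps; exact: sm2_near.
have [D [D' [E [E' [sD sD' sE sE' df]]]]] := sm2_bool sf.
move=> v; pose g z := Re (D z * v.1 + D' z * (v.1)^J + E z * v.2 + E' z * (v.2)^J).
have dg z : is_derive (0 : R) (1 : R) (rline f v z) (g z).
  have line (a w : C) : cder (fun s => a + s%:C * w) 0 w.
    apply: cder_eq (cderD (cder_cst a 0) (cderM (cder_real 0) (cder_cst w 0))) _.
    by rewrite add0r mulr0 addr0 mul1r.
  have [h _] := df _ _ 0 _ _ (line z.1 v.1) (line z.2 v.2).
  by apply: (is_derive_eq h); rewrite /g !mul0r !addr0; case: z {h}.
split; first by move=> z _; case: (dg z).
have -> : rderive v f = g by apply/funext => z; rewrite /rderive derive_val.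
apply: ih; apply: sm2_Re; do !apply: sm_add; apply: sm_mul => //; exact: sm_cst.
Qed.

Lemma sm2_line f (a b : C * C) : sm2 f -> sm1 (fun w => f (a + w *: b)).
Proof.
apply: sm_comp => -[] /=.
  exact: (sm_add (sm_cst _ a.1) (sm_mul (sm_X Xid tt) (sm_cst _ b.1))).
exact: (sm_add (sm_cst _ a.2) (sm_mul (sm_X Xid tt) (sm_cst _ b.2))).
Qed.

End two_variables.

(** * Polynomials in z and its conjugate *)

Section lines.
Context {R : realType}.
Local Notation C := R[i].

(** Restriction to a complex line turns identities in several variables into
identities of univariate polynomials, together with their derivatives. *)
Lemma line_poly n (q : mpoly.mpoly n C) (v0 v1 : 'I_n -> C) :
  exists p : {poly C}, forall s,
    p.[s] = mpoly.meval (fun i => v0 i + s * v1 i) q /\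
    p^`().[s] = \sum_i v1 i * mpoly.meval (fun i => v0 i + s * v1 i) (mpoly.mderiv i q).
Proof.
elim/mpoly_ring_ind: q => [c|i|p q [P HP] [Q HQ]|p q [P HP] [Q HQ]].
- exists c%:P => s; rewrite mpoly.mevalC hornerC derivC horner0; split=> //.
  by rewrite big1 // => i _; rewrite mpoly.mderivC mpoly.meval0 mulr0.
- exists ((v0 i)%:P + v1 i *: 'X) => s; rewrite mpoly.mevalXU !hornerE; split; first by rewrite mulrC.
  rewrite derivD derivC derivZ derivX !hornerE (bigD1 i)//= big1 ?addr0 => [|j ji].
    rewrite mpoly.mderivX mpoly.mnm1E eqxx scale1r.
    rewrite (_ : mpoly.mnm_sub _ _ = mpoly.mnm0); last first.
      by apply/mpoly.mnmP => j; rewrite mpoly.mnmBE mpoly.mnm0E subnn.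
    by rewrite mpoly.mpolyX0 mpoly.meval1 mulr1.
  by rewrite mpoly.mderivX mpoly.mnm1E eq_sym (negbTE ji) scale0r mpoly.meval0 mulr0.
- exists (P + Q) => s; have [P1 P2] := HP s; have [Q1 Q2] := HQ s.
  have dE : (P + Q)^`().[s] = P^`().[s] + Q^`().[s] by rewrite derivD hornerD.
  rewrite dE hornerD mpoly.mevalD P1 P2 Q1 Q2; split; first by [].
  by rewrite -big_split; apply: eq_bigr => i _; rewrite mpoly.mderivD mpoly.mevalD mulrDr.
- exists (P * Q) => s; have [P1 P2] := HP s; have [Q1 Q2] := HQ s.
  have dE : (P * Q)^`().[s] = P^`().[s] * Q.[s] + P.[s] * Q^`().[s].
    by rewrite derivM hornerD !hornerM.
  rewrite dE hornerM mpoly.mevalM P1 P2 Q1 Q2; split; first by [].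
  rewrite mulr_suml mulr_sumr -big_split; apply: eq_bigr => i _ /=.
  by rewrite mpoly.mderivM mpoly.mevalD !mpoly.mevalM; exact: leibnizl.
Qed.

Lemma poly_real_roots (p : {poly C}) (r : R) : 0 < r ->
  (forall s : R, `|s| < r -> p.[s%:C] = 0) -> p = 0.
Proof.
move=> r0 H; apply/eqP; apply/negPn/negP => p0.
pose rs := [seq (r / k.+2%:R)%:C | k <- iota 0 (size p)].
have := max_poly_roots p0 (rs := rs); rewrite size_map size_iota ltnn => h.
suff : false by []. apply: h.
  apply/allP => x /mapP[k _ ->]; rewrite rootE H//.
  rewrite ger0_norm ?divr_ge0 ?ltW// ltr_pdivrMr ?ltr0n// ltr_pMr//.
  by rewrite ltr1n.
rewrite map_inj_uniq ?iota_uniq// => i j [] /(mulfI (lt0r_neq0 r0)).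
by move/invr_inj/eqP; rewrite eqr_nat => /eqP[].
Qed.

Lemma line_zero n (q : mpoly.mpoly n C) (v0 v1 : 'I_n -> C) (r : R) : 0 < r ->
  (forall s : R, `|s| < r -> mpoly.meval (fun i => v0 i + s%:C * v1 i) q = 0) ->
  forall s : C, mpoly.meval (fun i => v0 i + s * v1 i) q = 0.
Proof.
move=> r0 H s; have [p Hp] := line_poly q v0 v1.
have [<- _] := Hp s; rewrite (poly_real_roots (p := p) r0) ?horner0// => t /H <-.
by have [-> _] := Hp t%:C.
Qed.

End lines.

HB.lock Definition ev (R : realType) (q : mpoly.mpoly 4 R[i]) (z1 z2 w1 w2 : R[i]) : R[i] :=
  mpoly.meval (tnth [tuple z1; z2; w1; w2]) q.

(** Derivative in the i-th of the variables z1, z2, w1, w2, numbered from 0. *)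
HB.lock Definition dvar (R : realType) (i : nat) (q : mpoly.mpoly 4 R[i]) : mpoly.mpoly 4 R[i] :=
  mpoly.mderiv (inord i) q.

Local Notation dz1 := (dvar 0).
Local Notation dz2 := (dvar 1).
Local Notation dw1 := (dvar 2).
Local Notation dw2 := (dvar 3).

Section four_variables.
Context {R : realType}.
Local Notation C := R[i].

Lemma evE (q : mpoly.mpoly 4 C) z1 z2 w1 w2 : ev q z1 z2 w1 w2 = mpoly.meval (tnth [tuple z1; z2; w1; w2]) q.
Proof. by rewrite ev.unlock. Qed.

Lemma ord4P (P : 'I_4 -> Prop) : P (inord 0) -> P (inord 1) -> P (inord 2) -> P (inord 3) -> forall i, P i.
Proof.
move=> P0 P1 P2 P3 [[|[|[|[|//]]]] Hi].
- by rewrite (_ : Ordinal Hi = inord 0)//; apply: val_inj; rewrite /= inordK.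
- by rewrite (_ : Ordinal Hi = inord 1)//; apply: val_inj; rewrite /= inordK.
- by rewrite (_ : Ordinal Hi = inord 2)//; apply: val_inj; rewrite /= inordK.
- by rewrite (_ : Ordinal Hi = inord 3)//; apply: val_inj; rewrite /= inordK.
Qed.

Lemma tnth4 (T : Type) (a b c d : T) :
  [/\ tnth [tuple a; b; c; d] (inord 0) = a, tnth [tuple a; b; c; d] (inord 1) = b,
      tnth [tuple a; b; c; d] (inord 2) = c & tnth [tuple a; b; c; d] (inord 3) = d].
Proof. by split; rewrite (tnth_nth a)//= inordK. Qed.

(** With z_j = a_j + s_j + i t_j and w_j = conj a_j + s_j - i t_j the hypothesis says
that q vanishes for small real s_j, t_j; one variable at a time, it then vanishes
for all complex values, and every (z, w) has this form. *)
Lemma polarize (q : mpoly.mpoly 4 C) (a1 a2 : C) (r : R) : 0 < r ->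
  (forall z1 z2, normc (z1 - a1) < r -> normc (z2 - a2) < r -> ev q z1 z2 z1^J z2^J = 0) ->
  forall z1 z2 w1 w2, ev q z1 z2 w1 w2 = 0.
Proof.
move=> r0 H.
pose V (s1 t1 s2 t2 : C) : 'I_4 -> C := tnth [tuple a1 + (s1 + Ci * t1); a2 + (s2 + Ci * t2);
   a1^J + (s1 - Ci * t1); a2^J + (s2 - Ci * t2)].
have ii : (Ci : C) * Ci = -1 by rewrite -expr2 sqr_i.
have ij : (Ci : C)^J = - Ci by apply: complexP => /=; rewrite ?oppr0.
have r2 : 0 < r / 2 by rewrite divr_gt0.
have H0 (s1 t1 s2 t2 : R) : `|s1| < r/2 -> `|t1| < r/2 -> `|s2| < r/2 -> `|t2| < r/2 ->
  mpoly.meval (V s1%:C t1%:C s2%:C t2%:C) q = 0.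
  have nst (s t : R) : `|s| < r/2 -> `|t| < r/2 -> normc (s%:C + Ci * t%:C) < r.
    move=> hs ht; apply: le_lt_trans (normcD _ _) _; rewrite normcM !normcR normc_i mul1r; lra.
  move=> h1 h2 h3 h4; rewrite -[RHS](H (a1 + (s1%:C + Ci * t1%:C)) (a2 + (s2%:C + Ci * t2%:C))).
  - by rewrite evE /V !conjE ij !mulNr.
  - by rewrite addrC addKr; exact: nst.
  - by rewrite addrC addKr; exact: nst.
have ext (d v0 : 'I_4 -> C) (W : C -> 'I_4 -> C) : (forall s, W s =1 (fun i => v0 i + s * d i)) ->
   (forall s : R, `|s| < r/2 -> mpoly.meval (W s%:C) q = 0) -> forall s, mpoly.meval (W s) q = 0.
  move=> WE h s; rewrite (mpoly.meval_eq _ (WE s)); apply: (line_zero (r := r/2)) => // t /h <-.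
  by apply: mpoly.meval_eq => i; rewrite WE.
have H1 (s1 : C) (t1 s2 t2 : R) : `|t1| < r/2 -> `|s2| < r/2 -> `|t2| < r/2 ->
  mpoly.meval (V s1 t1%:C s2%:C t2%:C) q = 0.
  move=> h2 h3 h4; move: s1; apply: (ext (tnth [tuple 1; 0; 1; 0]) (V 0 t1%:C s2%:C t2%:C)).
    move=> s; have [e1 e2 e3 e4] := tnth4 (1 : C) 0 1 0.
    by apply: ord4P; rewrite /V ?e1 ?e2 ?e3 ?e4 !(tnth_nth 0) /= ?inordK//=; ring.
  by move=> s hs; apply: H0.
have H2 (s1 t1 : C) (s2 t2 : R) : `|s2| < r/2 -> `|t2| < r/2 ->
  mpoly.meval (V s1 t1 s2%:C t2%:C) q = 0.
  move=> h3 h4; move: t1; apply: (ext (tnth [tuple Ci; 0; - Ci; 0]) (V s1 0 s2%:C t2%:C)).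
    move=> s; apply: ord4P; rewrite /V !(tnth_nth 0) /= ?inordK//=; ring.
  by move=> s hs; apply: H1.
have H3 (s1 t1 s2 : C) (t2 : R) : `|t2| < r/2 ->
  mpoly.meval (V s1 t1 s2 t2%:C) q = 0.
  move=> h4; move: s2; apply: (ext (tnth [tuple 0; 1; 0; 1]) (V s1 t1 0 t2%:C)).
    move=> s; apply: ord4P; rewrite /V !(tnth_nth 0) /= ?inordK//=; ring.
  by move=> s hs; apply: H2.
have H4 (s1 t1 s2 t2 : C) : mpoly.meval (V s1 t1 s2 t2) q = 0.
  move: t2; apply: (ext (tnth [tuple 0; Ci; 0; - Ci]) (V s1 t1 s2 0)).
    move=> s; apply: ord4P; rewrite /V !(tnth_nth 0) /= ?inordK//=; ring.
  by move=> s hs; apply: H3.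
move=> z1 z2 w1 w2.
pose S (z w a : C) := (z - a + (w - a^J)) / 2.
pose T (z w a : C) := - Ci * (z - a - (w - a^J)) / 2.
have n2 : (2 : C) != 0 by rewrite pnatr_eq0.
have E1 z w a : a + (S z w a + Ci * T z w a) = z.
  transitivity (a + (z - a + (w - a^J)) / 2 - (Ci * Ci) * (z - a - (w - a^J)) / 2).
    by rewrite /S /T; ring.
  by rewrite ii; field.
have E2 z w a : a^J + (S z w a - Ci * T z w a) = w.
  transitivity (a^J + (z - a + (w - a^J)) / 2 + (Ci * Ci) * (z - a - (w - a^J)) / 2).
    by rewrite /S /T; ring.
  by rewrite ii; field.
by rewrite evE; have := H4 (S z1 w1 a1) (T z1 w1 a1) (S z2 w2 a2) (T z2 w2 a2); rewrite /V !E1 !E2.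
Qed.

Lemma big_ord4 (F : 'I_4 -> C) :
  \sum_i F i = F (inord 0) + F (inord 1) + F (inord 2) + F (inord 3).
Proof.
rewrite !big_ord_recl big_ord0 addr0 !addrA; congr (_ + _ + _ + _); congr F; apply: val_inj;
  by rewrite /= inordK.
Qed.

Lemma cder_ev q (z1 z2 w1 w2 : R -> C) t a1 a2 b1 b2 :
  cder z1 t a1 -> cder z2 t a2 -> cder w1 t b1 -> cder w2 t b2 ->
  cder (fun s => ev q (z1 s) (z2 s) (w1 s) (w2 s)) t
   (ev (dz1 q) (z1 t) (z2 t) (w1 t) (w2 t) * a1 + ev (dz2 q) (z1 t) (z2 t) (w1 t) (w2 t) * a2
    + ev (dw1 q) (z1 t) (z2 t) (w1 t) (w2 t) * b1 + ev (dw2 q) (z1 t) (z2 t) (w1 t) (w2 t) * b2).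
Proof.
move=> h1 h2 h3 h4.
pose x (i : 'I_4) s := tnth [tuple z1 s; z2 s; w1 s; w2 s] i.
pose dx (i : 'I_4) := tnth [tuple a1; a2; b1; b2] i.
rewrite !evE.
rewrite (_ : (fun s => ev q _ _ _ _) = (fun s => mpoly.meval (x^~ s) q)); last first.
  by apply/funext => s; rewrite evE.
have := @cder_mpoly R 4 q x t dx; rewrite big_ord4 /dx !dvar.unlock.
have [-> -> -> ->] := tnth4 a1 a2 b1 b2; apply.
have [d1 d2 d3 d4] := tnth4 a1 a2 b1 b2.
by apply: ord4P; rewrite /x ?d1 ?d2 ?d3 ?d4;
 [apply: cder_ext h1 | apply: cder_ext h2|apply: cder_ext h3|apply: cder_ext h4] => s;
 have [e1 e2 e3 e4] := tnth4 (z1 s) (z2 s) (w1 s) (w2 s).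
Qed.

Lemma ev_sm2 q (T : Type) (I : finType) (X : I -> T -> C) (f1 f2 f3 f4 : T -> C) :
  sm X f1 -> sm X f2 -> sm X f3 -> sm X f4 -> sm X (fun z => ev q (f1 z) (f2 z) (f3 z) (f4 z)).
Proof.
move=> s1 s2 s3 s4.
apply: (sm_ext (fun z => esym (evE q (f1 z) (f2 z) (f3 z) (f4 z)))).
apply: (sm_mpoly q (x := fun i z => tnth [tuple f1 z; f2 z; f3 z; f4 z] i)).
apply: ord4P; [apply: sm_ext s1|apply: sm_ext s2|apply: sm_ext s3|apply: sm_ext s4] => z;
by have [e1 e2 e3 e4] := tnth4 (f1 z) (f2 z) (f3 z) (f4 z).
Qed.

End four_variables.

(** * The Levi form *)

Section levi_form.
Context {R : realType}.
Local Notation C := R[i].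
Implicit Types (q p : mpoly.mpoly 4 C) (a b z : C * C).

Definition evr q z := ev q z.1 z.2 z.1^J z.2^J.

Lemma evr_sm2 q : sm2 (evr q).
Proof.
apply: ev_sm2; [exact: (sm_X X2 true)|exact: (sm_X X2 false)
 |exact: (sm_conj (sm_X X2 true))|exact: (sm_conj (sm_X X2 false))].
Qed.

Lemma cder_evr q (x y : R -> C) t dx dy : cder x t dx -> cder y t dy ->
  cder (fun s => evr q (x s, y s)) t
    (evr (dz1 q) (x t, y t) * dx + evr (dz2 q) (x t, y t) * dy
     + evr (dw1 q) (x t, y t) * dx^J + evr (dw2 q) (x t, y t) * dy^J).
Proof. by move=> h1 h2; apply: cder_ev => //; exact: cderJ. Qed.

Lemma wirt_evr_line q a b : wirt (fun w => evr q (a + w *: b))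
  (fun w => evr (dz1 q) (a + w *: b) * b.1 + evr (dz2 q) (a + w *: b) * b.2)
  (fun w => evr (dw1 q) (a + w *: b) * b.1^J + evr (dw2 q) (a + w *: b) * b.2^J).
Proof.
move=> x t dx dxx.
have line (c d : C) : cder (fun s => c + x s * d) t (dx * d).
  apply: cder_eq (cderD (cder_cst c t) (cderM dxx (cder_cst d t))) _; ring.
apply: cder_eq (cder_evr q (line a.1 b.1) (line a.2 b.2)) _.
by rewrite !conjE /evr /=; ring.
Qed.

(** The complex Hessian of p(z, conj z), as a Hermitian form in b. *)
Definition levi p z b := evr (dw1 (dz1 p)) z * b.1 * b.1^J + evr (dw2 (dz1 p)) z * b.1 * b.2^J
  + evr (dw1 (dz2 p)) z * b.2 * b.1^J + evr (dw2 (dz2 p)) z * b.2 * b.2^J.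

(** Restrict to the complex line through z with direction b. *)
Lemma levi_ge0 p (P : C * C -> R) : is_real_poly2 p P -> plurisubharmonic P ->
  forall z b, 0 <= Re (levi p z b).
Proof.
move=> pP [_ psh] a b.
have E w : (P (a + w *: b))%:C = evr p (a + w *: b) by rewrite pP /evr evE.
pose f w := evr p (a + w *: b).
have sev q : sm1 (fun w => evr q (a + w *: b)) by apply: sm2_line; exact: evr_sm2.
have d0 := wirt_ext (fun w => esym (E w)) (frefl _) (frefl _) (wirt_evr_line p a b).
pose A (w : C) := evr (dz1 p) (a + w *: b) * b.1 + evr (dz2 p) (a + w *: b) * b.2.
have dw (d : mpoly.mpoly 4 C) c := wirtM (wirt_evr_line d a b) (wirt_cst c).
have dA := wirtD (dw (dz1 p) b.1) (dw (dz2 p) b.2).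
have su : sm1 (fun w => (P (a + w *: b))%:C) by apply: sm_ext (sev p) => w; rewrite E.
have [A1 [B1 [sA1 sB1 dA']]] : exists A1 B1, [/\ sm1 A1, sm1 B1 & wirt A A1 B1].
  by apply: sm1_wirt; apply: sm_add; apply: sm_mul; first [exact: sev|exact: sm_cst].
have [_ BE] := wirt_uniq dA dA'.
have := lap_of_subharmonic su _ sA1 sB1 (wirt_real d0) dA' (psh a b) 0.
rewrite -BE !scale0r !addr0 /levi => h.
have -> : forall m11 m12 m21 m22 : C, m11 * b.1 * b.1^J + m12 * b.1 * b.2^J
  + m21 * b.2 * b.1^J + m22 * b.2 * b.2^J = (m11 * b.1^J + m12 * b.2^J) * b.1 + 0 + ((m21 * b.1^J + m22 * b.2^J) * b.2 + 0).
  by move=> *; ring.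
move: h; rewrite !mulr0; apply.
by apply: sm_add; apply: sm_mul; first [exact: sev|exact: sm_cst].
Qed.

Lemma evr_conj_deriv q q' : (forall z, (evr q z)^J = evr q' z) ->
  forall z, [/\ (evr (dz1 q) z)^J = evr (dw1 q') z, (evr (dz2 q) z)^J = evr (dw2 q') z,
    (evr (dw1 q) z)^J = evr (dz1 q') z & (evr (dw2 q) z)^J = evr (dz2 q') z].
Proof.
move=> H z.
have K b : ((evr (dw1 q) z * b.1^J + evr (dw2 q) z * b.2^J)^J = evr (dz1 q') z * b.1 + evr (dz2 q') z * b.2)
  /\ ((evr (dz1 q) z * b.1 + evr (dz2 q) z * b.2)^J = evr (dw1 q') z * b.1^J + evr (dw2 q') z * b.2^J).
  have h := wirt_ext (fun w => H (z + w *: b)) (frefl _) (frefl _) (wirt_conj (wirt_evr_line q z b)).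
  have [h1 h2] := wirt_uniq h (wirt_evr_line q' z b).
  by have := h1 0; have := h2 0; rewrite !scale0r !addr0 => -> ->.
have [k1 k2] := K (1, 0); have [k3 k4] := K (0, 1).
by move: k1 k2 k3 k4; rewrite /fst /snd !conjE !mulr1 !mulr0 !addr0 !add0r => -> -> -> ->.
Qed.

Lemma levi_herm p (P : C * C -> R) : is_real_poly2 p P -> forall z,
  [/\ (evr (dw1 (dz1 p)) z)^J = evr (dw1 (dz1 p)) z,
      (evr (dw2 (dz1 p)) z)^J = evr (dw1 (dz2 p)) z,
      (evr (dw1 (dz2 p)) z)^J = evr (dw2 (dz1 p)) z &
      (evr (dw2 (dz2 p)) z)^J = evr (dw2 (dz2 p)) z].
Proof.
move=> pP z; have h0 w : (evr p w)^J = evr p w by rewrite /evr evE -pP conjR.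
have h1 w : (evr (dz1 p) w)^J = evr (dw1 p) w by have [] := evr_conj_deriv h0 w.
have h2 w : (evr (dz2 p) w)^J = evr (dw2 p) w by have [] := evr_conj_deriv h0 w.
have [_ _ k1 k2] := evr_conj_deriv h1 z.
have [_ _ k3 k4] := evr_conj_deriv h2 z.
by rewrite k1 k2 k3 k4 !dvar.unlock; split; congr (evr _ z); exact: mpoly.mderiv_comm.
Qed.

(** For every c the function s -> L(v + s c) = 2 s Re h(v, c) + s^2 L(c) of a real s
is nonnegative, so Re h(v, c) = 0; replace c by i c for the imaginary part. *)
Lemma levi_kernel p (P : C * C -> R) : is_real_poly2 p P -> plurisubharmonic P ->
  forall z v, Re (levi p z v) = 0 ->
    evr (dw1 (dz1 p)) z * v.1 + evr (dw1 (dz2 p)) z * v.2 = 0 /\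
    evr (dw2 (dz1 p)) z * v.1 + evr (dw2 (dz2 p)) z * v.2 = 0.
Proof.
move=> pP psh z v v0; have [j1 j2 j3 j4] := levi_herm pP z.
have pos := levi_ge0 pP psh z.
pose h (c : C * C) := evr (dw1 (dz1 p)) z * v.1 * c.1^J + evr (dw2 (dz1 p)) z * v.1 * c.2^J
  + evr (dw1 (dz2 p)) z * v.2 * c.1^J + evr (dw2 (dz2 p)) z * v.2 * c.2^J.
have E (s : R) c : levi p z (v.1 + s%:C * c.1, v.2 + s%:C * c.2) =
   levi p z v + s%:C * (h c + (h c)^J) + s%:C ^+ 2 * levi p z c.
  rewrite /levi /h /= !conjE j1 j2 j3 j4; ring.
have hr c : Re (h c) = 0.
  have hs (s : R) : 0 <= s * (2 * Re (h c)) + s ^+ 2 * Re (levi p z c).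
    have := pos (v.1 + s%:C * c.1, v.2 + s%:C * c.2); rewrite E.
    have -> : s%:C ^+ 2 = (s ^+ 2)%:C by rewrite rmorphXn.
    rewrite ReD ReD v0 add0r (ReM s%:C) (ReM (s ^+ 2)%:C) /= !mul0r !subr0 ReD ReJ.
    by rewrite [2 * _]mulr_natl mulr2n.
  have k0 : 0 <= Re (levi p z c) by exact: pos.
  move: hs k0; set x := Re (h c); set k := Re (levi p z c) => hs k0.
  (* x = Re h(v, c) and k = L(c) >= 0; this s makes the quadratic negative unless x = 0 *)
  have := hs (- x / (1 + k)); rewrite (_ : _ + _ = - x ^+ 2 * (2 + k) / (1 + k) ^+ 2); last first.
    by field; lra.
  rewrite pmulr_lge0 ?invr_gt0 ?exprn_gt0//; last lra.
  nra.
have h0 c : h c = 0.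
  apply: complexP; first by rewrite hr.
  have := hr (Ci * c.1, Ci * c.2); rewrite (_ : h _ = - Ci * h c).
    by rewrite ReM ReN ImN /=; lra.
  have ij : (Ci : C)^J = - Ci by apply: complexP => /=; rewrite ?oppr0.
  by rewrite /h /= !conjE ij; ring.
have := h0 (1, 0); have := h0 (0, 1); rewrite /h /fst /snd !conjE !mulr1 !mulr0 !addr0 !add0r.
by move=> k1 k2; split.
Qed.

End levi_form.

(** * The holomorphic implicit function theorem *)

Section implicit_functions.
Context {R : realType}.
Local Notation C := R[i].

Lemma cmvt_le (f f' : R -> C) (M : R) : 0 <= M -> (forall t : R, 0 <= t <= 1 -> cder f t (f' t)) ->
  (forall t : R, 0 <= t <= 1 -> normc (f' t) <= M) -> normc (f 1 - f 0) <= M.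
Proof.
move=> M0 df bf; pose D := f 1 - f 0.
have [D0|D0] := eqVneq D 0; first by rewrite -/D D0 normc0.
have nD : 0 < normc D by rewrite normc_gt0.
pose phi t := Re (D^J * f t).
have dphi (t : R) : 0 <= t <= 1 -> is_derive t 1 phi (Re (D^J * f' t)).
  move=> ht; have [h _] := cderM (cder_cst D^J t) (df t ht).
  by apply: (is_derive_eq h); rewrite mul0r add0r.
have [||c] := @MVT R phi (fun t => Re (D^J * f' t)) 0 1 ltr01.
- by move=> x; rewrite in_itv /= => /andP[x0 x1]; apply: dphi; rewrite !ltW.
- apply: derivable_within_continuous => x; rewrite in_itv /= => hx.
  by case: (dphi x hx).
rewrite in_itv /= => /andP[c0 c1]; rewrite subr0 mulr1 /phi -ReN -ReD -mulrBr -/D mulrC mulcJ /=.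
move=> E; rewrite -/D -(ler_pM2l nD) -expr2 E.
apply: le_trans (ler_norm _) _; apply: le_trans (Re_le_normc _) _.
by rewrite normcM normc_conj ler_pM2l// bf// !ltW.
Qed.

Lemma le0_geometric (x K : R) : (forall n, x <= K / 2 ^+ n) -> x <= 0.
Proof.
move=> H; rewrite leNgt; apply/negP => x0.
have K0 : 0 < K by have := H 0; rewrite expr0 divr1; apply: lt_le_trans.
have := archi_boundP (ltW (divr_gt0 K0 x0)); set n := Num.bound _ => hn.
have := H n; rewrite ler_pdivlMr ?exprn_gt0// leNgt => /negP; apply.
rewrite mulrC -ltr_pdivrMr//; apply: (lt_le_trans hn).
by rewrite -natrX ler_nat ltnW// ltn_expl.
Qed.

Lemma real_geometric_limit (x : nat -> R) (M : R) :
  (forall n, `|x n.+1 - x n| <= M / 2 ^+ n) -> exists l, forall n, `|x n - l| <= 2 * M / 2 ^+ n.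
Proof.
move=> H; pose a n := x n - 2 * M / 2 ^+ n; pose b n := x n + 2 * M / 2 ^+ n.
have E n : 2 * M / 2 ^+ n = 2 * M / 2 ^+ n.+1 + M / 2 ^+ n.
  by rewrite exprS; field; rewrite expf_neq0.
have an n m : a n <= a (n + m)%N.
  elim: m => [|m ih]; first by rewrite addn0.
  apply: le_trans ih _; rewrite addnS; have := H (n + m)%N; rewrite ler_norml /a (E (n + m)%N); lra.
have bn n m : b (n + m)%N <= b n.
  elim: m => [|m ih]; first by rewrite addn0.
  apply: le_trans _ ih; rewrite addnS; have := H (n + m)%N; rewrite ler_norml /b (E (n + m)%N); lra.
have M0 : 0 <= M by have := H 0; rewrite expr0 divr1; apply: le_trans.
have ab n m : a n <= b m.
  apply: le_trans (an n m) _; apply: le_trans _ (bn m n); rewrite addnC /a /b.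
  have : 0 <= 2 * M / 2 ^+ (m + n) by rewrite divr_ge0 ?mulr_ge0 ?exprn_ge0.
  lra.
have ubA m : ubound (range a) (b m) by move=> _ [n _ <-].
exists (sup (range a)) => n.
have h1 : a n <= sup (range a).
  by apply: ub_le_sup; [exists (b 0)|exists n].
have h2 : sup (range a) <= b n.
  by apply: ge_sup => //; exists (a 0), 0.
by rewrite ler_norml; move: h1 h2; rewrite /a /b; lra.
Qed.

Lemma complex_geometric_limit (y : nat -> C) (M : R) :
  (forall n, normc (y n.+1 - y n) <= M / 2 ^+ n) -> exists l, forall n, normc (y n - l) <= 4 * M / 2 ^+ n.
Proof.
move=> H.
have [lr Hr] := real_geometric_limit (x := fun n => Re (y n)) (M := M)
  (fun n => ltac:(rewrite -ReN -ReD; exact: le_trans (Re_le_normc _) (H n))).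
have [li Hi] := real_geometric_limit (x := fun n => Im (y n)) (M := M)
  (fun n => ltac:(rewrite -ImN -ImD; exact: le_trans (Im_le_normc _) (H n))).
exists (lr +i* li) => n; apply: le_trans (normc_le_ReIm _) _.
rewrite !ReImE /=; apply: le_trans (lerD (Hr n) (Hi n)) _.
by rewrite -mulrDl -mulrDl -natrD.
Qed.

(** Picard iteration; the strict bound on T b - b keeps the limit in the open disc. *)
Lemma disc_fixed_point (T : C -> C) (b : C) (d : R) : 0 < d ->
  (forall x y, normc (x - b) <= d -> normc (y - b) <= d -> normc (T x - T y) <= normc (x - y) / 2) ->
  normc (T b - b) < d / 2 ->
  exists l, normc (l - b) < d /\ T l = l.
Proof.
move=> d0 Tc Tb.
have Tin x : normc (x - b) <= d -> normc (T x - b) < d.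
  move=> hx; apply: le_lt_trans (normc_tri (T b) _ _) _.
  have hb : normc (b - b) <= d by rewrite subrr normc0 ltW.
  have := Tc x b hx hb; lra.
pose y n := iter n T b.
have yin n : normc (y n - b) <= d.
  by elim: n => [|n ih] /=; [rewrite subrr normc0 ltW|apply/ltW/Tin].
have ystep n : normc (y n.+1 - y n) <= d / 2 ^+ n.
  elim: n => [|n ih]; first by rewrite expr0 divr1 /=; lra.
  apply: le_trans (Tc _ _ (yin n.+1) (yin n)) _; rewrite exprS invfM mulrCA mulrC.
  by rewrite ler_wpM2l ?invr_ge0.
have [l Hl] := complex_geometric_limit ystep.
have lb : normc (l - b) <= d.
  rewrite -subr_le0; apply: (@le0_geometric _ (4 * d)) => n.
  rewrite lerBlDr; apply: le_trans (normc_tri (y n) _ _) _.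
  by rewrite normcB; apply: lerD.
have E : T l = l.
  apply/eqP; rewrite -subr_eq0; apply/eqP/eq0_normc/eqP; rewrite eq_le normc_ge0 andbT.
  apply: (@le0_geometric _ (8 * d)) => n.
  apply: le_trans (normc_tri (y n.+1) _ _) _.
  have h1 : normc (T l - y n.+1) <= normc (l - y n) / 2 by exact: Tc.
  have h2 := Hl n; have := Hl n.+1; rewrite exprS invfM; rewrite normcB in h2.
  set q := (2 ^+ n)^-1 in h2 *; have q0 : 0 <= q by rewrite invr_ge0 exprn_ge0.
  move: h1 h2 => h1 h2 h3; have := mulr_ge0 (ltW d0) q0; nra.
by exists l; split=> //; rewrite -E; exact: Tin.
Qed.

Section implicit_function.
Variables (k K1 K2 : C -> C -> C).
Hypothesis K2c : forall a b (e : R), 0 < e -> exists2 d : R, 0 < d &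
  forall z w, normc (z - a) < d -> normc (w - b) < d -> normc (K2 z w - K2 a b) < e.
Hypothesis kd : forall a b (e : R), 0 < e -> exists2 d : R, 0 < d &
  forall s t, normc s < d -> normc t < d ->
    normc (k (a + s) (b + t) - k a b - (K1 a b * s + K2 a b * t)) <= e * (normc s + normc t).

Lemma frechet_cont a b (e : R) : 0 < e -> exists2 d : R, 0 < d &
  forall z w, normc (z - a) < d -> normc (w - b) < d -> normc (k z w - k a b) < e.
Proof.
move=> e0; have [d d0 Hd] := kd a b ltr01.
pose L := 1 + normc (K1 a b) + normc (K2 a b).
have L0 : 0 < L by have := normc_ge0 (K1 a b); have := normc_ge0 (K2 a b); rewrite /L; lra.
exists (Num.min d (e / (2 * L))); first by rewrite lt_min d0 divr_gt0// mulr_gt0.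
move=> z w; rewrite !lt_min => /andP[z1 z2] /andP[w1 w2].
have := Hd _ _ z1 w1; rewrite !subrKC mul1r.
set s := z - a; set t := w - b => h.
have h1 : normc (k z w - k a b) <= normc s + normc t + normc (K1 a b * s + K2 a b * t).
  by rewrite -{1}[k z w - k a b](subrK (K1 a b * s + K2 a b * t)); apply: le_trans (normcD _ _) _; rewrite lerD2r.
have h2 : normc (K1 a b * s + K2 a b * t) <= normc (K1 a b) * normc s + normc (K2 a b) * normc t.
  by apply: le_trans (normcD _ _) _; rewrite !normcM.
rewrite !ltr_pdivlMr ?mulr_gt0// -/s -/t in z2 w2.
move: z2 w2; rewrite /L; have := normc_ge0 s; have := normc_ge0 t.
have := normc_ge0 (K1 a b); have := normc_ge0 (K2 a b).
move: h1 h2; set x := normc s; set y := normc t; set A := normc (K1 a b); set B := normc (K2 a b).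
move=> *; nra.
Qed.

Lemma cder_partial2 a b w t : cder (fun s => k a (b + s%:C * w)) t (K2 a (b + t%:C * w) * w).
Proof.
apply/cderP => e e0.
have w0 : 0 < 1 + normc w by have := normc_ge0 w; lra.
have [d d0 Hd] := kd a (b + t%:C * w) (divr_gt0 e0 w0).
exists (d / (1 + normc w)); first by rewrite divr_gt0.
move=> h; rewrite ltr_pdivlMr// => hh.
have n0 : normc (0 : C) < d by rewrite normc0.
have hw : normc (h%:C * w) < d.
  by rewrite normcM normcR; apply: le_lt_trans hh; rewrite ler_wpM2l// lerDr.
have := Hd 0 (h%:C * w) n0 hw; rewrite addr0 mulr0 add0r normc0 add0r.
have -> : b + t%:C * w + h%:C * w = b + (t + h)%:C * w by rewrite rmorphD; ring.
move=> H; have -> : h%:C * (K2 a (b + t%:C * w) * w) = K2 a (b + t%:C * w) * (h%:C * w) by ring.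
apply: le_trans H _; rewrite normcM normcR mulrAC -mulrA ler_pM2l//.
by rewrite -mulrA ler_piMr// ler_pdivrMr// mul1r lerDr.
Qed.

Variables (a b : C) (r : R).
Hypothesis r0 : 0 < r.

(** For z near a the Newton-like map w -> w - (k z w - c) / K2 a b halves distances,
and its fixed point is g z c. The same estimate, applied to two points, bounds
w - w' by the difference of the values of k z. *)
Lemma implicit_function : K2 a b != 0 -> exists (ep de ga M : R) (g : C -> C -> C),
  [/\ 0 < ep < r, 0 < de < r, 0 < ga, 0 < M &
   [/\ forall z c, normc (z - a) < ep -> normc (c - k a b) < ga ->
        normc (g z c - b) < de /\ k z (g z c) = c,
      forall z w w', normc (z - a) < ep -> normc (w - b) < de -> normc (w' - b) < de ->
        normc (w - w') <= M * normc (k z w - k z w') &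
      forall z w, normc (z - a) < ep -> normc (w - b) < de -> K2 z w != 0]].
Proof.
set l := K2 a b => K20; have nl : 0 < normc l by rewrite normc_gt0.
have [d1 d10 Hd1] := K2c a b (divr_gt0 nl (ltr0n _ 2)).
pose de := Num.min d1 r / 2.
have m0 : 0 < Num.min d1 r by rewrite lt_min d10.
have de0 : 0 < de by rewrite divr_gt0.
have de1 : de < d1.
  have : Num.min d1 r <= d1 by rewrite ge_min lexx.
  by rewrite /de; lra.
have der : de < r.
  have : Num.min d1 r <= r by rewrite ge_min lexx orbT.
  by rewrite /de; lra.
have q0 : 0 < normc l * de / 4 by rewrite divr_gt0// mulr_gt0.
have [d2 d20 Hd2] := frechet_cont a b q0.
pose ep := Num.min (Num.min d1 d2) r / 2.
have m0' : 0 < Num.min (Num.min d1 d2) r by rewrite !lt_min d10 d20.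
have ep0 : 0 < ep by rewrite divr_gt0.
have ep1 : ep < d1.
  have : Num.min (Num.min d1 d2) r <= d1 by rewrite !ge_min lexx.
  by rewrite /ep; lra.
have ep2 : ep < d2.
  have : Num.min (Num.min d1 d2) r <= d2 by rewrite !ge_min lexx orbT.
  by rewrite /ep; lra.
have epr : ep < r.
  have : Num.min (Num.min d1 d2) r <= r by rewrite !ge_min lexx !orbT.
  by rewrite /ep; lra.
have near_l z w : normc (z - a) < ep -> normc (w - b) <= de -> normc (K2 z w - l) < normc l / 2.
  by move=> hz hw; apply: Hd1; [apply: lt_trans hz ep1|apply: le_lt_trans hw de1].
have contr z c w w' : normc (z - a) < ep -> normc (w - b) <= de -> normc (w' - b) <= de ->
    normc ((w - (k z w - c) / l) - (w' - (k z w' - c) / l)) <= normc (w - w') / 2.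
  move=> hz hw hw'.
  pose f (t : R) := (w' + t%:C * (w - w')) - (k z (w' + t%:C * (w - w')) - c) / l.
  pose f' (t : R) := (w - w') - (K2 z (w' + t%:C * (w - w')) * (w - w')) / l.
  have df t : cder f t (f' t).
    have h1 : cder (fun t => w' + t%:C * (w - w')) t (w - w').
      apply: cder_eq (cderD (cder_cst w' t) (cderM (cder_real t) (cder_cst (w - w') t))) _; ring.
    apply: cder_eq (cderB h1 (cderM (cderB (cder_partial2 z w' (w - w') t) (cder_cst c t)) (cder_cst l^-1 t))) _.
    by rewrite /f'; ring.
  have -> : w - (k z w - c) / l - (w' - (k z w' - c) / l) = f 1 - f 0.
    by rewrite /f mul0r addr0 mul1r subrKC.
  apply: (cmvt_le (f' := f')) => //; first by rewrite divr_ge0// normc_ge0.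
  move=> t /andP[t0 t1].
  have hin : normc (w' + t%:C * (w - w') - b) <= de.
    have -> : w' + t%:C * (w - w') - b = (1 - t)%:C * (w' - b) + t%:C * (w - b).
      by rewrite rmorphB; ring.
    apply: le_trans (normcD _ _) _; rewrite !normcM !normcR !ger0_norm ?subr_ge0//; nra.
  have -> : f' t = (w - w') * (l - K2 z (w' + t%:C * (w - w'))) / l.
    by rewrite /f'; field.
  rewrite !normcM normcV -mulrA ler_wpM2l ?normc_ge0// ler_pdivrMr//.
  by rewrite normcB [leRHS]mulrC; exact/ltW/near_l.
have fp z c : normc (z - a) < ep -> normc (c - k a b) < normc l * de / 4 ->
   exists w, normc (w - b) < de /\ k z w = c.
  move=> hz hc.
  have [||w [hw Ew]] := @disc_fixed_point (fun w => w - (k z w - c) / l) b de de0.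
  - by move=> x y hx hy; exact: contr.
  - rewrite addrC addKr normcN normcM normcV ltr_pdivrMr//.
    apply: le_lt_trans (normc_tri (k a b) _ _) _.
    have h1 : normc (k z b - k a b) < normc l * de / 4.
      by apply: Hd2; [apply: lt_trans hz ep2|rewrite subrr normc0].
    rewrite normcB in hc; lra.
  - exists w; split=> //; move/eqP: Ew; rewrite -subr_eq0 addrC addKr oppr_eq0 mulf_eq0.
    by rewrite invr_eq0 (negbTE K20) orbF subr_eq0 => /eqP.
have /choice[g Hg] : forall zc : C * C, exists w, normc (zc.1 - a) < ep -> normc (zc.2 - k a b) < normc l * de / 4 ->
    normc (w - b) < de /\ k zc.1 w = zc.2.
  move=> [z c] /=.
  have [hz|hz] := ltP (normc (z - a)) ep; last by exists 0.
  have [hc|hc] := ltP (normc (c - k a b)) (normc l * de / 4); last by exists 0.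
  by have [w hw] := fp z c hz hc; exists w.
exists ep, de, (normc l * de / 4), (2 / normc l), (fun z c => g (z, c)).
split; [by rewrite ep0|by rewrite de0|exact: q0|by rewrite divr_gt0|split].
- by move=> z c hz hc; exact: (Hg (z, c)).
- move=> z w w' hz hw hw'; have := contr z 0 w w' hz (ltW hw) (ltW hw').
  rewrite !subr0 => h.
  have : normc (w - w') <= normc (w - k z w / l - (w' - k z w' / l)) + normc (k z w - k z w') / normc l.
    rewrite -normcV -normcM; apply: le_trans (normcD _ _).
    by rewrite le_eqVlt; apply/orP; left; apply/eqP; congr normc; ring.
  rewrite mulrAC -mulrA; lra.
- move=> z w hz hw; apply/eqP => E; have := near_l z w hz (ltW hw).
  by rewrite E sub0r normcN; lra.
Qed.

End implicit_function.
End implicit_functions.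

(** * Limits, and equality of mixed partials *)

Section tends.
Context {R : realType}.
Local Notation C := R[i].

Definition tends {T : Type} (F : set_system T) (f : T -> C) (l : C) : Prop :=
  forall e : R, 0 < e -> \forall x \near F, normc (f x - l) < e.

Section tends_filter.
Context {T : Type} {F : set_system T} {FF : Filter F}.
Implicit Types (f g : T -> C) (l m : C).

Lemma tends_cst l : tends F (fun=> l) l.
Proof. by move=> e e0; near=> x; rewrite subrr normc0. Unshelve. all: by end_near. Qed.

Lemma tends_ext f g l : f =1 g -> tends F f l -> tends F g l.
Proof. by move=> /funext ->. Qed.

Lemma tends_near f g l : (\forall x \near F, f x = g x) -> tends F f l -> tends F g l.
Proof.
move=> fg fl e e0; near=> x.
have <- : f x = g x by near: x.
near: x; exact: fl.
Unshelve. all: by end_near. Qed.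

Lemma tends_sm (S : Type) (I : finType) (X : I -> S -> C) (q : S -> C) (x : T -> S) (y : S) :
  sm X q -> (forall i, tends F (fun t => X i (x t)) (X i y)) ->
  tends F (fun t => q (x t)) (q y).
Proof.
move=> sq H e e0; have [d d0 Hd] := sm_cont sq y e0.
have K : \forall t \near F, forall i, normc (X i (x t) - X i y) < d.
  by apply: filter_forall => i; exact: H.
by apply: filterS K => t Ht; exact: Hd.
Qed.

Lemma tends_bool (q : C * C -> C) f g l m : sm2 q -> tends F f l -> tends F g m ->
  tends F (fun t => q (f t, g t)) (q (l, m)).
Proof. by move=> sq fl gm; apply: (tends_sm (x := fun t => (f t, g t)) (y := (l, m)) sq); case. Qed.

Lemma tendsD f g l m : tends F f l -> tends F g m -> tends F (fun t => f t + g t) (l + m).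
Proof.
exact: (@tends_bool (fun z => z.1 + z.2) _ _ _ _ (sm_add (sm_X X2 true) (sm_X X2 false))).
Qed.

Lemma tendsM f g l m : tends F f l -> tends F g m -> tends F (fun t => f t * g t) (l * m).
Proof.
exact: (@tends_bool (fun z => z.1 * z.2) _ _ _ _ (sm_mul (sm_X X2 true) (sm_X X2 false))).
Qed.

Lemma tendsJ f l : tends F f l -> tends F (fun t => (f t)^J) l^J.
Proof.
move=> fl; exact: (@tends_bool (fun z => z.1^J) _ _ _ _ (sm_conj (sm_X X2 true)) fl fl).
Qed.

Lemma tendsN f l : tends F f l -> tends F (fun t => - f t) (- l).
Proof.
move=> fl; exact: (@tends_bool (fun z => - z.1) _ _ _ _ (sm_opp (sm_X X2 true)) fl fl).
Qed.

Lemma tendsV f l : l != 0 -> tends F f l -> tends F (fun t => (f t)^-1) l^-1.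
Proof.
move=> l0 fl e e0; have nl : 0 < normc l by rewrite normc_gt0.
pose d := Num.min (normc l / 2) (e * normc l ^+ 2 / 2).
have d0 : 0 < d by rewrite lt_min !divr_gt0// mulr_gt0// exprn_gt0.
apply: filterS (fl d d0) => t; rewrite lt_min => /andP[h1 h2].
have ft : normc l / 2 < normc (f t).
  by have := normc_tri (f t) l 0; rewrite !subr0 normcB; lra.
have nf : 0 < normc (f t) by lra.
have f0 : f t != 0 by rewrite -normc_gt0.
have -> : (f t)^-1 - l^-1 = (l - f t) / (f t * l) by field; rewrite f0 l0.
rewrite normcM normcV ltr_pdivrMr ?normcM ?mulr_gt0// normcB; apply: (lt_trans h2).
rewrite -[ltLHS]mulrA ltr_pM2l// expr2; nra.
Qed.

Lemma tends_real (f : T -> R) (l : R) : f @ F --> l -> tends F (fun t => (f t)%:C) l%:C.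
Proof.
move=> /cvgrPdist_lt fl e e0; near=> t; rewrite -rmorphB normcR distrC; near: t; exact: fl.
Unshelve. all: by end_near. Qed.

End tends_filter.

(** Equality of mixed partials in Peano's form: the hypotheses give the derivative of
fs in t, and differentiability of ft in s is part of the conclusion. This is
what the derivative dg/dc = 1 / K2 needs, as K2 is only known to be continuous. *)
Lemma schwarz (f fs fts : R -> R -> C) (ft : R -> C) (r : R) : 0 < r ->
  (forall s t : R, `|s| < r -> `|t| < r -> cder (f^~ t) s (fs s t)) ->
  (forall s t : R, `|s| < r -> `|t| < r -> cder (fs s) t (fts s t)) ->
  (forall s : R, `|s| < r -> cder (f s) 0 (ft s)) ->
  (forall e : R, 0 < e -> exists2 d : R, 0 < d & forall s t : R, `|s| < d -> `|t| < d ->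
     normc (fts s t - fts 0 0) <= e) ->
  cder ft 0 (fts 0 0).
Proof.
move=> r0 dfs dfts dft cts; set l := fts 0 0.
apply/cderP => e e0; have [d d0 Hd] := cts e e0.
exists (Num.min d r); first by rewrite lt_min d0.
move=> s; rewrite lt_min add0r => /andP[sd sr].
have scale (x y : R) (z : R) : 0 <= z <= 1 -> `|x| < y -> `|z * x| < y.
  move=> /andP[z0 z1] xy; rewrite normrM (ger0_norm z0); apply: le_lt_trans xy.
  by rewrite ler_piMl.
(* the mean value theorem, used in s and then in t, estimates the second difference *)
have Delta t : `|t| < d -> `|t| < r ->
    normc (f s t - f s 0 - (f 0 t - f 0 0) - s%:C * t%:C * l) <= e * `|s| * `|t|.
  move=> td tr.
  pose h (x : R) := f (x * s) t - f (x * s) 0 - x%:C * (s%:C * t%:C * l).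
  have dls (x : R) : is_derive x 1 (fun x => x * s) s.
    have := @is_deriveM _ _ (id : R -> R) (cst s) x 1 _ _ (is_derive_id _ _) (is_derive_cst _ _ _).
    by move=> hh; apply: (is_derive_eq hh); rewrite /GRing.scale /= mulr0 add0r mulr1.
  have dlt (x : R) : is_derive x 1 (fun x => x * t) t.
    have := @is_deriveM _ _ (id : R -> R) (cst t) x 1 _ _ (is_derive_id _ _) (is_derive_cst _ _ _).
    by move=> hh; apply: (is_derive_eq hh); rewrite /GRing.scale /= mulr0 add0r mulr1.
  pose h' (x : R) := (fs (x * s) t - fs (x * s) 0 - t%:C * l) * s%:C.
  have dh (x : R) : 0 <= x <= 1 -> cder h x (h' x).
    move=> hx; have xs := scale _ _ _ hx sr.
    have n0 : `|0 : R| < r by rewrite normr0.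
    have h1 := @cder_comp R (f^~ t) _ x _ _ (dls x) (dfs _ _ xs tr).
    have h2 := @cder_comp R (f^~ 0) _ x _ _ (dls x) (dfs _ _ xs n0).
    apply: cder_eq (cderB (cderB h1 h2) (cderM (cder_real x) (cder_cst _ x))) _.
    by rewrite /h'; ring.
  have E : f s t - f s 0 - (f 0 t - f 0 0) - s%:C * t%:C * l = h 1 - h 0.
    by rewrite /h !mul0r !mul1r subr0; ring.
  rewrite E; apply: (cmvt_le (f' := h')) => //; first by rewrite !mulr_ge0// ltW.
  move=> x hx; rewrite /h' normcM normcR mulrAC ler_wpM2r//.
  have xs := scale _ _ _ hx sr; have xd := scale _ _ _ hx sd.
  pose k (y : R) := fs (x * s) (y * t) - y%:C * (t%:C * l).
  pose k' (y : R) := (fts (x * s) (y * t) - l) * t%:C.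
  have -> : fs (x * s) t - fs (x * s) 0 - t%:C * l = k 1 - k 0.
    by rewrite /k !mul0r !mul1r subr0; ring.
  apply: (cmvt_le (f' := k')) => //; first by rewrite mulr_ge0// ltW.
    move=> y hy; have yt := scale _ _ _ hy tr.
    have h1 := @cder_comp R (fs (x * s)) _ y _ _ (dlt y) (dfts _ _ xs yt).
    apply: cder_eq (cderB h1 (cderM (cder_real y) (cder_cst _ y))) _.
    by rewrite /k'; ring.
  move=> y hy; have yt := scale _ _ _ hy td.
  by rewrite /k' normcM normcR ler_wpM2r// Hd.
suff H : forall e', 0 < e' -> normc (ft s - ft 0 - s%:C * l) <= e * `|s| + 2 * e'.
  apply/ler_addgt0Pl => e' e'0; have := H (e' / 2) (divr_gt0 e'0 (ltr0n _ 2)).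
  have -> : 2 * (e' / 2) = e' by field.
  by rewrite [e' + _]addrC.
move=> e' e'0.
have n0 : `|0 : R| < r by rewrite normr0.
have [d1 d10 H1] := (cderP _ _ _).1 (dft s sr) _ e'0.
have [d2 d20 H2] := (cderP _ _ _).1 (dft 0 n0) _ e'0.
(* any small t > 0 serves: the error terms are divided by t at the end *)
pose t := Num.min (Num.min d r) (Num.min d1 d2) / 2.
have m0 : 0 < Num.min (Num.min d r) (Num.min d1 d2) by rewrite !lt_min d0 r0 d10.
have t0 : 0 < t by rewrite divr_gt0.
have tlt : t < Num.min (Num.min d r) (Num.min d1 d2) by rewrite /t; lra.
move: tlt; rewrite !lt_min => /andP[/andP[td tr] /andP[t1 t2]].
have nt : `|t| = t by rewrite ger0_norm// ltW.
have := Delta t; rewrite nt => /(_ td tr) D1.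
have := H1 t; rewrite nt add0r => /(_ t1) D2.
have := H2 t; rewrite nt add0r => /(_ t2) D3.
rewrite -(ler_pM2l t0).
have <- : normc (t%:C * (ft s - ft 0 - s%:C * l)) = t * normc (ft s - ft 0 - s%:C * l).
  by rewrite normcM normcR nt.
have -> : t%:C * (ft s - ft 0 - s%:C * l) = (f s t - f s 0 - (f 0 t - f 0 0) - s%:C * t%:C * l)
   - (f s t - f s 0 - t%:C * ft s) + (f 0 t - f 0 0 - t%:C * ft 0) by ring.
apply: le_trans (normcD _ _) _; apply: le_trans (lerD (normcD _ _) D3) _.
rewrite normcN; lra.
Qed.

End tends.

(** * Complex differentiability in two variables *)

Section frechet.
Context {R : realType}.
Local Notation C := R[i].

(** Differentiability over the complex field in two variables, in terms of normc. *)
Definition frechet (k : C -> C -> C) (a b A B : C) : Prop :=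
  forall e : R, 0 < e -> exists2 d : R, 0 < d & forall s t, normc s < d -> normc t < d ->
    normc (k (a + s) (b + t) - k a b - (A * s + B * t)) <= e * (normc s + normc t).

Lemma frechet_tends k a b A B : frechet k a b A B ->
  tends (nbhs (a, b)) (fun z : C * C => k z.1 z.2) (k a b).
Proof.
move=> kd e e0; have [d d0 Hd] := kd 1 ltr01.
pose L := 1 + normc A + normc B.
have L0 : 0 < L by have := normc_ge0 A; have := normc_ge0 B; rewrite /L; lra.
near=> z.
have : normc (z.1 - a) < Num.min d (e / (2 * L)) /\ normc (z.2 - b) < Num.min d (e / (2 * L)).
  near: z; apply: (@nbhs_normc2 R (a, b)).
  by rewrite lt_min d0 divr_gt0// mulr_gt0.
rewrite !lt_min => -[/andP[z1 z2] /andP[w1 w2]].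
have := Hd _ _ z1 w1; rewrite !subrKC mul1r.
set s := z.1 - a; set t := z.2 - b => h.
have h1 : normc (k z.1 z.2 - k a b) <= normc s + normc t + normc (A * s + B * t).
  by rewrite -{1}[k z.1 z.2 - k a b](subrK (A * s + B * t)); apply: le_trans (normcD _ _) _; rewrite lerD2r.
have h2 : normc (A * s + B * t) <= normc A * normc s + normc B * normc t.
  by apply: le_trans (normcD _ _) _; rewrite !normcM.
rewrite !ltr_pdivlMr ?mulr_gt0// -/s -/t in z2 w2.
move: z2 w2; rewrite /L; have := normc_ge0 s; have := normc_ge0 t.
have := normc_ge0 A; have := normc_ge0 B.
move: h1 h2; set x := normc s; set y := normc t; set AA := normc A; set BB := normc B.
move=> *; nra.
Unshelve. all: by end_near. Qed.

(** Chain rule along a real curve. *)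
Lemma frechet_curve k a b A B (x y : R -> C) t dx dy : frechet k a b A B ->
  cder x t dx -> cder y t dy -> x t = a -> y t = b ->
  cder (fun s => k (x s) (y s)) t (A * dx + B * dy).
Proof.
move=> kd dxx dyy xa yb; apply/cderP => e e0.
have A0 := normc_ge0 A; have B0 := normc_ge0 B.
have X0 := normc_ge0 dx; have Y0 := normc_ge0 dy.
pose e1 := Num.min 1 (e / (2 * (1 + normc A + normc B))).
have e10 : 0 < e1 by rewrite lt_min ltr01 divr_gt0// mulr_gt0//; lra.
pose e2 := e / (2 * (2 + normc dx + normc dy)).
have e20 : 0 < e2 by rewrite divr_gt0// mulr_gt0//; lra.
have [d d0 Hd] := kd _ e20.
have [d1 d10 H1] := (cderP x t dx).1 dxx _ e10.
have [d2 d20 H2] := (cderP y t dy).1 dyy _ e10.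
have [d3 d30 H3] := cder_cont dxx (divr_gt0 d0 (ltr0n _ 2)).
have [d4 d40 H4] := cder_cont dyy (divr_gt0 d0 (ltr0n _ 2)).
exists (Num.min (Num.min d1 d2) (Num.min d3 d4)); first by rewrite !lt_min d10 d20 d30.
move=> h; rewrite !lt_min => /andP[/andP[h1 h2] /andP[h3 h4]].
have k1 := H1 h h1; have k2 := H2 h h2.
have k3 : normc (x (t + h) - x t) < d by have := H3 h h3; lra.
have k4 : normc (y (t + h) - y t) < d by have := H4 h h4; lra.
have := Hd _ _ k3 k4; rewrite -xa -yb !subrKC => k5.
set sx := x (t + h) - x t in k1 k3 k5 *; set sy := y (t + h) - y t in k2 k4 k5 *.
set Q := k _ _ - _ in k5 *.
have -> : Q - h%:C * (A * dx + B * dy) = (Q - (A * sx + B * sy)) +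
   (A * (sx - h%:C * dx) + B * (sy - h%:C * dy)) by ring.
apply: le_trans (normcD _ _) _; apply: le_trans (lerD k5 (normcD _ _)) _; rewrite !normcM.
have bx : normc sx <= (1 + normc dx) * `|h|.
  rewrite -[sx](subrK (h%:C * dx)); apply: le_trans (normcD _ _) _; rewrite normcM normcR mulrDl mul1r.
  apply: lerD; last by rewrite mulrC.
  by apply: le_trans k1 _; rewrite ler_piMl// ge_min lexx.
have by' : normc sy <= (1 + normc dy) * `|h|.
  rewrite -[sy](subrK (h%:C * dy)); apply: le_trans (normcD _ _) _; rewrite normcM normcR mulrDl mul1r.
  apply: lerD; last by rewrite mulrC.
  by apply: le_trans k2 _; rewrite ler_piMl// ge_min lexx.
have E1 : e1 * (2 * (1 + normc A + normc B)) <= e.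
  by rewrite -ler_pdivlMr ?mulr_gt0//; [rewrite ge_min lexx orbT|lra].
have E2 : e2 * (2 * (2 + normc dx + normc dy)) = e.
  by rewrite /e2 divfK// gt_eqF// mulr_gt0//; lra.
have h0 := normr_ge0 h.
have F1 : normc A * normc (sx - h%:C * dx) <= normc A * (e1 * `|h|) by rewrite ler_wpM2l.
have F2 : normc B * normc (sy - h%:C * dy) <= normc B * (e1 * `|h|) by rewrite ler_wpM2l.
have F3 : e2 * (normc sx + normc sy) <= e2 * ((2 + normc dx + normc dy) * `|h|).
  by rewrite ler_pM2l//; lra.
have F4 : (e1 * (2 * (1 + normc A + normc B))) * `|h| <= e * `|h| by rewrite ler_wpM2r.
have F5 : e2 * ((2 + normc dx + normc dy) * `|h|) = e * `|h| / 2.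
  by rewrite -E2; field.
have F6 : 0 <= e1 * `|h| by rewrite mulr_ge0// ltW.
lra.
Qed.

Section inverse.
Variables (k K1 K2 g : C -> C -> C) (a b c0 : C) (ep de ga M : R).
Hypothesis kd : forall z w, frechet k z w (K1 z w) (K2 z w).
Hypothesis M0 : 0 < M.
Hypothesis Hg : forall z c, normc (z - a) < ep -> normc (c - c0) < ga ->
        normc (g z c - b) < de /\ k z (g z c) = c.
Hypothesis HL : forall z w w', normc (z - a) < ep -> normc (w - b) < de -> normc (w' - b) < de ->
        normc (w - w') <= M * normc (k z w - k z w').
Hypothesis HK : forall z w, normc (z - a) < ep -> normc (w - b) < de -> K2 z w != 0.

(** Solve k (z + s) (g (z + s) (c + t)) = c + t to first order; the Lipschitz bound
HL makes the increment of g of order |s| + |t|. *)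
Lemma inverse_frechet z c : normc (z - a) < ep -> normc (c - c0) < ga ->
  frechet g z c (- K1 z (g z c) / K2 z (g z c)) (K2 z (g z c))^-1.
Proof.
move=> hz hc; have [wb kw] := Hg hz hc; set w := g z c in wb kw *.
have K20 := HK hz wb; have nK : 0 < normc (K2 z w) by rewrite normc_gt0.
have A0 := normc_ge0 (K1 z w).
(* M' bounds the ratio of the increment of g to |s| + |t| *)
pose M' := M * (normc (K1 z w) + 2).
have M'0 : 0 < M' by rewrite mulr_gt0//; lra.
move=> e e0.
pose e' := e * normc (K2 z w) / (1 + M').
have e'0 : 0 < e' by rewrite divr_gt0 ?mulr_gt0//; lra.
have [d1 d10 H1] := kd z w ltr01.
have [d2 d20 H2] := kd z w e'0.
pose r1 := ep - normc (z - a); have r10 : 0 < r1 by rewrite subr_gt0.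
pose r2 := ga - normc (c - c0); have r20 : 0 < r2 by rewrite subr_gt0.
exists (Num.min (Num.min d1 d2) (Num.min (Num.min r1 r2) (d2 / (2 * M')))).
  by rewrite !lt_min d10 d20 r10 r20 divr_gt0// mulr_gt0.
move=> s t; rewrite !lt_min => /andP[/andP[s1 s2] /andP[/andP[s3 s4] s5]].
move=> /andP[/andP[t1 t2] /andP[/andP[t3 t4] t5]].
have hz' : normc (z + s - a) < ep.
  by rewrite addrAC; apply: le_lt_trans (normcD _ _) _; rewrite /r1 in s3; lra.
have hc' : normc (c + t - c0) < ga.
  by rewrite addrAC; apply: le_lt_trans (normcD _ _) _; rewrite /r2 in t4; lra.
have [wb' kw'] := Hg hz' hc'; set w' := g _ _ in wb' kw' *.
have n0 : normc (0 : C) < d1 by rewrite normc0.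
have := H1 s 0 s1 n0; rewrite addr0 mulr0 addr0 normc0 addr0 mul1r => h1.
have tau : normc (w' - w) <= M' * (normc s + normc t).
  apply: le_trans (HL hz' wb' wb) _; rewrite kw' -mulrA ler_pM2l//.
  have -> : c + t - k (z + s) w = t - ((k (z + s) w - k z w - K1 z w * s) + K1 z w * s).
    by rewrite kw; ring.
  apply: le_trans (normcD _ _) _; rewrite normcN.
  apply: le_trans (lerD (lexx _) (normcD _ _)) _; rewrite normcM.
  have := normc_ge0 s; have := normc_ge0 t; move: h1 A0; nra.
have st0 : 0 <= normc s + normc t by rewrite addr_ge0 ?normc_ge0.
have tau2 : normc (w' - w) < d2.
  have m20 : 0 < 2 * M' by lra.
  apply: le_lt_trans tau _; move: s5 t5; rewrite !(ltr_pdivlMr _ _ m20); lra.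
have := H2 s (w' - w) s2 tau2; rewrite subrKC kw' kw => h2.
have -> : w' - w - (- K1 z w / K2 z w * s + (K2 z w)^-1 * t) =
   - (c + t - c - (K1 z w * s + K2 z w * (w' - w))) / K2 z w by field.
rewrite normcM normcV normcN ler_pdivrMr//; apply: le_trans h2 _.
have h3 : normc s + normc (w' - w) <= (1 + M') * (normc s + normc t).
  by have := normc_ge0 t; lra.
apply: (@le_trans _ _ (e' * ((1 + M') * (normc s + normc t)))); first by rewrite ler_pM2l.
by rewrite mulrA /e' divfK ?gt_eqF//; [rewrite mulrAC|lra].
Qed.

End inverse.
End frechet.

(** * Harmonic leaves *)

Section leaf.
Context {R : realType}.
Local Notation C := R[i].

Lemma rderive_is_derive (f : C -> R) (v z : C) : rderivable f v z ->
  is_derive (0 : R) (1 : R) (rline f v z) (rderive v f z).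
Proof. by move=> h; apply: DeriveDef. Qed.

Lemma unit_discP (w : C) : unit_disc w <-> normc w < 1.
Proof. by rewrite /unit_disc /= normE -[1]/(1%:C) ltcR. Qed.

Lemma disc_near (w v : C) : normc w < 1 -> \forall s \near (0 : R), normc (w + s%:C * v) < 1.
Proof.
move=> w1; have v0 : 0 < 1 + normc v by have := normc_ge0 v; lra.
near=> s.
have hs : `|s| < (1 - normc w) / (1 + normc v).
  near: s; apply/nbhs_ballP; exists ((1 - normc w) / (1 + normc v)) => /=.
    by rewrite divr_gt0// subr_gt0.
  by move=> y; rewrite -ball_normE /= sub0r normrN.
apply: le_lt_trans (normcD _ _) _; rewrite normcM normcR.
move: hs; rewrite ltr_pdivlMr// => hs.
have := normc_ge0 v; have := normr_ge0 s; nra.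
Unshelve. all: by end_near. Qed.

Lemma disc_nbhs (w : C) : normc w < 1 -> \forall z \near w, normc z < 1.
Proof.
move=> w1; near=> z; have : normc (z - w) < 1 - normc w.
  by near: z; apply: nbhs_normc; rewrite subr_gt0.
by have := normc_tri w z 0; rewrite !subr0; lra.
Unshelve. all: by end_near. Qed.

Lemma cder_shift (f : C -> C) (w v l : C) (s0 : R) :
  cder (fun s : R => f (w + s0%:C * v + s%:C * v)) 0 l ->
  cder (fun s : R => f (w + s%:C * v)) s0 l.
Proof.
move=> /cderP H; apply/cderP => e /H[d d0 Hd]; exists d => // h /Hd.
by rewrite add0r mul0r addr0 rmorphD mulrDl addrA.
Qed.

Lemma cder_half (f g : R -> C) (t : R) (l m : C) : cder f t l -> cder g t m ->
  cder (fun s => f s * 2^-1 - Ci * (g s * 2^-1)) t (l * 2^-1 - Ci * (m * 2^-1)).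
Proof.
move=> h1 h2; apply: cder_eq (cderB (cderM h1 (cder_cst 2^-1 t)) (cderM (cder_cst Ci t) (cderM h2 (cder_cst 2^-1 t)))) _.
by ring.
Qed.

Lemma tends_half (T : Type) (F : set_system T) (FF : Filter F) (f g : T -> R) (l m : R) :
  f @ F --> l -> g @ F --> m ->
  tends F (fun s => (f s)%:C * 2^-1 - Ci * ((g s)%:C * 2^-1)) (l%:C * 2^-1 - Ci * (m%:C * 2^-1)).
Proof.
move=> h1 h2; apply: tendsD; first by apply: tendsM; [exact: tends_real|exact: tends_cst].
apply: tendsN; apply: tendsM; first exact: tends_cst.
by apply: tendsM; [exact: tends_real|exact: tends_cst].
Qed.

Lemma Re_half4 (x y z t : R) : x + t = 0 ->
  Re ((x%:C * 2^-1 - Ci * (y%:C * 2^-1)) + Ci * (z%:C * 2^-1 - Ci * (t%:C * 2^-1)) : C) = 0.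
Proof.
have -> : (2^-1 : C) = (2^-1 : R)%:C by rewrite fmorphV rmorph_nat.
by rewrite !ReImE /=; lra.
Qed.

Lemma Re2_eq0 (X : C) : Re (2 * X) = 0 -> Re X = 0.
Proof.
have -> : (2 : C) = (2 : R)%:C by rewrite rmorph_nat.
by rewrite ReM /= mul0r subr0; lra.
Qed.

Section leafs.
Variables (p : mpoly.mpoly 4 C) (uu : C -> R) (phi dphi : C -> C) (a E : C).
Hypothesis preal : forall z, (evr p z)^J = evr p z.
Let pt w := (a + E * w, phi w).
Hypothesis huu : forall w, (uu w)%:C = evr p (pt w).
Hypothesis hphi : forall w v, normc w < 1 -> cder (fun s : R => phi (w + s%:C * v)) 0 (dphi w * v).
Hypothesis cphi : forall w, normc w < 1 -> tends (nbhs w) phi (phi w).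
Hypothesis hu : harmonic_on unit_disc uu.
Hypothesis p20 : forall w, normc w < 1 -> evr (dz2 p) (pt w) != 0.

Let dpt q v w := evr (dz1 q) (pt w) * (E * v) + evr (dz2 q) (pt w) * (dphi w * v)
  + evr (dw1 q) (pt w) * (E * v)^J + evr (dw2 q) (pt w) * (dphi w * v)^J.

Lemma cder_dpt q v w : normc w < 1 ->
  cder (fun s : R => evr q (pt (w + s%:C * v))) 0 (dpt q v w).
Proof.
move=> w1.
have h1 : cder (fun s : R => a + E * (w + s%:C * v)) 0 (E * v).
  apply: cder_eq (cderD (cder_cst a 0) (cderM (cder_cst E 0) (cderD (cder_cst w 0) (cderM (cder_real 0) (cder_cst v 0))))) _.
  ring.
apply: cder_eq (cder_evr q h1 (hphi v w1)) _.
by rewrite mul0r addr0.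
Qed.

Lemma tends_pt q w : normc w < 1 -> tends (nbhs w) (fun w => evr q (pt w)) (evr q (pt w)).
Proof.
move=> w1; apply: (tends_bool (evr_sm2 q) _ (cphi w1)).
apply: tendsD; first exact: tends_cst.
apply: tendsM; first exact: tends_cst.
by move=> e e0; exact: nbhs_normc.
Qed.

(** Let u be P along the leaf w -> pt w. As u is real, its first derivatives are
those of A = dp/dz1 * E + dp/dz2 * phi', and A is C^1 because u is C^2. Since
dp/dz2 is not 0, phi' = (A - dp/dz1 * E) / (dp/dz2) is C^1, and equality of mixed
partials of phi turns the Cauchy-Riemann equations of phi into those of phi'.
The terms with phi'' then cancel in the Laplacian of u, which is four times the
Levi form on the tangent vector. *)
Lemma leaf_levi w : normc w < 1 -> Re (levi p (pt w) (E, dphi w)) = 0 /\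
  exists psi, cder (fun s : R => dphi (w + s%:C * 1)) 0 psi /\
              cder (fun s : R => dphi (w + s%:C * Ci)) 0 (Ci * psi).
Proof.
move=> w1.
have ij : (Ci : C)^J = - Ci by apply: complexP => /=; rewrite ?oppr0.
have ii : (Ci : C) * Ci = -1 by rewrite -expr2 sqr_i.
pose A w := evr (dz1 p) (pt w) * E + evr (dz2 p) (pt w) * dphi w.
case: hu => [[_ ck1] lap].
have r1 v z : normc z < 1 -> rderive v uu z = 2 * Re (A z * v).
  move=> z1; have [hr _] := ck1 v.
  have [k1 k2 _ _] := evr_conj_deriv preal (pt z).
  have := cder_dpt p v z1; rewrite (_ : (fun s : R => _) = fun s : R => (uu (z + s%:C * v))%:C); last first.
    by apply/funext => s; rewrite huu.
  move=> [h _]; have E1 := rderive_is_derive (hr z ((unit_discP z).2 z1)).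
  rewrite -(@derive_val _ _ _ _ _ _ _ E1) (@derive_val _ _ _ _ _ _ _ h).
  rewrite /dpt -k1 -k2 -!conjM /A mulrDl !mulrA !ReImE; ring.
have h2 : (2^-1 : C) = (2^-1 : R)%:C by rewrite fmorphV rmorph_nat.
pose B z : C := (rderive (1 : C) uu z)%:C * 2^-1 - Ci * ((rderive (Ci : C) uu z)%:C * 2^-1).
have AB z : normc z < 1 -> A z = B z.
  move=> z1; rewrite /B !r1// mulr1 h2; by apply: complexP; rewrite !ReImE /=; lra.
have rr v v' z : normc z < 1 -> is_derive (0 : R) (1 : R) (rline (rderive v uu) v' z) (rderive v' (rderive v uu) z).
  move=> z1; apply: rderive_is_derive.
  have [_ [_ ck2]] := ck1 v; have [h _] := ck2 v'; exact: h ((unit_discP z).2 z1).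
have rc v v' z : normc z < 1 -> {for z, continuous (rderive v' (rderive v uu))}.
  move=> z1; have [_ [_ ck2]] := ck1 v; have [_ [h _]] := ck2 v'; exact: h ((unit_discP z).2 z1).
have rc1 v z : normc z < 1 -> {for z, continuous (rderive v uu)}.
  move=> z1; have [_ [h _]] := ck1 v; exact: h ((unit_discP z).2 z1).
pose Bv v z : C := (rderive v (rderive (1 : C) uu) z)%:C * 2^-1 - Ci * ((rderive v (rderive (Ci : C) uu) z)%:C * 2^-1).
have dB v z : normc z < 1 -> cder (fun s : R => B (z + s%:C * v)) 0 (Bv v z).
  move=> z1.
  have c1 : cder (fun s : R => (rderive (1 : C) uu (z + s%:C * v))%:C) 0 (rderive v (rderive (1 : C) uu) z)%:C.
    by split; [exact: (rr 1 v z z1)|exact: is_derive_cst].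
  have c2 : cder (fun s : R => (rderive (Ci : C) uu (z + s%:C * v))%:C) 0 (rderive v (rderive (Ci : C) uu) z)%:C.
    by split; [exact: (rr Ci v z z1)|exact: is_derive_cst].
  exact: cder_half c1 c2.
pose dphi2 v z := (Bv v z - dpt (dz1 p) v z * E) / evr (dz2 p) (pt z)
    - (B z - evr (dz1 p) (pt z) * E) * dpt (dz2 p) v z / evr (dz2 p) (pt z) ^+ 2.
have dphiE z : normc z < 1 -> dphi z = (B z - evr (dz1 p) (pt z) * E) / evr (dz2 p) (pt z).
  by move=> z1; rewrite -AB// /A; field; exact: p20.
have ddphi v z : normc z < 1 -> cder (fun s : R => dphi (z + s%:C * v)) 0 (dphi2 v z).
  move=> z1.
  apply: (@cder_near _ (fun s : R => (B (z + s%:C * v) - evr (dz1 p) (pt (z + s%:C * v)) * E) / evr (dz2 p) (pt (z + s%:C * v)))).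
    near=> s; rewrite -dphiE//; near: s; exact: disc_near.
  have P0 : evr (dz2 p) (pt (z + 0%:C * v)) != 0 by rewrite mul0r addr0; exact: p20.
  apply: cder_eq (cderM (cderB (dB v z z1) (cderM (cder_dpt (dz1 p) v z1) (cder_cst E 0))) (cderV P0 (cder_dpt (dz2 p) v z1))) _.
  by rewrite mul0r addr0 /dphi2; field; exact: p20.
have tB v z : normc z < 1 -> tends (nbhs z) (Bv v) (Bv v z).
  by move=> z1; apply: tends_half; exact: rc.
have tB0 z : normc z < 1 -> tends (nbhs z) B (B z).
  by move=> z1; apply: tends_half; exact: rc1.
have tdphi z : normc z < 1 -> tends (nbhs z) dphi (dphi z).
  move=> z1; rewrite (dphiE z)//.
  apply: (@tends_near _ _ _ _ (fun z => (B z - evr (dz1 p) (pt z) * E) / evr (dz2 p) (pt z))).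
    near=> y; rewrite -dphiE//; near: y; exact: disc_nbhs.
  apply: tendsM; last by apply: tendsV; [exact: p20|exact: tends_pt].
  apply: tendsD; first exact: tB0.
  by apply: tendsN; apply: tendsM; [exact: tends_pt|exact: tends_cst].
have tdir q v z : normc z < 1 -> tends (nbhs z) (dpt q v) (dpt q v z).
  move=> z1; have tc (l : C) : tends (nbhs z) (fun=> l) l by exact: tends_cst.
  have tEv := tc (E * v); have tEvJ := tc (E * v)^J.
  have tpv : tends (nbhs z) (fun z => dphi z * v) (dphi z * v) by apply: tendsM; [exact: tdphi|exact: tc].
  exact: (tendsD (tendsD (tendsD (tendsM (tends_pt (dz1 q) z1) tEv) (tendsM (tends_pt (dz2 q) z1) tpv))
    (tendsM (tends_pt (dw1 q) z1) tEvJ)) (tendsM (tends_pt (dw2 q) z1) (tendsJ tpv))).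
have td2 v z : normc z < 1 -> tends (nbhs z) (dphi2 v) (dphi2 v z).
  move=> z1; have tc (l : C) : tends (nbhs z) (fun=> l) l by exact: tends_cst.
  have tV : tends (nbhs z) (fun z => (evr (dz2 p) (pt z))^-1) (evr (dz2 p) (pt z))^-1.
    by apply: tendsV; [exact: p20|exact: tends_pt].
  have t2 : tends (nbhs z) (fun z => (evr (dz2 p) (pt z) ^+ 2)^-1) (evr (dz2 p) (pt z) ^+ 2)^-1.
    apply: tendsV; first by rewrite expf_neq0// p20.
    apply: (tends_ext (fun z => esym (expr2 (evr (dz2 p) (pt z))))); rewrite expr2.
    exact: (tendsM (tends_pt (dz2 p) z1) (tends_pt (dz2 p) z1)).
  exact: (tendsD (tendsM (tendsD (tB v z z1) (tendsN (tendsM (tdir (dz1 p) v z z1) (tc E)))) tV)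
    (tendsN (tendsM (tendsM (tendsD (tB0 z z1) (tendsN (tendsM (tends_pt (dz1 p) z1) (tc E)))) (tdir (dz2 p) v z z1)) t2))).
(* the Cauchy-Riemann equations of phi', from the equality of mixed partials of phi *)
pose r := (1 - normc w) / 2; have r0 : 0 < r by rewrite divr_gt0// subr_gt0.
have inD (s t : R) : `|s| < r -> `|t| < r -> normc (w + s%:C * 1 + t%:C * Ci) < 1.
  move=> hs ht; apply: le_lt_trans (normcD _ _) _; apply: le_lt_trans (lerD (normcD _ _) (lexx _)) _.
  by rewrite (mulr1 s%:C) normcM !normcR normc_i mulr1; move: hs ht; rewrite /r; lra.
have n00 : normc (w + 0%:C * 1 + 0%:C * Ci) < 1 by rewrite !mul0r !addr0.
have S : cder (fun s : R => dphi (w + s%:C * 1) * Ci) 0 (dphi2 Ci w).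
  have := @schwarz R (fun s t => phi (w + s%:C * 1 + t%:C * Ci)) (fun s t => dphi (w + s%:C * 1 + t%:C * Ci))
    (fun s t => dphi2 Ci (w + s%:C * 1 + t%:C * Ci)) (fun s => dphi (w + s%:C * 1) * Ci) r r0.
  rewrite !mul0r !addr0; apply.
  - move=> s t hs ht.
    apply: (@cder_ext _ (fun s => phi (w + t%:C * Ci + s%:C * 1))) => [x|]; first by congr phi; ring.
    have -> : w + s%:C * 1 + t%:C * Ci = w + t%:C * Ci + s%:C * 1 by ring.
    apply: cder_shift; rewrite -[dphi _]mulr1; apply: hphi.
    have -> : w + t%:C * Ci + s%:C * 1 = w + s%:C * 1 + t%:C * Ci by ring.
    exact: inD.
  - by move=> s t hs ht; apply: cder_shift; apply: ddphi; exact: inD.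
  - move=> s hs; apply: hphi; have := inD s 0 hs; rewrite mul0r addr0; apply.
    by rewrite normr0.
  - move=> e e0; have [d d0 Hd] := nbhs_normcP (td2 Ci w w1 e e0).
    exists (d / 2); first by rewrite divr_gt0.
    move=> s t hs ht; apply/ltW/Hd; have -> : w + s%:C * 1 + t%:C * Ci - w = s%:C * 1 + t%:C * Ci by ring.
    apply: le_lt_trans (normcD _ _) _; rewrite (mulr1 s%:C) normcM !normcR normc_i mulr1; lra.
have CR : dphi2 Ci w = Ci * dphi2 1 w.
  have := cderM (ddphi 1 w w1) (cder_cst Ci 0); move/(cder_uniq S) => ->; ring.
split; last by exists (dphi2 1 w); split; [exact: ddphi|rewrite -CR; exact: ddphi].
have A1 v : Bv v w = dpt (dz1 p) v w * E + (dpt (dz2 p) v w * dphi w + evr (dz2 p) (pt w) * dphi2 v w).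
  have h1 := cderD (cderM (cder_dpt (dz1 p) v w1) (cder_cst E 0)) (cderM (cder_dpt (dz2 p) v w1) (ddphi v w w1)).
  have h3 : cder (fun s : R => B (w + s%:C * v)) 0 (dpt (dz1 p) v w * E + evr (dz1 p) (pt (w + 0%:C * v)) * 0 +
     (dpt (dz2 p) v w * dphi (w + 0%:C * v) + evr (dz2 p) (pt (w + 0%:C * v)) * dphi2 v w)).
    apply: cder_near h1; near=> s; rewrite -AB//; near: s; exact: disc_near.
  rewrite (cder_uniq (dB v w w1) h3) !mul0r !addr0 mulr0 addr0//.
have L : 2 * levi p (pt w) (E, dphi w) = Bv 1 w + Ci * Bv Ci w.
  rewrite !A1 CR /levi /dpt /fst /snd !conjE ij.
  set x1 := evr (dz1 (dz1 p)) _; set x2 := evr (dz2 (dz1 p)) _; set x3 := evr (dw1 (dz1 p)) _; set x4 := evr (dw2 (dz1 p)) _.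
  set y1 := evr (dz1 (dz2 p)) _; set y2 := evr (dz2 (dz2 p)) _; set y3 := evr (dw1 (dz2 p)) _; set y4 := evr (dw2 (dz2 p)) _.
  set q := evr (dz2 p) _; set X := dphi2 1 w; set EJ := E^J; set dJ := (dphi w)^J.
  transitivity (((x3 * EJ + x4 * dJ) * E + (y3 * EJ + y4 * dJ) * dphi w) * (1 - Ci * Ci) +
     ((x1 * E + x2 * dphi w) * E + (y1 * E + y2 * dphi w) * dphi w + q * X) * (1 + Ci * Ci)).
    by rewrite ii; ring.
  by ring.
have lapw := lap w ((unit_discP w).2 w1).
have : Re (Bv 1 w + Ci * Bv Ci w) = 0.
  exact: Re_half4 lapw.
by rewrite -L => /Re2_eq0.
Unshelve. all: by end_near. Qed.

End leafs.
End leaf.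

(** * Proportional polynomials *)

Section proportional.
Context {R : realType}.
Local Notation C := R[i].

Lemma poly_fun_eq (P Q : {poly C}) : (forall s, P.[s] = Q.[s]) -> P = Q.
Proof.
move=> H; apply/eqP; rewrite -subr_eq0; apply/eqP/(poly_real_roots (r := 1)) => // s _.
by rewrite !hornerE H subrr.
Qed.

(** Compare leading coefficients: deg A = deg B, in characteristic 0. *)
Lemma wronskian_size (K : numFieldType) (A B : {poly K}) : A != 0 -> B != 0 ->
  A^`() * B = A * B^`() -> size A = size B.
Proof.
move=> A0 B0 E.
have lcd (D : {poly K}) : (1 < size D)%N -> D^`() != 0 /\ lead_coef D^`() = lead_coef D *+ (size D).-1.
  move=> sD; have D0 : D != 0 by rewrite -size_poly_eq0; case: (size D) sD.
  have c0 : D^`()`_(size D).-2 = lead_coef D *+ (size D).-1.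
    by rewrite coef_deriv lead_coefE; case: (size D) sD => [|[|n]].
  have c1 : D^`()`_(size D).-2 != 0.
    by rewrite c0 mulrn_eq0 lead_coef_eq0 (negbTE D0) orbF; case: (size D) sD => [|[|n]].
  have D'0 : D^`() != 0 by apply: contraNneq c1 => ->; rewrite coef0.
  split=> //; rewrite [LHS]lead_coefE; have -> : size D^`() = (size D).-1; last exact: c0.
  apply/eqP; rewrite eqn_leq; apply/andP; split.
    by have := lt_size_deriv D0; case: (size D) sD.
  rewrite leqNgt; apply: contra c1 => h; apply/eqP; rewrite nth_default//.
  by case: (size D) sD h => [|[|n]].
have small (D : {poly K}) : D != 0 -> (size D <= 1)%N -> size D = 1%N /\ D^`() = 0.
  move=> D0 sD; split; first by apply/eqP; rewrite eqn_leq sD lt0n size_poly_eq0.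
  by rewrite (size1_polyC sD) derivC.
have [sA|sA] := leqP (size A) 1.
  have [sA1 A'0] := small _ A0 sA; move: E; rewrite A'0 mul0r => /esym/eqP.
  rewrite mulf_eq0 (negbTE A0) /= => /eqP B'0.
  have [sB|sB] := leqP (size B) 1; first by have [-> _] := small _ B0 sB.
  by have [] := lcd _ sB; rewrite B'0 eqxx.
have [A'0 lA] := lcd _ sA.
have [sB|sB] := leqP (size B) 1.
  have [_ B'0] := small _ B0 sB; move/eqP: E; rewrite B'0 mulr0 mulf_eq0 (negbTE A'0) /=.
  by rewrite (negbTE B0).
have [B'0 lB] := lcd _ sB.
have := congr1 lead_coef E; rewrite !lead_coefM lA lB mulrnAl mulrnAr => /eqP.
have lc0 : lead_coef A * lead_coef B != 0 by rewrite mulf_neq0 ?lead_coef_eq0.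
rewrite -[X in X == _]mulr_natr -[X in _ == X]mulr_natr (inj_eq (mulfI lc0)) eqr_nat => /eqP.
by case: (size A) sA => // n; case: (size B) sB => // m _ _ /= ->.
Qed.

(** Subtract the multiple of B that cancels the leading term of A: the difference
still has zero Wronskian with B but a smaller degree, so it vanishes. *)
Lemma proportional_of_wronskian (K : numFieldType) (A B : {poly K}) : B != 0 -> A^`() * B = A * B^`() ->
  exists c, A = c *: B.
Proof.
move=> B0 E; have [->|A0] := eqVneq A 0; first by exists 0; rewrite scale0r.
have sAB := wronskian_size A0 B0 E.
pose c := lead_coef A / lead_coef B; exists c; apply/eqP; rewrite -subr_eq0.
apply/negPn/negP => D0.
have E2 : (A - c *: B)^`() * B = (A - c *: B) * B^`().
  by rewrite derivB derivZ mulrBl mulrBl E -!scalerAl [B^`() * B]mulrC.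
have := wronskian_size D0 B0 E2; apply/eqP; rewrite neq_ltn; apply/orP; left.
have sB : (0 < size B)%N by rewrite lt0n size_poly_eq0.
rewrite -(prednK sB) ltnS; apply/leq_sizeP => j; rewrite leq_eqVlt => /predU1P[<-|h].
  rewrite coefB coefZ /c -[B`_ _]lead_coefE -{1}sAB -[A`_ _]lead_coefE divfK ?subrr//.
  by rewrite lead_coef_eq0.
have hB : (size B <= j)%N by rewrite -(prednK sB).
by rewrite coefB coefZ !nth_default ?mulr0 ?subrr// sAB.
Qed.

Lemma line_w q (z1 z2 w1 w2 v1 v2 : C) : exists P : {poly C}, forall s,
  P.[s] = ev q z1 z2 (w1 + s * v1) (w2 + s * v2) /\
  P^`().[s] = v1 * ev (dw1 q) z1 z2 (w1 + s * v1) (w2 + s * v2) +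
     v2 * ev (dw2 q) z1 z2 (w1 + s * v1) (w2 + s * v2).
Proof.
have [P HP] := line_poly q (tnth [tuple z1; z2; w1; w2]) (tnth [tuple 0; 0; v1; v2]).
exists P => s; have [h1 h2] := HP s.
have E : (fun i => tnth [tuple z1; z2; w1; w2] i + s * tnth [tuple 0; 0; v1; v2] i) =1
   tnth [tuple z1; z2; w1 + s * v1; w2 + s * v2].
  by apply: ord4P; rewrite !(tnth_nth 0) /= ?inordK//= mulr0 addr0.
rewrite h1 h2 !evE (mpoly.meval_eq _ E); split=> //.
rewrite big_ord4; have [-> -> -> ->] := tnth4 (0 : C) 0 v1 v2; rewrite !mul0r !add0r.
by rewrite !dvar.unlock !(mpoly.meval_eq _ E).
Qed.

Lemma const_w q (z1 z2 w1 w2 : C) : (forall w1 w2, ev (dw1 q) z1 z2 w1 w2 = 0) ->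
  (forall w1 w2, ev (dw2 q) z1 z2 w1 w2 = 0) -> ev q z1 z2 w1 w2 = ev q z1 z2 0 0.
Proof.
move=> h1 h2; have [P HP] := line_w q z1 z2 0 0 w1 w2.
have P0 : P^`() = 0.
  by apply: poly_fun_eq => s; have [_ ->] := HP s; rewrite h1 h2 !mulr0 addr0 horner0.
have [c Ec] : exists c, P = c *: 1.
  by apply: proportional_of_wronskian; rewrite ?oner_neq0// P0 -[1]/(1%:P) derivC mul0r mulr0.
have [e0 _] := HP 0; have [e1 _] := HP 1.
by move: e0 e1; rewrite Ec !mul0r !mul1r !addr0 !add0r !hornerE => <- <-.
Qed.

Section ratio.
Variables (p : mpoly.mpoly 4 C) (k0 : nat) (z1 z2 : C).
Let M1 := dvar k0 (dz1 p).
Let M2 := dvar k0 (dz2 p).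
Hypothesis np1 : ev (dz1 p) z1 z2 0 0 = 0.
Hypothesis np2 : ev (dz2 p) z1 z2 0 0 = 0.
Hypothesis h1 : forall w1 w2, ev (dw1 M1) z1 z2 w1 w2 * ev M2 z1 z2 w1 w2 = ev M1 z1 z2 w1 w2 * ev (dw1 M2) z1 z2 w1 w2.
Hypothesis h2 : forall w1 w2, ev (dw2 M1) z1 z2 w1 w2 * ev M2 z1 z2 w1 w2 = ev M1 z1 z2 w1 w2 * ev (dw2 M2) z1 z2 w1 w2.
Hypothesis h3 : forall w1 w2, ev (dw1 (dz1 p)) z1 z2 w1 w2 * ev M2 z1 z2 w1 w2 = ev (dw1 (dz2 p)) z1 z2 w1 w2 * ev M1 z1 z2 w1 w2.
Hypothesis h4 : forall w1 w2, ev (dw2 (dz1 p)) z1 z2 w1 w2 * ev M2 z1 z2 w1 w2 = ev (dw2 (dz2 p)) z1 z2 w1 w2 * ev M1 z1 z2 w1 w2.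

(** On lines in w the Wronskian of M1 and M2 vanishes, so M1 = rho M2 with rho
independent of w. Then the w-gradient of dp/dz1 - rho dp/dz2 vanishes, and this
polynomial is 0 at w = 0. *)
Lemma gradient_ratio_const a1 a2 : ev M2 z1 z2 a1 a2 != 0 -> exists rho, forall w1 w2,
  ev (dz1 p) z1 z2 w1 w2 = rho * ev (dz2 p) z1 z2 w1 w2.
Proof.
move=> M20; pose rho := ev M1 z1 z2 a1 a2 / ev M2 z1 z2 a1 a2.
have atline q w1 w2 (Q : {poly C}) : (forall s, Q.[s] = ev q z1 z2 (a1 + s * (w1 - a1)) (a2 + s * (w2 - a2)) /\
   Q^`().[s] = (w1 - a1) * ev (dw1 q) z1 z2 (a1 + s * (w1 - a1)) (a2 + s * (w2 - a2)) +
     (w2 - a2) * ev (dw2 q) z1 z2 (a1 + s * (w1 - a1)) (a2 + s * (w2 - a2))) ->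
   Q.[0] = ev q z1 z2 a1 a2 /\ Q.[1] = ev q z1 z2 w1 w2.
  move=> H; have [e0 _] := H 0; have [e1 _] := H 1.
  by rewrite e0 e1 !mul0r !addr0 !mul1r !subrKC.
have ratM w1 w2 : ev M1 z1 z2 w1 w2 = rho * ev M2 z1 z2 w1 w2.
  have [A HA] := line_w M1 z1 z2 a1 a2 (w1 - a1) (w2 - a2).
  have [B HB] := line_w M2 z1 z2 a1 a2 (w1 - a1) (w2 - a2).
  have [A0 A1] := atline _ _ _ _ HA; have [B0 B1] := atline _ _ _ _ HB.
  have Bn : B != 0 by apply: contraNneq M20 => E; rewrite -B0 E horner0.
  have [c Ec] : exists c, A = c *: B.
    apply: proportional_of_wronskian => //; apply: poly_fun_eq => s; rewrite !hornerM.
    have [-> ->] := HA s; have [-> ->] := HB s.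
    by rewrite mulrDl mulrDr -!mulrA h1 h2; ring.
  have rc : rho = c by rewrite /rho -A0 -B0 Ec hornerZ mulfK// B0.
  by rewrite -A1 -B1 Ec hornerZ rc.
have ratk q q' : (forall w1 w2, ev q z1 z2 w1 w2 * ev M2 z1 z2 w1 w2 = ev q' z1 z2 w1 w2 * ev M1 z1 z2 w1 w2) ->
   forall w1 w2, ev q z1 z2 w1 w2 = rho * ev q' z1 z2 w1 w2.
  move=> h w1 w2.
  have [B HB] := line_w M2 z1 z2 a1 a2 (w1 - a1) (w2 - a2).
  have [B0 B1] := atline _ _ _ _ HB.
  have Bn : B != 0 by apply: contraNneq M20 => E; rewrite -B0 E horner0.
  have [Q HQ] := line_w q z1 z2 a1 a2 (w1 - a1) (w2 - a2).
  have [Q' HQ'] := line_w q' z1 z2 a1 a2 (w1 - a1) (w2 - a2).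
  have [_ Q1] := atline _ _ _ _ HQ; have [_ Q1'] := atline _ _ _ _ HQ'.
  have : (Q - rho *: Q') * B = 0.
    apply: poly_fun_eq => s; rewrite !hornerE.
    have [-> _] := HQ s; have [-> _] := HQ' s; have [-> _] := HB s.
    by rewrite mulrBl h ratM; ring.
  move/eqP; rewrite mulf_eq0 (negbTE Bn) orbF subr_eq0 => /eqP E.
  by rewrite -Q1 -Q1' E hornerZ.
exists rho => w1 w2.
have [Q HQ] := line_w (dz1 p) z1 z2 0 0 w1 w2.
have [Q' HQ'] := line_w (dz2 p) z1 z2 0 0 w1 w2.
have d0 : (Q - rho *: Q')^`() = 0.
  apply: poly_fun_eq => s; rewrite derivB derivZ !hornerE.
  have [_ ->] := HQ s; have [_ ->] := HQ' s.
  by rewrite (ratk _ _ h3) (ratk _ _ h4); ring.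
have [c Ec] : exists c, Q - rho *: Q' = c *: 1.
  by apply: proportional_of_wronskian; rewrite ?oner_neq0// d0 -[1]/(1%:P) derivC mul0r mulr0.
have c0 : c = 0.
  have := congr1 (horner^~ 0) Ec; rewrite /= !hornerE.
  have [-> _] := HQ 0; have [-> _] := HQ' 0.
  by rewrite !mul0r !addr0 np1 np2 mulr0 subrr.
have := congr1 (horner^~ 1) Ec; rewrite /= c0 scale0r !hornerE.
have [-> _] := HQ 1; have [-> _] := HQ' 1.
by rewrite !add0r !mul1r => /eqP; rewrite subr_eq0 => /eqP.
Qed.

End ratio.
End proportional.

(** * Proportional gradients *)

Section gradients.
Context {R : realType}.
Local Notation C := R[i].
Implicit Types (q : mpoly.mpoly 4 C).

Lemma evM q q' z1 z2 w1 w2 : ev (q * q') z1 z2 w1 w2 = ev q z1 z2 w1 w2 * ev q' z1 z2 w1 w2.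
Proof. by rewrite !evE mpoly.mevalM. Qed.

Lemma evB q q' z1 z2 w1 w2 : ev (q - q') z1 z2 w1 w2 = ev q z1 z2 w1 w2 - ev q' z1 z2 w1 w2.
Proof. by rewrite !evE mpoly.mevalB. Qed.

Lemma tends_box (z0 w0 : C) (f : C * C -> C) (l : C) : tends (nbhs (z0, w0)) f l ->
  forall e : R, 0 < e -> exists2 d : R, 0 < d &
    forall z w, normc (z - z0) < d -> normc (w - w0) < d -> normc (f (z, w) - l) < e.
Proof.
move=> H e e0; have [d d0 Hd] := nbhs_normc2P (H e e0).
by exists d => // z w h1 h2; exact: (Hd (z, w)).
Qed.

Lemma tends_comp2 (T : Type) (F : set_system T) (FF : Filter F) (k : C * C -> C) (f g : T -> C) l m v :
  tends (nbhs (l, m)) k v -> tends F f l -> tends F g m -> tends F (fun t => k (f t, g t)) v.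
Proof.
move=> kv fl gm e e0; have [d d0 Hd] := tends_box kv e0.
near=> t; apply: Hd; near: t; [exact: fl|exact: gm].
Unshelve. all: by end_near. Qed.

Lemma tends_nz (z0 w0 : C) (f : C * C -> C) : tends (nbhs (z0, w0)) f (f (z0, w0)) -> f (z0, w0) != 0 ->
  exists2 d : R, 0 < d & forall z w, normc (z - z0) < d -> normc (w - w0) < d -> f (z, w) != 0.
Proof.
move=> H n0; have nn : 0 < normc (f (z0, w0)) by rewrite normc_gt0.
have [d d0 Hd] := tends_box H nn; exists d => // z w h1 h2; apply/eqP => E.
by have := Hd z w h1 h2; rewrite E sub0r normcN ltxx.
Qed.

Lemma tends_evr q z : tends (nbhs z) (evr q) (evr q z).
Proof. by move=> e e0; exact: (sm2_nbhs (evr_sm2 q)). Qed.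

(** A nonzero polynomial is nonzero somewhere in every box with w = conj z, hence
on a smaller box by continuity. *)
Lemma nonzero_near q a b (r : R) : 0 < r -> ~ (forall z1 z2 w1 w2, ev q z1 z2 w1 w2 = 0) ->
  exists a' b' (r' : R), [/\ 0 < r',
    forall z w, normc (z - a') < r' -> normc (w - b') < r' -> normc (z - a) < r /\ normc (w - b) < r &
    forall z w, normc (z - a') < r' -> normc (w - b') < r' -> evr q (z, w) != 0].
Proof.
move=> r0 nz.
have [a' [b' [ha hb n0]]] : exists a' b', [/\ normc (a' - a) < r, normc (b' - b) < r & evr q (a', b') != 0].
  apply: contrapT => H; apply: nz; apply: (polarize (a1 := a) (a2 := b) r0) => z1 z2 h1 h2.
  by apply/eqP; apply: contrapT => /negP n; apply: H; exists z1, z2.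
have [d d0 Hd] := tends_nz (@tends_evr q (a', b')) n0.
exists a', b', (Num.min d (Num.min (r - normc (a' - a)) (r - normc (b' - b)))); split.
- by rewrite !lt_min d0 !subr_gt0 ha.
- move=> z w; rewrite !lt_min => /andP[_ /andP[h1 _]] /andP[_ /andP[_ h2]].
  have := normc_tri a' z a; have := normc_tri b' w b; lra.
- by move=> z w; rewrite !lt_min => /andP[h1 _] /andP[h2 _]; exact: Hd.
Qed.

(** A real-linear map that commutes with i has no antilinear part. *)
Lemma leaf_alg (E i G0 G1 G2 G3 x y X Y : C) : E != 0 -> i != 0 ->
  i * (E * (G0 * x + G1 * y + G2 * X + G3 * Y)) =
  E * (G0 * (x * i) + G1 * (y * i) + G2 * (X * - i) + G3 * (Y * - i)) -> G2 * X + G3 * Y = 0.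
Proof.
move=> E0 i0 H; have : 2 * i * E * (G2 * X + G3 * Y) = 0.
  have -> : 2 * i * E * (G2 * X + G3 * Y) = i * (E * (G0 * x + G1 * y + G2 * X + G3 * Y)) -
    E * (G0 * (x * i) + G1 * (y * i) + G2 * (X * - i) + G3 * (Y * - i)) by ring.
  by rewrite H subrr.
by move/eqP; rewrite !mulf_eq0 (negbTE E0) (negbTE i0) pnatr_eq0/= => /eqP.
Qed.

Lemma transverse_alg (i G1 G3 u U : C) : i != 0 -> U != 0 ->
  i * (G1 * u + G3 * U) = G1 * (i * u) + G3 * (- i * U) -> G3 = 0.
Proof.
move=> i0 U0 H; have : 2 * i * G3 * U = 0.
  have -> : 2 * i * G3 * U = i * (G1 * u + G3 * U) - (G1 * (i * u) + G3 * (- i * U)) by ring.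
  by rewrite H subrr.
by move/eqP; rewrite !mulf_eq0 (negbTE U0) (negbTE i0) pnatr_eq0/= orbF => /eqP.
Qed.

Lemma tends_R2 (f : R * R -> C) l : tends (nbhs ((0 : R), (0 : R))) f l ->
  forall e : R, 0 < e -> exists2 d : R, 0 < d & forall s t : R, `|s| < d -> `|t| < d -> normc (f (s, t) - l) <= e.
Proof.
move=> H e e0; have /nbhs_ballP[d /= d0 Hd] := H e e0.
exists d => // s t hs ht; apply/ltW/(Hd (s, t)).
by split; rewrite -ball_normE /ball_ /= sub0r normrN.
Qed.

Lemma tends_fst0 (z v : C) : tends (nbhs ((0 : R), (0 : R))) (fun x : R * R => z + x.1%:C * v) z.
Proof.
suff : tends (nbhs ((0 : R), (0 : R))) (fun x : R * R => z + x.1%:C * v) (z + (0 : R)%:C * v) by rewrite mul0r addr0.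
apply: tendsD; first exact: tends_cst.
apply: tendsM; last exact: tends_cst.
by apply: tends_real; exact: cvg_fst.
Qed.

Lemma tends_snd0 (z v : C) : tends (nbhs ((0 : R), (0 : R))) (fun x : R * R => z + x.2%:C * v) z.
Proof.
suff : tends (nbhs ((0 : R), (0 : R))) (fun x : R * R => z + x.2%:C * v) (z + (0 : R)%:C * v) by rewrite mul0r addr0.
apply: tendsD; first exact: tends_cst.
apply: tendsM; last exact: tends_cst.
by apply: tends_real; exact: cvg_snd.
Qed.

Lemma cder_affine (z v : C) (s : R) : cder (fun s : R => z + s%:C * v) s v.
Proof.
apply: cder_eq (cderD (cder_cst z s) (cderM (cder_real s) (cder_cst v s))) _; ring.
Qed.

(** Complex differentiability, in the form that the leaves provide. *)
Definition cdiff (f : C -> C) (w l : C) : Prop :=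
  forall e : R, 0 < e -> exists2 d : R, 0 < d & forall s, normc s < d ->
    normc (f (w + s) - f w - l * s) <= e * normc s.

Variables (p : mpoly.mpoly 4 C) (P : C * C -> R).
Hypothesis pP : forall z, (P z)%:C = evr p z.
Hypothesis kern : forall z v, Re (levi p z v) = 0 ->
    evr (dw1 (dz1 p)) z * v.1 + evr (dw1 (dz2 p)) z * v.2 = 0 /\
    evr (dw2 (dz1 p)) z * v.1 + evr (dw2 (dz2 p)) z * v.2 = 0.
Hypothesis noplur : forall z1 z2, ev (dz1 p) z1 z2 0 0 = 0 /\ ev (dz2 p) z1 z2 0 0 = 0.
Variables (k K1 K2 : C -> C -> C).
Hypothesis kd : forall z w, frechet k z w (K1 z w) (K2 z w).
Hypothesis K1c : forall z w, tends (nbhs (z, w)) (fun z => K1 z.1 z.2) (K1 z w).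
Hypothesis K2c : forall z w, tends (nbhs (z, w)) (fun z => K2 z.1 z.2) (K2 z w).
Hypothesis Hleaf : forall (a b c : C) (ep de : R) (phi dphi : C -> C), 0 < ep -> 0 < de ->
  (forall w, normc w < 1 -> cdiff phi w (dphi w)) ->
  (forall w, normc w < 1 -> tends (nbhs w) dphi (dphi w)) ->
  (forall w, normc w < 1 -> normc (phi w - b) < de) ->
  (forall w, normc w < 1 -> k (a + ep%:C * w) (phi w) = c) ->
  (forall z w, normc (z - a) < ep -> normc (w - b) < de -> k z w = c -> w = phi ((z - a) / ep%:C)) ->
  harmonic_on unit_disc (fun w => P (a + ep%:C * w, phi w)).

(** The kernel equations give the slope of the leaves as Gq = - M1 / M2 on the box.
Along a leaf the slope is holomorphic by [leaf_levi]. Across the leaves,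
d(slope)/dc is the z-derivative of dg/dc = 1 / K2 by [schwarz], so it is
complex linear in dc too. Both together say that Gq is holomorphic; polarized,
M1 / M2 has zero w-derivative, and [gradient_ratio_const] applies. *)
Lemma gradients_proportional_near a b : K2 a b != 0 ->
  (forall z1 z2 w1 w2, ev (dz2 p) z1 z2 w1 w2 = 0) \/
  exists a1 b1 (r : R), 0 < r /\ forall z w, normc (z - a1) < r -> normc (w - b1) < r ->
    exists rho, forall w1 w2, ev (dz1 p) z w w1 w2 = rho * ev (dz2 p) z w w1 w2.
Proof.
move=> K2ab.
have [all0|n2] := pselect (forall z1 z2 w1 w2, ev (dz2 p) z1 z2 w1 w2 = 0); [by left|right].
(* some second derivative of p in z2 and w_k0 is not identically 0: dp/dz2 vanishes at w = 0 *)
have [k0 nM] : exists k0, ~ (forall z1 z2 w1 w2, ev (dvar k0 (dz2 p)) z1 z2 w1 w2 = 0) /\ (k0 = 2%N \/ k0 = 3%N).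
  apply: contrapT => H; apply: n2 => z1 z2 w1 w2; rewrite const_w.
  - by have [] := noplur z1 z2.
  - by apply: contrapT => H2; apply: H; exists 2%N; split; [move=> E; apply: H2 => *; exact: E|left].
  - by apply: contrapT => H2; apply: H; exists 3%N; split; [move=> E; apply: H2 => *; exact: E|right].
case: nM => nM k0E.
pose M1 := dvar k0 (dz1 p); pose M2 := dvar k0 (dz2 p).
have [r0 r00 K2r0] := tends_nz (f := fun z => K2 z.1 z.2) (@K2c a b) K2ab.
have [a1 [b1 [r1 [r10 in1 M20]]]] := nonzero_near a b r00 nM.
have [a2 [b2 [r2 [r20 in2 P20]]]] := nonzero_near a1 b1 r10 n2.
have K2c' : forall a b (e : R), 0 < e -> exists2 d : R, 0 < d &
  forall z w, normc (z - a) < d -> normc (w - b) < d -> normc (K2 z w - K2 a b) < e.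
  by move=> x y e e0; exact: (tends_box (@K2c x y) e0).
have n22 : normc (a2 - a2) < r2 /\ normc (b2 - b2) < r2 by rewrite !subrr normc0.
have K220 : K2 a2 b2 != 0.
  have [h1 h2] := in2 a2 b2 n22.1 n22.2; have [h3 h4] := in1 _ _ h1 h2.
  exact: (K2r0 _ _ h3 h4).
have [ep [de [ga [M [g [/andP[ep0 epr] /andP[de0 der] ga0 M0 [Hg HL HK]]]]]]] := implicit_function K2c' kd r20 K220.
set c0 := k a2 b2 in Hg.
have gfr := inverse_frechet kd M0 Hg HL HK.
have E0 : (ep%:C : C) != 0 by apply/eqP => -[] E; rewrite E ltxx in ep0.
set E := (ep%:C : C) in E0.
have nE : normc E = ep by rewrite normcR ger0_norm// ltW.
have preal z : (evr p z)^J = evr p z by rewrite -pP conjR.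
have M2n z w : normc (z - a2) < ep -> normc (w - b2) < de -> evr M2 (z, w) != 0.
  move=> hz hw; have [h1 h2] := in2 z w (lt_trans hz epr) (lt_trans hw der).
  exact: M20.
have P2n z w : normc (z - a2) < ep -> normc (w - b2) < de -> evr (dz2 p) (z, w) != 0.
  by move=> hz hw; apply: P20; [exact: lt_trans hz epr|exact: lt_trans hw der].
have inz w : normc w < 1 -> normc (a2 + E * w - a2) < ep.
  by move=> w1; rewrite addrC addKr normcM nE -[ltRHS]mulr1 ltr_pM2l.
have gc z c : normc (z - a2) < ep -> normc (c - c0) < ga -> tends (nbhs (z, c)) (fun x => g x.1 x.2) (g z c).
  by move=> hz hc; exact: frechet_tends (gfr z c hz hc).
pose Ga z w := - K1 z w / K2 z w.
pose phi c w := g (a2 + E * w) c.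
pose dphi c w := E * Ga (a2 + E * w) (phi c w).
have tline w : tends (nbhs w) (fun w => a2 + E * w) (a2 + E * w).
  apply: tendsD; first exact: tends_cst.
  by apply: tendsM; [exact: tends_cst|move=> e e0; exact: nbhs_normc].
have cphi c w : normc (c - c0) < ga -> normc w < 1 -> tends (nbhs w) (phi c) (phi c w).
  move=> hc w1.
  exact: (tends_comp2 (k := fun x => g x.1 x.2) (f := fun w => a2 + E * w) (g := fun=> c) _ (gc _ _ (inz w w1) hc) (tline w) (tends_cst c)).
have tGa z w : K2 z w != 0 -> tends (nbhs (z, w)) (fun x => Ga x.1 x.2) (Ga z w).
  by move=> n0; apply: tendsM; [apply: tendsN; exact: K1c|apply: tendsV => //; exact: K2c].
have hphi c w v : normc (c - c0) < ga -> normc w < 1 -> cder (fun s : R => phi c (w + s%:C * v)) 0 (dphi c w * v).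
  move=> hc w1.
  have h1 : cder (fun s : R => a2 + E * (w + s%:C * v)) 0 (E * v).
    apply: cder_eq (cderD (cder_cst a2 0) (cderM (cder_cst E 0) (cderD (cder_cst w 0) (cderM (cder_real 0) (cder_cst v 0))))) _.
    ring.
  apply: cder_eq (frechet_curve (gfr _ _ (inz w w1) hc) h1 (cder_cst c 0) _ (erefl c)) _.
    by rewrite mul0r addr0.
  by rewrite mulr0 addr0 /dphi /Ga /phi; ring.
have harm c : normc (c - c0) < ga -> harmonic_on unit_disc (fun w => P (a2 + E * w, phi c w)).
  move=> hc; apply: (Hleaf (b := b2) (c := c) (de := de) (dphi := dphi c)) => //.
  - move=> w w1 e e0.
    have [d d0 Hd] := gfr _ _ (inz w w1) hc (e / ep) (divr_gt0 e0 ep0).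
    exists (d / ep); first exact: divr_gt0.
    move=> s; rewrite ltr_pdivlMr// => hs.
    have := Hd (E * s) 0; rewrite normcM nE normc0 addr0 addr0 mulr0 addr0 mulrC => /(_ hs d0).
    rewrite -[a2 + E * w + E * s]addrA -mulrDr -/(phi c (w + s)) => H; apply: le_trans (le_trans H _).
      by rewrite le_eqVlt; apply/orP; left; apply/eqP; congr normc; rewrite /dphi /Ga /phi; ring.
    by rewrite le_eqVlt; apply/orP; left; apply/eqP; field; rewrite gt_eqF.
  - move=> w w1; apply: tendsM; first exact: tends_cst.
    have [wb _] := Hg _ _ (inz w w1) hc.
    exact: (tends_comp2 (k := fun x => Ga x.1 x.2) (f := fun w => a2 + E * w) (g := phi c) _ (tGa _ _ (HK _ _ (inz w w1) wb)) (tline w) (cphi c w hc w1)).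
  - by move=> w w1; have [] := Hg _ _ (inz w w1) hc.
  - by move=> w w1; have [] := Hg _ _ (inz w w1) hc.
  - move=> z w hz hw kc; have [wb kg] := Hg z c hz hc.
    have := HL z w (g z c) hz hw wb; rewrite kc kg subrr normc0 mulr0 => h.
    have : normc (w - g z c) = 0 by apply/eqP; rewrite eq_le h normc_ge0.
    move/eq0_normc/eqP; rewrite subr_eq0 => /eqP ->.
    by rewrite /phi -/E mulrCA divff// mulr1 subrKC.
have leaf c w (hc : normc (c - c0) < ga) (w1 : normc w < 1) :=
  leaf_levi (E := E) (a := a2) preal (fun w => pP (a2 + E * w, phi c w)) (fun w v => hphi c w v hc)
    (fun w => cphi c w hc) (harm c hc)
    (fun w w1 => P2n _ _ (inz w w1) (proj1 (Hg _ _ (inz w w1) hc))) w1.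
have disc z : normc (z - a2) < ep -> normc ((z - a2) / E) < 1 /\ a2 + E * ((z - a2) / E) = z.
  move=> hz; split; first by rewrite normcM normcV nE ltr_pdivrMr// mul1r.
  by rewrite mulrCA divff// mulr1 subrKC.
have kerG z c : normc (z - a2) < ep -> normc (c - c0) < ga ->
   (evr (dw1 (dz1 p)) (z, g z c) + evr (dw1 (dz2 p)) (z, g z c) * Ga z (g z c) = 0) /\
   (evr (dw2 (dz1 p)) (z, g z c) + evr (dw2 (dz2 p)) (z, g z c) * Ga z (g z c) = 0).
  move=> hz hc; have [w1 wz] := disc z hz.
  have [/kern[]] := leaf c _ hc w1; rewrite /dphi /phi wz /fst /snd => h1 h2 _.
  split; apply: (mulfI E0); rewrite mulr0; [rewrite -h1|rewrite -h2]; ring.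
have kerM z c : normc (z - a2) < ep -> normc (c - c0) < ga ->
   evr M1 (z, g z c) + evr M2 (z, g z c) * Ga z (g z c) = 0.
  by move=> hz hc; have [] := kerG z c hz hc; rewrite /M1 /M2; case: k0E => ->.
(* the slope Ga of the leaves, expressed through p *)
pose Gq z := - evr M1 z / evr M2 z.
have GaE z c : normc (z - a2) < ep -> normc (c - c0) < ga -> Ga z (g z c) = Gq (z, g z c).
  move=> hz hc; have [wb _] := Hg z c hz hc; have n0 := M2n z _ hz wb.
  have := kerM z c hz hc; rewrite /Gq => h; apply: (mulfI n0).
  rewrite [RHS]mulrC divfK//; apply/eqP; rewrite -addr_eq0 addrC; exact/eqP.
(* D i is the numerator of the derivative of M1 / M2 in the i-th variable *)
pose D i z := evr (dvar i M1) z * evr M2 z - evr M1 z * evr (dvar i M2) z.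
pose Gi i z := - D i z / evr M2 z ^+ 2.
have dGq (x y : R -> C) t dx dy : cder x t dx -> cder y t dy -> evr M2 (x t, y t) != 0 ->
   cder (fun s => Gq (x s, y s)) t (Gi 0%N (x t, y t) * dx + Gi 1%N (x t, y t) * dy + Gi 2%N (x t, y t) * dx^J + Gi 3%N (x t, y t) * dy^J).
  move=> h1 h2 n0.
  apply: cder_eq (cderM (cderN (cder_evr M1 h1 h2)) (cderV n0 (cder_evr M2 h1 h2))) _.
  rewrite /Gi /D; field; exact: n0.
have ij : (Ci : C)^J = - Ci by apply: complexP => /=; rewrite ?oppr0.
have Ci0 : (Ci : C) != 0 by rewrite -normc_gt0 normc_i.
(* along a leaf: phi'' is complex linear *)
have eq1 z c : normc (z - a2) < ep -> normc (c - c0) < ga ->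
   Gi 2%N (z, g z c) * E^J + Gi 3%N (z, g z c) * (E * Ga z (g z c))^J = 0.
  move=> hz hc; have [w1 wz] := disc z hz; set w := (z - a2) / E in w1 wz.
  have [_ [psi [k1 k2]]] := leaf c w hc w1.
  have kv v : cder (fun s : R => dphi c (w + s%:C * v)) 0
     (E * (Gi 0%N (z, g z c) * (E * v) + Gi 1%N (z, g z c) * (dphi c w * v) +
        Gi 2%N (z, g z c) * (E * v)^J + Gi 3%N (z, g z c) * (dphi c w * v)^J)).
    apply: (@cder_near _ (fun s : R => E * Gq (a2 + E * (w + s%:C * v), phi c (w + s%:C * v)))).
      near=> s; rewrite /dphi GaE//; apply: inz; near: s; exact: disc_near.
    have h1 : cder (fun s : R => a2 + E * (w + s%:C * v)) 0 (E * v).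
      apply: cder_eq (cderD (cder_cst a2 0) (cderM (cder_cst E 0) (cderD (cder_cst w 0) (cderM (cder_real 0) (cder_cst v 0))))) _.
      ring.
    have w00 : w + 0%:C * v = w by rewrite mul0r addr0.
    have n0 : evr M2 (a2 + E * (w + 0%:C * v), phi c (w + 0%:C * v)) != 0.
      by rewrite w00; apply: M2n; [exact: inz|have [] := Hg _ _ (inz w w1) hc].
    apply: cder_eq (cderM (cder_cst E 0) (dGq _ _ _ _ _ h1 (hphi c w v hc w1) n0)) _.
    by rewrite w00 /phi wz mul0r add0r.
  have e1 := cder_uniq k1 (kv 1); have e2 := cder_uniq k2 (kv Ci).
  move: e2; rewrite e1 /dphi /phi wz !conjE ij !mulr1 => e2.
  exact: (leaf_alg E0 Ci0 e2).
(* across the leaves: compare the directions 1 and i for dc *)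
have eq2 z c : normc (z - a2) < ep -> normc (c - c0) < ga -> Gi 3%N (z, g z c) = 0.
  move=> hz hc.
  pose r := Num.min (ep - normc (z - a2)) (ga - normc (c - c0)).
  have rpos : 0 < r by rewrite lt_min !subr_gt0 hz.
  have zs (s : R) : `|s| < r -> normc (z + s%:C * 1 - a2) < ep.
    rewrite lt_min => /andP[h _]; rewrite mulr1 addrAC.
    by apply: le_lt_trans (normcD _ _) _; rewrite normcR; lra.
  have ct v (t : R) : normc v = 1 -> `|t| < r -> normc (c + t%:C * v - c0) < ga.
    move=> v1; rewrite lt_min => /andP[_ h]; rewrite addrAC.
    by apply: le_lt_trans (normcD _ _) _; rewrite normcM normcR v1; lra.
  pose gv v (x : R * R) := g (z + x.1%:C * 1) (c + x.2%:C * v).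
  pose pv v (x : R * R) := (z + x.1%:C * 1, gv v x).
  pose F v (x : R * R) := Gi 1%N (pv v x) * (v / K2 (pv v x).1 (pv v x).2) + Gi 3%N (pv v x) * (v / K2 (pv v x).1 (pv v x).2)^J.
  have gv0 v : gv v (0, 0) = g z c by rewrite /gv /= !mul0r !addr0.
  have pv0 v : pv v (0, 0) = (z, g z c) by rewrite /pv gv0 /= mul0r addr0.
  have [wb kw] := Hg z c hz hc.
  have m20 := M2n z _ hz wb; have k20 := HK z _ hz wb.
  have cF v : normc v = 1 -> cder (fun s : R => v / K2 (z + s%:C * 1) (g (z + s%:C * 1) c)) 0
     (Gi 1%N (z, g z c) * (v / K2 z (g z c)) + Gi 3%N (z, g z c) * (v / K2 z (g z c))^J).
    move=> v1.
    have F0 : F v (0, 0) = Gi 1%N (z, g z c) * (v / K2 z (g z c)) + Gi 3%N (z, g z c) * (v / K2 z (g z c))^J by rewrite /F pv0.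
    rewrite -F0; apply: (@schwarz _ (fun s t => gv v (s, t)) (fun s t => Gq (pv v (s, t))) (fun s t => F v (s, t))
      (fun s : R => v / K2 (z + s%:C * 1) (g (z + s%:C * 1) c)) r rpos).
    - move=> s t hs ht; have hz' := zs s hs; have hc' := ct v t v1 ht.
      apply: cder_eq (frechet_curve (gfr _ _ hz' hc') (cder_affine z 1 s) (cder_cst (c + t%:C * v) s) (erefl _) (erefl _)) _.
      by rewrite -/(Ga _ _) GaE// mulr1 mulr0 addr0.
    - move=> s t hs ht; have hz' := zs s hs; have hc' := ct v t v1 ht.
      have dg := frechet_curve (gfr _ _ hz' hc') (cder_cst (z + s%:C * 1) t) (cder_affine c v t) (erefl _) (erefl _).
      have [wb' _] := Hg _ _ hz' hc'.
      apply: cder_eq (dGq _ _ _ _ _ (cder_cst (z + s%:C * 1) t) dg (M2n _ _ hz' wb')) _.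
      rewrite conj0 !mulr0 add0r addr0 add0r [_^-1 * v]mulrC; reflexivity.
    - move=> s hs; have hz' := zs s hs; have hc' : normc (c + 0%:C * v - c0) < ga by rewrite mul0r addr0.
      have dg := frechet_curve (gfr _ _ hz' hc') (cder_cst (z + s%:C * 1) 0) (cder_affine c v 0) (erefl _) (erefl _).
      apply: cder_eq dg _; by rewrite mulr0 add0r mulrC mul0r addr0.
    apply: (@tends_R2 (F v)); rewrite F0.
    have tz := tends_fst0 z 1.
    have tg : tends (nbhs ((0 : R), (0 : R))) (gv v) (g z c).
      exact: (tends_comp2 (k := fun x => g x.1 x.2) (f := fun x : R * R => z + x.1%:C * 1) (g := fun x : R * R => c + x.2%:C * v) _ (gc _ _ hz hc) (tends_fst0 z 1) (tends_snd0 c v)).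
    have tev q : tends (nbhs ((0 : R), (0 : R))) (fun x => evr q (pv v x)) (evr q (z, g z c)).
      exact: (tends_bool (evr_sm2 q) (tends_fst0 z 1) tg).
    have tGi i : tends (nbhs ((0 : R), (0 : R))) (fun x => Gi i (pv v x)) (Gi i (z, g z c)).
      apply: tendsM.
        apply: tendsN; apply: tendsD; first exact: tendsM.
        by apply: tendsN; exact: tendsM.
      by apply: tendsV; [rewrite expf_neq0|rewrite expr2; exact: tendsM].
    have tK : tends (nbhs ((0 : R), (0 : R))) (fun x => v / K2 (pv v x).1 (pv v x).2) (v / K2 z (g z c)).
      apply: tendsM; first exact: tends_cst.
      apply: tendsV => //.
      exact: (tends_comp2 (k := fun x => K2 x.1 x.2) (f := fun x : R * R => z + x.1%:C * 1) (g := gv v) _ (@K2c _ _) (tends_fst0 z 1) tg).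
    by apply: tendsD; [apply: tendsM|apply: tendsM => //; exact: tendsJ].
  have c1 := cF 1 (@normc1 R); have c2 := cF Ci (@normc_i R).
  have c3 : cder (fun s : R => Ci / K2 (z + s%:C * 1) (g (z + s%:C * 1) c)) 0
     (Ci * (Gi 1%N (z, g z c) * (1 / K2 z (g z c)) + Gi 3%N (z, g z c) * (1 / K2 z (g z c))^J)).
    apply: cder_ext (cder_eq (cderM (cder_cst Ci 0) c1) _) => [s|]; first by rewrite mul1r.
    by rewrite mul0r add0r.
  have := cder_uniq c3 c2; rewrite !div1r !conjM ij; apply: transverse_alg => //.
  by rewrite conjV invr_eq0 -normc_gt0 normc_conj normc_gt0.
have eq3 z c : normc (z - a2) < ep -> normc (c - c0) < ga -> Gi 2%N (z, g z c) = 0.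
  move=> hz hc; have := eq1 z c hz hc; rewrite eq2// mul0r addr0 => /eqP.
  have : E^J != 0 by rewrite -normc_gt0 normc_conj normc_gt0.
  by move=> /negbTE EJ; rewrite mulf_eq0 EJ orbF => /eqP.
have [d3 d30 Hd3] := tends_box (frechet_tends (kd a2 b2)) ga0.
pose r3 := Num.min d3 (Num.min ep de).
have r30 : 0 < r3 by rewrite !lt_min d30 ep0.
have gk z w : normc (z - a2) < r3 -> normc (w - b2) < r3 ->
  [/\ normc (z - a2) < ep, normc (w - b2) < de, normc (k z w - c0) < ga & g z (k z w) = w].
  rewrite !lt_min => /andP[h1 /andP[h2 _]] /andP[h3 /andP[_ h4]].
  have hc : normc (k z w - c0) < ga := Hd3 z w h1 h3.
  have [wb kw] := Hg z _ h2 hc; split => //.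
  have := HL z _ _ h2 wb h4; rewrite kw subrr normc0 mulr0 => h.
  have /eq0_normc/eqP : normc (g z (k z w) - w) = 0 by apply/eqP; rewrite eq_le h normc_ge0.
  by rewrite subr_eq0 => /eqP.
have DE i z w : normc (z - a2) < ep -> normc (w - b2) < de -> Gi i (z, w) = 0 -> D i (z, w) = 0.
  move=> h1 h2 /eqP; rewrite /Gi mulf_eq0 invr_eq0 expf_eq0 (negbTE (M2n _ _ h1 h2)) orbF oppr_eq0.
  by move=> /eqP.
(* D 2 and D 3 vanish on the box, hence identically *)
have polD i : (i = 2%N \/ i = 3%N) -> forall z1 z2 w1 w2, ev (dvar i M1) z1 z2 w1 w2 * ev M2 z1 z2 w1 w2 = ev M1 z1 z2 w1 w2 * ev (dvar i M2) z1 z2 w1 w2.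
  move=> hi z1 z2 w1 w2; apply/eqP; rewrite -subr_eq0 -!evM -evB; apply/eqP.
  apply: (polarize r30 (a1 := a2) (a2 := b2)) => z w hz hw.
  have [h1 h2 h3 h4] := gk z w hz hw.
  rewrite evB !evM; apply: (DE i z w h1 h2); rewrite -h4.
  by case: hi => ->; [exact: eq3|exact: eq2].
have polK i : (i = 2%N \/ i = 3%N) -> forall z1 z2 w1 w2, ev (dvar i (dz1 p)) z1 z2 w1 w2 * ev M2 z1 z2 w1 w2 = ev (dvar i (dz2 p)) z1 z2 w1 w2 * ev M1 z1 z2 w1 w2.
  move=> hi z1 z2 w1 w2; apply/eqP; rewrite -subr_eq0 -!evM -evB; apply/eqP.
  apply: (polarize r30 (a1 := a2) (a2 := b2)) => z w hz hw.
  have [h1 h2 h3 h4] := gk z w hz hw.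
  rewrite evB !evM -[ev (dvar i (dz1 p)) _ _ _ _]/(evr (dvar i (dz1 p)) (z, w))
    -[ev (dvar i (dz2 p)) _ _ _ _]/(evr (dvar i (dz2 p)) (z, w)) -[ev M1 _ _ _ _]/(evr M1 (z, w)) -[ev M2 _ _ _ _]/(evr M2 (z, w)).
  have [k1 k2] := kerG z _ h1 h3; have k3 := kerM z _ h1 h3; rewrite h4 in k1 k2 k3.
  have e3 : evr M1 (z, w) = - (evr M2 (z, w) * Ga z w) by apply/eqP; rewrite -addr_eq0; apply/eqP.
  have e4 : evr (dvar i (dz1 p)) (z, w) = - (evr (dvar i (dz2 p)) (z, w) * Ga z w).
    by apply/eqP; rewrite -addr_eq0; apply/eqP; case: hi => ->.
  by rewrite e3 e4; ring.
exists a2, b2, r3; split=> // z w hz hw.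
have [h1 h2 _ _] := gk z w hz hw.
have [np1 np2] := noplur z w.
exact: (gradient_ratio_const np1 np2 (polD 2%N (or_introl erefl) z w) (polD 3%N (or_intror erefl) z w)
  (polK 2%N (or_introl erefl) z w) (polK 3%N (or_intror erefl) z w) (M2n _ _ h1 h2)).
Unshelve. all: by end_near. Qed.

End gradients.

(** * Level curves of an entire function *)

Section entire.
Context {R : realType}.
Local Notation C := R[i].

Lemma cvg_tends (T : Type) (F : set_system T) (f : T -> C) (l : C) :
  f @ F --> l -> tends F f l.
Proof. by move=> H e e0; exact: (H _ (nbhs_normc l e0)). Qed.

Lemma tends_cvg (T : Type) (F : set_system T) (FF : Filter F) (f : T -> C) (l : C) :
  tends F f l -> f @ F --> l.
Proof.
move=> H V /nbhs_normcP[d d0 Hd]; rewrite /nbhs /= /fmap /=.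
by apply: filterS (H d d0) => x; exact: Hd.
Qed.

Lemma tends_pair (T : Type) (F : set_system T) (FF : Filter F) (k : T -> C * C) (f g : T -> C) (l m : C) :
  (\forall x \near F, k x = (f x, g x)) -> tends F f l -> tends F g m -> k @ F --> (l, m).
Proof.
move=> kfg fl gm V /nbhs_normc2P[d d0 Hd]; rewrite /nbhs /= /fmap /=.
suff : \forall x \near F, V (k x) by [].
near=> x; have -> : k x = (f x, g x) by near: x.
by apply: Hd; near: x; [exact: fl|exact: gm].
Unshelve. all: by end_near. Qed.

Lemma norm2_normc (s t : C) : `|(s, t)| = (Num.max (normc s) (normc t))%:C :> C.
Proof.
rewrite prod_normE /= !normE; have [h|h] := leP (normc s) (normc t).
  by rewrite max_r// lecR.
by rewrite max_l// lecR ltW.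
Qed.

Lemma frechet_of_diff (h : C * C -> C) (a b : C) : differentiable h (a, b) ->
  frechet (fun z w => h (z, w)) a b ('D_((1, 0) : C * C) h (a, b)) ('D_((0, 1) : C * C) h (a, b)).
Proof.
move=> dh e e0; have /eqaddoP/(_ e%:C) := diff_locally dh.
rewrite ltcR => /(_ e0) /nbhs_normc2P[d d0 Hd]; exists d => // s t hs ht.
have := Hd (s, t); rewrite !subr0 => /(_ hs ht) /=.
rewrite [_ (s, t)]/= norm2_normc normE -rmorphM lecR => H.
have E : 'd h (a, b) (s, t) = 'D_((1, 0) : C * C) h (a, b) * s + 'D_((0, 1) : C * C) h (a, b) * t.
  rewrite !deriveE//.
  have -> : (s, t) = s *: (1, 0) + t *: (0, 1) :> C * C.
    by congr pair; rewrite /= /GRing.scale /= ?mulr1 ?mulr0 ?addr0 ?add0r.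
  by rewrite linearD !linearZ /= /GRing.scale /= (mulrC s) (mulrC t).
rewrite -E; apply: le_trans (_ : e * Num.max (normc s) (normc t) <= _).
  apply: le_trans H; rewrite le_eqVlt; apply/orP; left; apply/eqP; congr normc.
  rewrite -[RHS]/(h (s + a, t + b) - (h (a, b) + 'd h (a, b) (s, t))).
  by rewrite opprD addrA [s + a]addrC [t + b]addrC.
rewrite ler_pM2l// ge_max lerDl lerDr !normc_ge0//.
Qed.

Lemma frechet_swap (k : C -> C -> C) a b A B : frechet k a b A B -> frechet (fun z w => k w z) b a B A.
Proof.
move=> H e e0; have [d d0 Hd] := H e e0; exists d => // s t hs ht.
by have := Hd t s ht hs; rewrite [A * t + _]addrC [normc t + _]addrC.
Qed.

Lemma tends_swap (K : C -> C -> C) (a b l : C) : tends (nbhs (a, b)) (fun z : C * C => K z.1 z.2) l ->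
  tends (nbhs (b, a)) (fun z : C * C => K z.2 z.1) l.
Proof.
move=> H e e0; have [d d0 Hd] := nbhs_normc2P (H e e0).
by near=> z; have [] : normc (z.1 - b) < d /\ normc (z.2 - a) < d;
  [near: z; exact: nbhs_normc2|move=> h1 h2; exact: (Hd (z.2, z.1))].
Unshelve. all: by end_near. Qed.

Lemma frechet_const (k K1 K2 : C -> C -> C) : (forall z w, frechet k z w (K1 z w) (K2 z w)) ->
  (forall z w, K1 z w = 0) -> (forall z w, K2 z w = 0) -> forall z w, k z w = k 0 0.
Proof.
move=> kd k1 k2 z w.
have H (t : R) : cder (fun s : R => k (0 + s%:C * z) (0 + s%:C * w)) t 0.
  apply: cder_eq (frechet_curve (kd _ _) (cder_affine 0 z t) (cder_affine 0 w t) (erefl _) (erefl _)) _.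
  by rewrite k1 k2 !mul0r addr0.
have := @cmvt_le _ _ (fun=> 0) 0 (lexx _) (fun t _ => H t).
rewrite normc0 !mul1r !mul0r !addr0 !add0r => /(_ (fun _ _ => lexx _)) h.
have /eq0_normc/eqP : normc (k z w - k 0 0) = 0 by apply/eqP; rewrite eq_le h normc_ge0.
by rewrite subr_eq0 => /eqP.
Qed.

Lemma cdiff_cvg (f : C -> C) (w l v : C) : cdiff f w l ->
  (fun h : C => h^-1 *: (f (h *: v + w) - f w)) @ 0^' --> l * v.
Proof.
move=> H; apply: tends_cvg => e e0.
have nv : 0 < normc v + 1 by have := normc_ge0 v; lra.
have [d d0 Hd] := H (e / (normc v + 1) / 2) (divr_gt0 (divr_gt0 e0 nv) (ltr0n _ 2)).
near=> h.
have h0 : h != 0 by near: h; exact: nbhs_dnbhs_neq.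
have hd : normc (h - 0) < d / (normc v + 1).
  near: h; apply: cvg_within; apply: nbhs_normc; exact: divr_gt0.
rewrite subr0 in hd; have nh : 0 < normc h by rewrite normc_gt0.
have hv : normc (h * v) < d.
  rewrite normcM; apply: le_lt_trans (_ : normc h * (normc v + 1) < _); last by rewrite -ltr_pdivlMr.
  by rewrite ler_pM2l// lerDl.
have := Hd _ hv; rewrite [w + _]addrC => k1.
have -> : h^-1 *: (f (h *: v + w) - f w) - l * v = h^-1 * (f (h * v + w) - f w - l * (h * v)).
  by rewrite /GRing.scale /=; field.
rewrite normcM normcV mulrC ltr_pdivrMr//; apply: le_lt_trans k1 _.
rewrite normcM; set g := e / (normc v + 1) / 2.
have g0 : 0 < g by rewrite !divr_gt0.
have -> : e * normc h = g * ((normc v + 1) * normc h) * 2.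
  by rewrite /g; field; rewrite gt_eqF.
have q : g * (normc h * normc v) <= g * ((normc v + 1) * normc h).
  by rewrite ler_pM2l// mulrC ler_pM2r// lerDl.
have : 0 < g * ((normc v + 1) * normc h) by rewrite mulr_gt0// mulr_gt0.
lra.
Unshelve. all: by end_near. Qed.

Section curve.
Variables (f1 f2 d1 d2 : C -> C).
Hypothesis h1 : forall w, normc w < 1 -> cdiff f1 w (d1 w).
Hypothesis h2 : forall w, normc w < 1 -> cdiff f2 w (d2 w).
Hypothesis c1 : forall w, normc w < 1 -> tends (nbhs w) d1 (d1 w).
Hypothesis c2 : forall w, normc w < 1 -> tends (nbhs w) d2 (d2 w).

Lemma cdiff_differentiable (f : C -> C) (w l : C) : cdiff f w l -> differentiable f w.
Proof.
move=> H; apply/derivable1_diffP; apply/cvg_ex; exists (l * 1); exact: cdiff_cvg.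
Qed.

Lemma derive_curve w v : normc w < 1 -> 'D_v (fun w => (f1 w, f2 w)) w = (d1 w * v, d2 w * v).
Proof.
move=> w1; rewrite /derive; apply: cvg_lim; first exact: norm_hausdorff.
apply: (@tends_pair _ _ _ _ (fun h : C => h^-1 *: (f1 (h *: v + w) - f1 w)) (fun h : C => h^-1 *: (f2 (h *: v + w) - f2 w))).
- by near=> h.
- exact: (cvg_tends (@cdiff_cvg _ _ _ v (h1 w1))).
- exact: (cvg_tends (@cdiff_cvg _ _ _ v (h2 w1))).
Unshelve. all: by end_near. Qed.

Lemma holomorphic_curve : holomorphic_on (@unit_disc R) (fun w => (f1 w, f2 w)).
Proof.
move=> w /unit_discP w1; split.
  apply: differentiable_pair; apply: cdiff_differentiable; [exact: h1|exact: h2].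
move=> v.
suff : 'D_v (fun w => (f1 w, f2 w)) @ w --> 'D_v (fun w => (f1 w, f2 w)) w by [].
rewrite (derive_curve v w1).
have e1 : \forall z \near (w : C), 'D_v (fun w => (f1 w, f2 w)) z = (d1 z * v, d2 z * v).
  by near=> z; apply: derive_curve; near: z; exact: disc_nbhs.
have t1 : tends (nbhs (w : C)) (fun w => d1 w * v) (d1 w * v) by apply: tendsM; [exact: c1|exact: tends_cst].
have t2 : tends (nbhs (w : C)) (fun w => d2 w * v) (d2 w * v) by apply: tendsM; [exact: c2|exact: tends_cst].
refine (tends_pair _ e1 t1 t2).
Unshelve. all: by end_near. Qed.

(** One of the two coordinates of the leaves is affine in the parameter, so it
supplies the continuous inverse psi; here psi is any smooth expression. *)
Lemma curve_parametrization (S W : set (C * C)) (psi : C * C -> C) :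
  (forall w, normc w < 1 -> d1 w != 0 \/ d2 w != 0) ->
  open W -> (forall w, normc w < 1 -> (S `&` W) (f1 w, f2 w)) ->
  (forall x, (S `&` W) x -> normc (psi x) < 1 /\ (f1 (psi x), f2 (psi x)) = x) ->
  sm2 psi -> (forall w, normc w < 1 -> psi (f1 w, f2 w) = w) ->
  local_parametrization S (fun w => (f1 w, f2 w)).
Proof.
move=> dn oW SW WS spsi psif; split; first exact: holomorphic_curve.
  move=> w /unit_discP w1; rewrite derive_curve// !mulr1.
  by apply/eqP => -[e1 e2]; have [] := dn w w1; rewrite ?e1 ?e2 eqxx.
exists W, psi; split => //.
- apply/seteqP; split => [x [w /unit_discP w1 <-]|x /WS[w1 fx]]; first exact: SW.
  by exists (psi x) => //; exact/unit_discP.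
- apply: continuous_subspaceT => x; apply: tends_cvg => e; exact: sm2_nbhs.
by move=> w /unit_discP; exact: psif.
Qed.

End curve.

Lemma open_box (a b : C) (e d : R) : open [set x : C * C | normc (x.1 - a) < e /\ normc (x.2 - b) < d].
Proof.
rewrite openE => x /= [hx hy]; rewrite /interior.
have m0 : 0 < Num.min (e - normc (x.1 - a)) (d - normc (x.2 - b)) by rewrite lt_min !subr_gt0 hx.
near=> y.
have [] : normc (y.1 - x.1) < Num.min (e - normc (x.1 - a)) (d - normc (x.2 - b)) /\
   normc (y.2 - x.2) < Num.min (e - normc (x.1 - a)) (d - normc (x.2 - b)) by near: y; exact: nbhs_normc2.
rewrite !lt_min => /andP[k1 _] /andP[_ k2].
have := normc_tri x.1 y.1 a; have := normc_tri x.2 y.2 b; rewrite /=; split; lra.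
Unshelve. all: by end_near. Qed.

Lemma open_box' (a b : C) (e d : R) : open [set x : C * C | normc (x.2 - a) < e /\ normc (x.1 - b) < d].
Proof.
have -> : [set x : C * C | normc (x.2 - a) < e /\ normc (x.1 - b) < d] =
  [set x | normc (x.1 - b) < d /\ normc (x.2 - a) < e] by apply/seteqP; split => x /= [].
exact: open_box.
Qed.

Lemma cdiff_affine (a E w : C) : cdiff (fun w => a + E * w) w E.
Proof.
move=> e e0; exists 1 => // s _.
have -> : a + E * (w + s) - (a + E * w) - E * s = 0 by ring.
by rewrite normc0 mulr_ge0// ?normc_ge0// ltW.
Qed.

Section leaf.
Variables (h : C * C -> C) (P : C * C -> R).
Hypothesis hP : forall c, harmonic_along_smooth_part P (h @^-1` [set c]).
Variables (a b c : C) (ep de : R) (phi dphi : C -> C).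
Hypothesis ep0 : 0 < ep.
Hypothesis phid : forall w, normc w < 1 -> cdiff phi w (dphi w).
Hypothesis phic : forall w, normc w < 1 -> tends (nbhs w) dphi (dphi w).
Hypothesis phib : forall w, normc w < 1 -> normc (phi w - b) < de.

Let E : C := ep%:C.
Let E0 : E != 0. Proof. by apply/eqP => -[] e; move: ep0; rewrite e ltxx. Qed.
Let nE : normc E = ep. Proof. by rewrite normcR ger0_norm// ltW. Qed.
Let inz w : normc w < 1 -> normc (a + E * w - a) < ep.
Proof. by move=> w1; rewrite addrC addKr normcM nE -[ltRHS]mulr1 ltr_pM2l. Qed.
Let psiE w : (a + E * w - a) / E = w.
Proof. by rewrite addrC addKr mulrC mulKf. Qed.
Let psiK z : a + E * ((z - a) / E) = z.
Proof. by rewrite mulrCA divff// mulr1 subrKC. Qed.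
Let psi1 z : normc (z - a) < ep -> normc ((z - a) / E) < 1.
Proof. by move=> hz; rewrite normcM normcV nE ltr_pdivrMr// mul1r. Qed.

Lemma leaf_harmonic :
  (forall w, normc w < 1 -> h (a + E * w, phi w) = c) ->
  (forall z w, normc (z - a) < ep -> normc (w - b) < de -> h (z, w) = c -> w = phi ((z - a) / E)) ->
  harmonic_on unit_disc (fun w => P (a + E * w, phi w)).
Proof.
move=> hc hu; apply: (hP (c := c)).
apply: (@curve_parametrization _ _ (fun=> E) dphi _ phid _ phic _
   [set x : C * C | normc (x.1 - a) < ep /\ normc (x.2 - b) < de] (fun x => (x.1 - a) / E)).
- by move=> w _; exact: cdiff_affine.
- by move=> w _; exact: tends_cst.
- by move=> w _; left.
- exact: open_box.
- by move=> w w1; split=> /=; [exact: hc|split; [exact: inz|exact: phib]].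
- move=> [x y] /= [hxy [hx hy]]; split; first exact: psi1.
  by rewrite psiK -(hu x y).
- exact: (sm_mul (sm_add (sm_X X2 true) (sm_cst _ _)) (sm_cst _ _)).
- by move=> w _; exact: psiE.
Qed.

Lemma leaf_harmonic_swap :
  (forall w, normc w < 1 -> h (phi w, a + E * w) = c) ->
  (forall z w, normc (z - a) < ep -> normc (w - b) < de -> h (w, z) = c -> w = phi ((z - a) / E)) ->
  harmonic_on unit_disc (fun w => P (phi w, a + E * w)).
Proof.
move=> hc hu; apply: (hP (c := c)).
apply: (@curve_parametrization _ _ dphi (fun=> E) phid _ phic _ _
   [set x : C * C | normc (x.2 - a) < ep /\ normc (x.1 - b) < de] (fun x => (x.2 - a) / E)).
- by move=> w _; exact: cdiff_affine.
- by move=> w _; exact: tends_cst.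
- by move=> w _; right.
- exact: open_box'.
- by move=> w w1; split=> /=; [exact: hc|split; [exact: inz|exact: phib]].
- move=> [x y] /= [hxy [hy hx]]; split; first exact: psi1.
  by rewrite psiK -(hu y x).
- exact: (sm_mul (sm_add (sm_X X2 false) (sm_cst _ _)) (sm_cst _ _)).
- by move=> w _; exact: psiE.
Qed.

End leaf.

(** Exchanging the two coordinates reduces dh/dz1 <> 0 to dh/dz2 <> 0. *)
Lemma swap_poly (q : mpoly.mpoly 4 C) : exists q', forall z1 z2 w1 w2, ev q' z1 z2 w1 w2 = ev q z2 z1 w2 w1.
Proof.
elim/mpoly_ring_ind: q => [c|i|q r [q' hq] [r' hr]|q r [q' hq] [r' hr]].
- by exists (mpoly.mpolyC 4 c) => *; rewrite !evE !mpoly.mevalC.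
- suff [j Hj] : exists j : 'I_4, forall z1 z2 w1 w2 : C, tnth [tuple z1; z2; w1; w2] j = tnth [tuple z2; z1; w2; w1] i.
    by exists (mpoly.mpolyX _ (mpoly.mnm1 j)) => *; rewrite !evE !mpoly.mevalXU.
  by elim/ord4P: i; [exists (inord 1)|exists (inord 0)|exists (inord 3)|exists (inord 2)] => z1 z2 w1 w2;
    have [e1 e2 e3 e4] := tnth4 z1 z2 w1 w2; have [e1' e2' e3' e4'] := tnth4 z2 z1 w2 w1;
    rewrite ?e1 ?e2 ?e3 ?e4 ?e1' ?e2' ?e3' ?e4'.
- by exists (q' + r') => *; rewrite !evE !mpoly.mevalD -!evE hq hr.
- by exists (q' * r') => *; rewrite !evM hq hr.
Qed.

Lemma swap_poly_der (q q' : mpoly.mpoly 4 C) : (forall z1 z2 w1 w2, ev q' z1 z2 w1 w2 = ev q z2 z1 w2 w1) ->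
  forall z1 z2 w1 w2, ev (dz1 q') z1 z2 w1 w2 = ev (dz2 q) z2 z1 w2 w1 /\
    ev (dz2 q') z1 z2 w1 w2 = ev (dz1 q) z2 z1 w2 w1.
Proof.
move=> H z1 z2 w1 w2.
have aff (z : C) : cder (fun s : R => z + s%:C * 1) 0 1 by exact: cder_affine.
have cs (z : C) : cder (fun s : R => z) 0 0 by exact: cder_cst.
split.
  have h1 := cder_ev q' (aff z1) (cs z2) (cs w1) (cs w2).
  have h2 := cder_ev q (cs z2) (aff z1) (cs w2) (cs w1).
  have := cder_uniq h1 (cder_ext (fun s => esym (H _ _ _ _)) h2).
  by rewrite !mul0r !addr0 !mulr0 !addr0 !mulr1 !add0r.
have h1 := cder_ev q' (cs z1) (aff z2) (cs w1) (cs w2).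
have h2 := cder_ev q (aff z2) (cs z1) (cs w2) (cs w1).
have := cder_uniq h1 (cder_ext (fun s => esym (H _ _ _ _)) h2).
by rewrite !mul0r !addr0 !mulr0 !addr0 !mulr1 !add0r.
Qed.

(** For fixed w and w' the claim is polynomial in z; restrict it to lines through
the centre of the box. *)
Lemma parallel_everywhere (q r : mpoly.mpoly 4 C) a b (e : R) : 0 < e ->
  (forall z w w1 w2 w1' w2', normc (z - a) < e -> normc (w - b) < e ->
     ev q z w w1 w2 * ev r z w w1' w2' = ev r z w w1 w2 * ev q z w w1' w2') ->
  forall z w w1 w2 w1' w2', ev q z w w1 w2 * ev r z w w1' w2' = ev r z w w1 w2 * ev q z w w1' w2'.
Proof.
move=> e0 H z w w1 w2 w1' w2'.
have lin (g : mpoly.mpoly 4 C) v1 v2 : exists G : {poly C}, forall s, G.[s] = ev g (a + s * (z - a)) (b + s * (w - b)) v1 v2.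
  have [G HG] := line_poly g (tnth [tuple a; b; v1; v2]) (tnth [tuple z - a; w - b; 0; 0]).
  exists G => s; have [-> _] := HG s; rewrite evE; apply: mpoly.meval_eq; apply: ord4P;
   rewrite !(tnth_nth 0) /= ?inordK//= mulr0 addr0//.
have [Q1 HQ1] := lin q w1 w2; have [R1 HR1] := lin r w1' w2'.
have [R2 HR2] := lin r w1 w2; have [Q2 HQ2] := lin q w1' w2'.
pose N := 1 + normc (z - a) + normc (w - b).
have z0 := normc_ge0 (z - a); have w0 := normc_ge0 (w - b).
have N0 : 0 < N by rewrite /N; lra.
have small (s x : R) : `|s| < e / N -> 0 <= x <= N -> `|s| * x < e.
  move=> hs /andP[x0 xN]; apply: le_lt_trans (_ : `|s| * N < _); first by rewrite ler_wpM2l.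
  by rewrite -ltr_pdivlMr.
have D0 : Q1 * R1 - R2 * Q2 = 0.
  apply: (poly_real_roots (r := e / N)); first exact: divr_gt0.
  move=> s hs; rewrite !hornerE HQ1 HR1 HR2 HQ2 H ?subrr//.
    by rewrite addrC addKr normcM normcR; apply: small => //; rewrite /N; lra.
  by rewrite addrC addKr normcM normcR; apply: small => //; rewrite /N; lra.
have := congr1 (horner^~ 1) D0; rewrite /= !hornerE HQ1 HR1 HR2 HQ2 !mul1r !subrKC => /eqP.
by rewrite subr_eq0 => /eqP.
Qed.

End entire.

(** * From level curves to parallel gradients *)

Section parallel_gradients.
Context {R : realType}.
Local Notation C := R[i].
Implicit Types (p q : mpoly.mpoly 4 C) (P : C * C -> R).

Lemma real_polyP p P : is_real_poly2 p P <-> forall z, (P z)%:C = evr p z.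
Proof. by split => H z; rewrite H /evr evE. Qed.

(** At w = 0 the function p is constant in z. *)
Lemma dz_vanish p : (forall z1 z2, ev p z1 z2 0 0 = 0) ->
  forall z1 z2, ev (dz1 p) z1 z2 0 0 = 0 /\ ev (dz2 p) z1 z2 0 0 = 0.
Proof.
move=> H z1 z2.
have aff (z : C) : cder (fun s : R => z + s%:C * 1) 0 1 by exact: cder_affine.
have cs (z : C) : cder (fun s : R => z) 0 0 by exact: cder_cst.
split.
  have := cder_uniq (cder_ev p (aff z1) (cs z2) (cs 0) (cs 0)) (cder_ext (fun s => esym (H _ _)) (cs 0)).
  by rewrite !mul0r !addr0 !mulr0 !addr0 mulr1.
have := cder_uniq (cder_ev p (cs z1) (aff z2) (cs 0) (cs 0)) (cder_ext (fun s => esym (H _ _)) (cs 0)).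
by rewrite !mul0r !addr0 !mulr0 !addr0 mulr1 add0r.
Qed.

Lemma noplur_vanish p : no_pluriharmonic_terms p -> forall z1 z2, ev p z1 z2 0 0 = 0.
Proof.
move=> np z1 z2; rewrite evE mpoly.mevalE big1_seq// => m /andP[_ mp].
rewrite mpoly.mcoeff_msupp in mp; have [_ hm] := np m mp.
have [_ _ e3 e4] := tnth4 z1 z2 (0 : C) 0.
have [i [ti mi]] : exists i : 'I_4, tnth [tuple z1; z2; 0; 0] i = 0 /\ (0 < m i)%N.
  have [h|h] := ltnP 0 (m (inord 2)); first by exists (inord 2).
  by exists (inord 3); split=> //; move: hm h; lia.
by rewrite (bigD1 i)//= ti expr0n eqn0Ngt mi mul0r mulr0.
Qed.

(** Parallel z-gradients: this symmetric form avoids a quotient and also covers the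
case where one of the derivatives vanishes identically. *)
Definition parallel p := forall z w w1 w2 w1' w2', ev (dz1 p) z w w1 w2 * ev (dz2 p) z w w1' w2' =
   ev (dz2 p) z w w1 w2 * ev (dz1 p) z w w1' w2'.

Lemma parallel_of_leaves p P (k K1 K2 : C -> C -> C) :
  is_real_poly2 p P -> plurisubharmonic P -> (forall z1 z2, ev p z1 z2 0 0 = 0) ->
  (forall z w, frechet k z w (K1 z w) (K2 z w)) ->
  (forall z w, tends (nbhs (z, w)) (fun z : C * C => K1 z.1 z.2) (K1 z w)) ->
  (forall z w, tends (nbhs (z, w)) (fun z : C * C => K2 z.1 z.2) (K2 z w)) ->
  (forall (a b c : C) (ep de : R) (phi dphi : C -> C), 0 < ep -> 0 < de ->
  (forall w, normc w < 1 -> cdiff phi w (dphi w)) ->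
  (forall w, normc w < 1 -> tends (nbhs w) dphi (dphi w)) ->
  (forall w, normc w < 1 -> normc (phi w - b) < de) ->
  (forall w, normc w < 1 -> k (a + ep%:C * w) (phi w) = c) ->
  (forall z w, normc (z - a) < ep -> normc (w - b) < de -> k z w = c -> w = phi ((z - a) / ep%:C)) ->
  harmonic_on unit_disc (fun w => P (a + ep%:C * w, phi w))) ->
  (exists a b, K2 a b != 0) -> parallel p.
Proof.
move=> pP psh np kd K1c K2c Hl [a [b K20]].
have [E|[a1 [b1 [r [r0 H]]]]] := gradients_proportional_near ((real_polyP _ _).1 pP) (levi_kernel pP psh) (dz_vanish np) kd K1c K2c Hl K20.
  by move=> *; rewrite !E mul0r mulr0.
apply: (parallel_everywhere r0) => z w w1 w2 w1' w2' hz hw.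
by have [rho Hr] := H z w hz hw; rewrite !Hr mulrAC mulrC mulrA.
Qed.

Lemma psh_swap p P : is_real_poly2 p P -> plurisubharmonic P -> plurisubharmonic (fun z => P (z.2, z.1)).
Proof.
move=> pP [_ psh]; split.
  have [q Hq] := swap_poly p; apply: sm2_usc.
  apply: sm_ext (evr_sm2 q) => z.
  by rewrite /evr Hq ((real_polyP _ _).1 pP).
move=> a b; have := psh (a.2, a.1) (b.2, b.1); congr subharmonic.
Qed.

Theorem parallel_of_propertyB p P : is_real_poly2 p P -> plurisubharmonic P ->
  no_pluriharmonic_terms p -> propertyB P -> parallel p.
Proof.
move=> pP psh np [_ [h [hol nc lev]]].
have np' := noplur_vanish np.
pose k z w := h (z, w).
pose K1 z w := 'D_((1, 0) : C * C) h (z, w).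
pose K2 z w := 'D_((0, 1) : C * C) h (z, w).
have kd z w : frechet k z w (K1 z w) (K2 z w) by apply: frechet_of_diff; have [] := hol (z, w) I.
have K1c z w : tends (nbhs (z, w)) (fun z : C * C => K1 z.1 z.2) (K1 z w).
  have [_ /(_ (1, 0)) H] := hol (z, w) I.
  by apply: tends_ext (cvg_tends H) => -[].
have K2c z w : tends (nbhs (z, w)) (fun z : C * C => K2 z.1 z.2) (K2 z w).
  have [_ /(_ (0, 1)) H] := hol (z, w) I.
  by apply: tends_ext (cvg_tends H) => -[].
have [K20|nK2] := pselect (exists a b, K2 a b != 0).
  apply: (parallel_of_leaves pP psh np' kd K1c K2c _ K20).
  move=> a b c ep de phi dphi ep0 de0 h1 h2 h3 h4 h5.
  exact: (leaf_harmonic lev ep0 h1 h2 h3 h4 h5).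
have K10 : exists a b, K1 b a != 0.
  apply: contrapT => nK1; apply: nc; exists (k 0 0) => -[z w].
  apply: (frechet_const kd) => x y; apply/eqP/negPn/negP => H.
    by apply: nK1; exists y, x.
  by apply: nK2; exists x, y.
have [q Hq] := swap_poly p.
have qP : is_real_poly2 q (fun z => P (z.2, z.1)).
  by apply/real_polyP => z; rewrite /evr Hq ((real_polyP _ _).1 pP).
have par : parallel q.
  apply: (parallel_of_leaves qP (psh_swap pP psh) _ (fun z w => frechet_swap (kd w z))
    (fun z w => tends_swap (K2c w z)) (fun z w => tends_swap (K1c w z)) _ K10).
    by move=> z1 z2; rewrite Hq np'.
  move=> a b c ep de phi dphi ep0 de0 h1 h2 h3 h4 h5.
  exact: (leaf_harmonic_swap lev ep0 h1 h2 h3 h4 h5).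
move=> z w w1 w2 w1' w2'.
have dq := swap_poly_der Hq.
have := par w z w2 w1 w2' w1'.
have [-> ->] := dq w z w2 w1; have [-> ->] := dq w z w2' w1'.
by move=> ->.
Qed.

End parallel_gradients.

(** * Binary forms and bidegrees *)

Section form.
Context {R : realType}.
Local Notation C := R[i].
Implicit Types (f g : {poly C}).

(** The binary form z2^a f(z1 / z2); f is its dehomogenization, of degree at most a. *)
Definition form (a : nat) f (z1 z2 : C) : C := \sum_(i < a.+1) f`_i * z1 ^+ i * z2 ^+ (a - i).

Lemma form_scale a f t z1 z2 : form a f (t * z1) (t * z2) = t ^+ a * form a f z1 z2.
Proof.
rewrite /form big_distrr; apply: eq_bigr => i _ /=.
by rewrite !exprMn -[in t ^+ a](subnKC (ltn_ord i : (i <= a)%N)) exprD; ring.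
Qed.

Lemma formZ a c f z1 z2 : form a (c *: f) z1 z2 = c * form a f z1 z2.
Proof. by rewrite /form big_distrr; apply: eq_bigr => i _ /=; rewrite coefZ !mulrA. Qed.

Lemma form0 a z1 z2 : form a 0 z1 z2 = 0.
Proof. by rewrite /form big1// => i _; rewrite coef0 !mul0r. Qed.

Lemma formD a f g z1 z2 : form a (f + g) z1 z2 = form a f z1 z2 + form a g z1 z2.
Proof. by rewrite /form -big_split; apply: eq_bigr => i _ /=; rewrite coefD !mulrDl. Qed.

Lemma form_sum a (I : Type) (r : seq I) (Q : pred I) (F : I -> {poly C}) z1 z2 :
  form a (\sum_(i <- r | Q i) F i) z1 z2 = \sum_(i <- r | Q i) form a (F i) z1 z2.
Proof.
apply: (big_morph (fun f => form a f z1 z2)) => [f g|]; [exact: formD|exact: form0].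
Qed.

Lemma formXn a i z1 z2 : (i <= a)%N -> form a 'X^i z1 z2 = z1 ^+ i * z2 ^+ (a - i).
Proof.
move=> ia; rewrite /form (bigD1 (Ordinal (ia : (i < a.+1)%N)))//= coefXn eqxx mul1r big1 ?addr0// => j ji.
rewrite coefXn; suff /negbTE -> : nat_of_ord j != i by rewrite !mul0r.
by apply: contraNneq ji => E; apply/eqP/val_inj.
Qed.

Lemma form_x1 a f x : (size f <= a.+1)%N -> form a f x 1 = f.[x].
Proof.
by move=> sf; rewrite (horner_coef_wide _ sf); apply: eq_bigr => i _; rewrite expr1n mulr1.
Qed.

Lemma form_div a f z1 z2 : (size f <= a.+1)%N -> z2 != 0 -> form a f z1 z2 = z2 ^+ a * f.[z1 / z2].
Proof.
move=> sf z20; rewrite -(form_x1 _ sf) -form_scale mulr1; congr form.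
by rewrite mulrCA divff// mulr1.
Qed.

Lemma form_z20 a f z1 : form a f z1 0 = f`_a * z1 ^+ a.
Proof.
rewrite /form big_ord_recr /= subnn expr0 mulr1 big1 ?add0r// => i _.
by rewrite expr0n subn_eq0 leqNgt ltn_ord mulr0.
Qed.

Lemma form_inj a f : (size f <= a.+1)%N -> (forall z1 z2, form a f z1 z2 = 0) -> f = 0.
Proof.
move=> sf H; apply: poly_fun_eq => s.
by rewrite horner0 -(form_x1 _ sf).
Qed.

Lemma formM a b f g z1 z2 : (size f <= a.+1)%N -> (size g <= b.+1)%N ->
  form (a + b) (f * g) z1 z2 = form a f z1 z2 * form b g z1 z2.
Proof.
move=> sf sg.
have sfg : (size (f * g)%R <= (a + b).+1)%N.
  by apply: leq_trans (size_polyMleq _ _) _; move: sf sg; lia.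
have [->|z20] := eqVneq z2 0; last by rewrite !form_div// hornerM exprD; ring.
rewrite !form_z20 coefM.
have la : (a < (a + b).+1)%N by lia.
rewrite (bigD1 (Ordinal la))//= addKn big1 ?addr0; first by rewrite exprD; ring.
move=> i ia; have [h|h] := ltnP a i; first by rewrite nth_default ?mul0r//; exact: leq_trans sf _.
rewrite [X in _ * X]nth_default ?mulr0//; apply: leq_trans sg _.
have : nat_of_ord i != a by apply: contraNneq ia => E; apply/eqP/val_inj.
by move: h; lia.
Qed.

Lemma size_exp_le d n f : (size f <= d.+1)%N -> (size (f ^+ n) <= (d * n).+1)%N.
Proof.
move=> sf; have [->|f0] := eqVneq f 0.
  by case: n => [|n]; rewrite ?expr0 ?size_poly1// expr0n size_poly0.
have := size_exp f n; have : (0 < size (f ^+ n))%N by rewrite size_poly_gt0 expf_neq0.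
have : (0 < size f)%N by rewrite size_poly_gt0.
have : ((size f).-1 * n <= d * n)%N by rewrite leq_mul2r; apply/orP; right; move: sf; lia.
move: (size _) (size f) => x y; lia.
Qed.

Lemma form_exp d n f z1 z2 : (size f <= d.+1)%N -> form (d * n) (f ^+ n) z1 z2 = form d f z1 z2 ^+ n.
Proof.
move=> sf; elim: n => [|n ih].
  by rewrite muln0 !expr0 -[1]/('X^0) formXn// !expr0 mulr1.
by rewrite mulnS !exprS formM ?ih//; exact: size_exp_le.
Qed.

Definition form1 (a : nat) f (z1 z2 : C) : C := \sum_(i < a.+1) f`_i * (z1 ^+ i.-1 *+ i) * z2 ^+ (a - i).
Definition form2 (a : nat) f (z1 z2 : C) : C := \sum_(i < a.+1) f`_i * z1 ^+ i * (z2 ^+ (a - i).-1 *+ (a - i)).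

Lemma cder_form a f (x y : R -> C) t dx dy : cder x t dx -> cder y t dy ->
  cder (fun s => form a f (x s) (y s)) t (form1 a f (x t) (y t) * dx + form2 a f (x t) (y t) * dy).
Proof.
move=> hx hy.
have E : form1 a f (x t) (y t) * dx + form2 a f (x t) (y t) * dy =
  \sum_(i < a.+1) (f`_i * (x t ^+ i.-1 *+ i * dx) * y t ^+ (a - i) + f`_i * x t ^+ i * (y t ^+ (a - i).-1 *+ (a - i) * dy)).
  rewrite big_split /= /form1 /form2 !mulr_suml; congr (_ + _); apply: eq_bigr => i _; by ring.
rewrite E; apply: cder_sum => i _.
apply: cder_eq (cderM (cderM (cder_cst f`_i t) (cderX i hx)) (cderX (a - i) hy)) _.
by ring.
Qed.

Lemma form1_x1 a f x : (size f <= a.+1)%N -> form1 a f x 1 = f^`().[x].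
Proof.
move=> sf; rewrite /form1 big_ord_recl /= mulr0n mulr0 mul0r add0r.
have sf' : (size f^`() <= a)%N.
  by apply/leq_sizeP => j hj; rewrite coef_deriv nth_default ?mul0rn//; apply: leq_trans sf _.
rewrite (horner_coef_wide _ sf'); apply: eq_bigr => i _.
by rewrite expr1n mulr1 coef_deriv /bump /= add1n mulrnAr mulrnAl.
Qed.

Lemma form_euler a f z1 z2 : z1 * form1 a f z1 z2 + z2 * form2 a f z1 z2 = a%:R * form a f z1 z2.
Proof.
rewrite /form1 /form2 /form !big_distrr -big_split; apply: eq_bigr => i _ /=.
have sh (z : C) n : z * (z ^+ n.-1 *+ n) = n%:R * z ^+ n.
  by case: n => [|n]; rewrite ?mulr0n ?mulr0 ?mul0r//= mulrnAr -exprS mulr_natl.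
have -> : z1 * (f`_i * (z1 ^+ i.-1 *+ i) * z2 ^+ (a - i)) = f`_i * (z1 * (z1 ^+ i.-1 *+ i)) * z2 ^+ (a - i) by ring.
have -> : z2 * (f`_i * z1 ^+ i * (z2 ^+ (a - i).-1 *+ (a - i))) = f`_i * z1 ^+ i * (z2 * (z2 ^+ (a - i).-1 *+ (a - i))) by ring.
have ia : (a = i + (a - i))%N by rewrite subnKC// -ltnS.
rewrite !sh [in a%:R]ia natrD; ring.
Qed.

End form.

Section graded.
Context {R : realType}.
Local Notation C := R[i].
Variables (k : nat) (p : mpoly.mpoly 4 C) (P : C * C -> R).
Hypothesis pP : is_real_poly2 p P.
Hypothesis hom : homogeneous (2 * k) (fun z => (P z)%:C).

Definition mon4 (m : mpoly.multinom 4) (z1 z2 w1 w2 : C) : C :=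
  z1 ^+ m (inord 0) * z2 ^+ m (inord 1) * w1 ^+ m (inord 2) * w2 ^+ m (inord 3).

Definition deg4 (m : mpoly.multinom 4) : nat :=
  (m (inord 0) + m (inord 1) + m (inord 2) + m (inord 3))%N.

Lemma big_ord4M (F : 'I_4 -> C) :
  \prod_i F i = F (inord 0) * F (inord 1) * F (inord 2) * F (inord 3).
Proof.
rewrite !big_ord_recl big_ord0 mulr1 !mulrA; congr (_ * _ * _ * _); congr F; apply: val_inj;
  by rewrite /= inordK.
Qed.

Lemma ev_mon (q : mpoly.mpoly 4 C) z1 z2 w1 w2 :
  ev q z1 z2 w1 w2 = \sum_(m <- mpoly.msupp q) mpoly.mcoeff m q * mon4 m z1 z2 w1 w2.
Proof.
rewrite evE mpoly.mevalE; apply: eq_bigr => m _; rewrite big_ord4M /mon4.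
by have [-> -> -> ->] := tnth4 z1 z2 w1 w2.
Qed.

Lemma mon4_scale m t z1 z2 w1 w2 :
  mon4 m (t * z1) (t * z2) (t * w1) (t * w2) = t ^+ deg4 m * mon4 m z1 z2 w1 w2.
Proof. by rewrite /mon4 /deg4 !exprMn !exprD; ring. Qed.

Lemma poly_pos_eq (A B : {poly C}) : (forall t : R, 0 < t -> A.[t%:C] = B.[t%:C]) -> A = B.
Proof.
move=> H.
have E : (A - B) \Po ('X + 1) = 0.
  apply: (poly_real_roots (r := 1)) => // s; rewrite ltr_norml => /andP[s1 _].
  rewrite horner_comp !hornerE -[1]/(1%:C) -rmorphD H ?subrr//; lra.
apply: poly_fun_eq => s; apply/eqP; rewrite -subr_eq0.
have := congr1 (horner^~ (s - 1)) E.
by rewrite /= horner_comp !hornerE subrK => ->.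
Qed.

(** Compare coefficients of t^(2k) in P(t z) = t^(2k) P(z). *)
Lemma evr_degree z : evr p z = \sum_(m <- mpoly.msupp p | deg4 m == (2 * k)%N)
  mpoly.mcoeff m p * mon4 m z.1 z.2 z.1^J z.2^J.
Proof.
pose A : {poly C} := \sum_(m <- mpoly.msupp p) (mpoly.mcoeff m p * mon4 m z.1 z.2 z.1^J z.2^J) *: 'X^(deg4 m).
have EA : A = (evr p z) *: 'X^(2 * k).
  apply: poly_pos_eq => t t0; rewrite !hornerE -((real_polyP _ _).1 pP).
  have := hom z t0; rewrite /GRing.scale /= => h.
  rewrite mulrC -h ((real_polyP _ _).1 pP) /evr /= !conjM conjR ev_mon /A horner_sum; apply: eq_bigr => m _.
  have -> : mon4 m (t%:C *: z.1) (t%:C *: z.2) (t%:C * z.1^J) (t%:C * z.2^J) = mon4 m (t%:C * z.1) (t%:C * z.2) (t%:C * z.1^J) (t%:C * z.2^J) by [].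
  by rewrite mon4_scale hornerZ hornerXn; ring.
have := congr1 (fun A : {poly C} => A`_(2 * k)) EA.
rewrite /= coefZ coefXn eqxx mulr1 => <-.
rewrite /A coef_sum [RHS]big_mkcond; apply: eq_bigr => m _.
by rewrite coefZ coefXn eq_sym; case: eqP => _; rewrite ?mulr1 ?mulr0.
Qed.

Lemma ev_degree z1 z2 w1 w2 : ev p z1 z2 w1 w2 = \sum_(m <- mpoly.msupp p | deg4 m == (2 * k)%N)
  mpoly.mcoeff m p * mon4 m z1 z2 w1 w2.
Proof.
pose q : mpoly.mpoly 4 C := \sum_(m <- mpoly.msupp p | deg4 m == (2 * k)%N)
   mpoly.mpolyC 4 (mpoly.mcoeff m p) * mpoly.mpolyX C m.
have Eq z1' z2' w1' w2' : ev q z1' z2' w1' w2' = \sum_(m <- mpoly.msupp p | deg4 m == (2 * k)%N)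
  mpoly.mcoeff m p * mon4 m z1' z2' w1' w2'.
  rewrite evE /q raddf_sum /=; apply: eq_bigr => m _.
  rewrite mpoly.mevalM mpoly.mevalC mpoly.mevalX big_ord4M /mon4.
  by have [-> -> -> ->] := tnth4 z1' z2' w1' w2'.
rewrite -Eq; apply/eqP; rewrite -subr_eq0 -evB; apply/eqP.
apply: (polarize (a1 := 0) (a2 := 0) ltr01) => x y _ _.
by rewrite evB Eq -[ev p _ _ _ _]/(evr p (x, y)) evr_degree subrr.
Qed.

(** The part of degree a in z, dehomogenized: a polynomial in z1 whose coefficients
are homogeneous of degree 2k - a in w. *)
Definition zcomp (a : nat) (w1 w2 : C) : {poly C} :=
  \sum_(m <- mpoly.msupp p | ((m (inord 0) + m (inord 1))%N == a) && (deg4 m == (2 * k)%N))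
    (mpoly.mcoeff m p * w1 ^+ m (inord 2) * w2 ^+ m (inord 3)) *: 'X^(m (inord 0)).

Lemma zcomp_size a w1 w2 : (size (zcomp a w1 w2) <= a.+1)%N.
Proof.
apply: leq_trans (size_sum _ _ _) _; apply/bigmax_leqP_seq => m _ /andP[/eqP <- _].
apply: leq_trans (size_scale_leq _ _) _; rewrite size_polyXn; lia.
Qed.

Lemma zcomp_scale a t w1 w2 : (a <= 2 * k)%N -> zcomp a (t * w1) (t * w2) = t ^+ (2 * k - a) *: zcomp a w1 w2.
Proof.
move=> ak; rewrite /zcomp scaler_sumr; apply: eq_bigr => m /andP[/eqP m1 /eqP m2].
rewrite scalerA; congr (_ *: _); rewrite !exprMn.
have -> : (2 * k - a = m (inord 2) + m (inord 3))%N by rewrite -m1 -m2 /deg4; lia.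
by rewrite exprD; ring.
Qed.

Lemma ev_zcomp z1 z2 w1 w2 : ev p z1 z2 w1 w2 = \sum_(a < (2 * k).+1) form a (zcomp a w1 w2) z1 z2.
Proof.
rewrite ev_degree.
have E (a : 'I_(2 * k).+1) : form a (zcomp a w1 w2) z1 z2 =
  \sum_(m <- mpoly.msupp p | deg4 m == (2 * k)%N)
     if (m (inord 0) + m (inord 1))%N == a then mpoly.mcoeff m p * mon4 m z1 z2 w1 w2 else 0.
  rewrite /zcomp form_sum big_mkcondl; apply: eq_bigr => m /eqP m2.
  case: eqP => // m1; rewrite formZ formXn; last by rewrite -m1 leq_addr.
  have -> : (a - m (inord 0) = m (inord 1))%N by rewrite -m1 addKn.
  by rewrite /mon4; ring.
under [RHS]eq_bigr do rewrite E.
rewrite exchange_big; apply: eq_bigr => m /eqP m2 /=.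
have la : (m (inord 0) + m (inord 1) < (2 * k).+1)%N by rewrite -m2 /deg4; lia.
rewrite (bigD1 (Ordinal la))//= eqxx big1 ?addr0// => i ia; case: eqP => // E'.
by case/eqP: ia; apply: val_inj.
Qed.

End graded.

(** * Forms with parallel gradients *)

Section parallel_forms.
Context {R : realType}.
Local Notation C := R[i].
Implicit Types (f g q F : {poly C}).

(** Parallel gradients of the forms of degrees a and b, written on their
dehomogenizations with the help of Euler's identity. *)
Definition par a f b g : Prop := b%:R * f^`() * g = a%:R * f * g^`().

Lemma natp_neq0 n : (0 < n)%N -> (n%:R : {poly C}) != 0.
Proof. by move=> n0; rewrite -polyC_natr polyC_eq0 pnatr_eq0 -lt0n. Qed.

Lemma par_trans a f b g c q : (0 < c)%N -> q != 0 -> par a f c q -> par b g c q -> par a f b g.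
Proof.
move=> c0 q0 h1 h2; apply: (mulIf q0); apply: (mulfI (natp_neq0 c0)).
have -> : c%:R * (b%:R * f^`() * g * q) = b%:R * g * (c%:R * f^`() * q) by ring.
have -> : c%:R * (a%:R * f * g^`() * q) = a%:R * f * (c%:R * g^`() * q) by ring.
by rewrite h1 h2; ring.
Qed.

(** The hypothesis says that the Wronskian of f^b and g^a vanishes. *)
Lemma par_pow a f b g : (0 < b)%N -> g != 0 -> par a f b g -> exists c, f ^+ b = c *: g ^+ a.
Proof.
move=> b0 g0 h; apply: proportional_of_wronskian; first by rewrite expf_neq0.
have dp r n : (r ^+ n.+1)^`() = n.+1%:R * r^`() * r ^+ n :> {poly C}.
  by rewrite deriv_exp -mulr_natl mulrA.
case: b b0 h => // b _ h; case: a h => [|a] h.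
  rewrite dp expr0 -[1]/(1%:P) derivC mulr0 mulr1; move: h; rewrite /par !mul0r => /eqP.
  rewrite mulf_eq0 (negbTE g0) orbF mulf_eq0 (negbTE (natp_neq0 (ltn0Sn b)))/= => /eqP ->.
  by rewrite mulr0 mul0r.
rewrite !dp !exprS.
have -> : b.+1%:R * f^`() * f ^+ b * (g * g ^+ a) = f ^+ b * g ^+ a * (b.+1%:R * f^`() * g) by ring.
by rewrite h; ring.
Qed.

Lemma par_size a f b g : (0 < b)%N -> g != 0 -> f != 0 -> (size g <= b.+1)%N -> par a f b g -> (size f <= a.+1)%N.
Proof.
move=> b0 g0 f0 sg /(par_pow b0 g0)[c E].
have c0 : c != 0 by apply: contraNneq (expf_neq0 b f0) => c0; rewrite E c0 scale0r.
have := size_exp f b; rewrite E size_scale// => H; have := size_exp g a; rewrite H => {}H.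
have : ((size f).-1 * b <= a * b)%N.
  rewrite H mulnC leq_mul2l; suff -> : ((size g).-1 <= b)%N by rewrite orbT.
  by rewrite -subn1 leq_subLR add1n.
rewrite leq_pmul2r//; lia.
Qed.

Lemma par_cancel a d q F : F != 0 -> par (d + a) (q * F) d F -> par a q d F.
Proof.
move=> F0; rewrite /par derivM natrD => h; apply: (mulIf F0).
have -> : d%:R * q^`() * F * F = d%:R * (q^`() * F + q * F^`()) * F - d%:R * q * F * F^`() by ring.
by rewrite h; ring.
Qed.

(** F has minimal degree d > 0 among the forms parallel to q0. A parallel form q of
degree a satisfies q^d = c F^a; if a >= d then F divides q and q / F is parallel
of degree a - d, while 0 < a < d contradicts minimality. *)
Lemma primitive_form a0 q0 : (0 < a0)%N -> q0 != 0 -> (size q0 <= a0.+1)%N ->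
  exists d F, [/\ (0 < d)%N, F != 0, (size F <= d.+1)%N &
    forall a q, q != 0 -> par a q a0 q0 -> exists n c, a = (d * n)%N /\ q = c *: F ^+ n].
Proof.
move=> a00 q00 s0.
pose S n := `[< exists F, [/\ (0 < n)%N, F != 0 & par n F a0 q0] >].
have exS : exists n, S n by exists a0; apply/asboolP; exists q0; split=> //; rewrite /par; ring.
have [d /asboolP[F [d0 F0 pF]] dmin] := ex_minnP exS.
exists d, F; split => //; first exact: par_size pF.
move=> a; elim/ltn_ind: a => a ih q qn0 pq.
have pqF : par a q d F by exact: (par_trans a00 q00 pq pF).
have [c E] := par_pow d0 F0 pqF.
have c0 : c != 0 by apply: contraNneq (expf_neq0 d qn0) => c0; rewrite E c0 scale0r.
have [a_0|apos] := posnP a.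
  exists 0%N, q`_0; rewrite muln0 a_0; split=> //.
  move: pq; rewrite /par a_0 !mul0r => /eqP.
  rewrite mulf_eq0 (negbTE q00) orbF mulf_eq0 (negbTE (natp_neq0 a00))/= => /eqP dq.
  rewrite expr0 alg_polyC; apply/polyP => i; rewrite coefC; case: i => [|i] //=.
  by have := congr1 (fun f : {poly C} => f`_i) dq; rewrite /= coef_deriv coef0 => /eqP; rewrite mulrn_eq0/= => /eqP.
have da : (d <= a)%N by apply: dmin; apply/asboolP; exists q.
have Fq : F %| q.
  rewrite -(dvdp_pexp2r _ _ d0) E dvdpZr//; exact: dvdp_exp2l.
have [q1 Eq] : exists q1, q = q1 * F by exists (q %/ F); rewrite divpK.
have q10 : q1 != 0 by apply: contraNneq qn0 => q10; rewrite Eq q10 mul0r.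
have p1 : par (a - d) q1 d F by apply: par_cancel => //; rewrite subnKC// -Eq.
have p1' : par (a - d) q1 a0 q0.
  apply: (par_trans d0 F0 p1); rewrite /par; move: pF; rewrite /par => h; rewrite -!mulrA [q0 * _]mulrC [F * _]mulrC !mulrA in h *; by rewrite h.
have lt : (a - d < a)%N by move: d0 apos; lia.
have [n [e [En Eq1]]] := ih (a - d)%N lt q1 q10 p1'.
exists n.+1, e; split; first by rewrite mulnS -En subnKC.
by rewrite Eq Eq1 exprSr scalerAl.
Qed.

(** Distinct powers of t are linearly independent. *)
Lemma coef_extract n (e : 'I_n -> nat) (u : 'I_n -> C) : injective e ->
  (forall t, \sum_(a < n) t ^+ e a * u a = 0) -> forall a, u a = 0.
Proof.
move=> ei H a; pose A : {poly C} := \sum_(a < n) u a *: 'X^(e a).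
have A0 : A = 0.
  apply: poly_fun_eq => t; rewrite horner0 -(H t) horner_sum; apply: eq_bigr => i _.
  by rewrite hornerZ hornerXn mulrC.
have := congr1 (fun f : {poly C} => f`_(e a)) A0; rewrite /= coef0 coef_sum (bigD1 a)//= big1 => [|i ia].
  by rewrite coefZ coefXn eqxx mulr1 addr0.
rewrite coefZ coefXn; case: eqP => [/ei E|_]; last by rewrite mulr0.
by rewrite E eqxx in ia.
Qed.

Lemma conj_swap_poly (p : mpoly.mpoly 4 C) : exists q : mpoly.mpoly 4 C, forall z1 z2 w1 w2,
  ev q z1 z2 w1 w2 = (ev p w1^J w2^J z1^J z2^J)^J.
Proof.
elim/mpoly_ring_ind: p => [c|i|q r [q' hq] [r' hr]|q r [q' hq] [r' hr]].
- by exists (mpoly.mpolyC 4 c^J) => *; rewrite !evE !mpoly.mevalC.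
- suff [j Hj] : exists j : 'I_4, forall z1 z2 w1 w2 : C, tnth [tuple z1; z2; w1; w2] j = (tnth [tuple w1^J; w2^J; z1^J; z2^J] i)^J.
    by exists (mpoly.mpolyX _ (mpoly.mnm1 j)) => *; rewrite !evE !mpoly.mevalXU.
  elim/ord4P: i; [exists (inord 2)|exists (inord 3)|exists (inord 0)|exists (inord 1)] => z1 z2 w1 w2;
    have [e1 e2 e3 e4] := tnth4 z1 z2 w1 w2; have [e1' e2' e3' e4'] := tnth4 w1^J w2^J z1^J z2^J;
    by rewrite ?e1 ?e2 ?e3 ?e4 ?e1' ?e2' ?e3' ?e4' conjcK.
- by exists (q' + r') => *; rewrite !evE !mpoly.mevalD -!evE hq hr conjD.
- by exists (q' * r') => *; rewrite !evM hq hr conjM.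
Qed.

(** P is real: polarize p(z, conj z) = conj p(z, conj z). *)
Lemma hermitian (p : mpoly.mpoly 4 C) (P : C * C -> R) : is_real_poly2 p P -> forall z1 z2 w1 w2,
  ev p z1 z2 w1 w2 = (ev p w1^J w2^J z1^J z2^J)^J.
Proof.
move=> pP z1 z2 w1 w2; have [q Hq] := conj_swap_poly p.
rewrite -Hq; apply/eqP; rewrite -subr_eq0 -evB; apply/eqP.
apply: (polarize (a1 := 0) (a2 := 0) ltr01) => x y _ _.
rewrite evB Hq !conjcK -[ev p _ _ _ _]/(evr p (x, y)) -((real_polyP _ _).1 pP) conjR subrr//.
Qed.

Lemma sum_multiples d D (G : nat -> C) : (0 < d)%N ->
  \sum_(a < (d * D).+1 | (d %| a)%N) G (a %/ d)%N = \sum_(n < D.+1) G n.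
Proof.
move=> d0.
rewrite (reindex_onto (fun n : 'I_D.+1 => inord (d * n) : 'I_(d * D).+1) (fun a => inord (a %/ d))) /=.
  have dn (n : 'I_D.+1) : (d * n < (d * D).+1)%N by rewrite ltnS leq_mul2l -ltnS ltn_ord orbT.
  apply: eq_big => [n|n _].
    by rewrite inordK// dvdn_mulr//= mulKn// inord_val eqxx.
  by rewrite inordK// mulKn.
move=> a da; apply: val_inj => /=.
have hq : (a %/ d < D.+1)%N by have := leq_div2r d (ltn_ord a : (a <= d * D)%N); rewrite mulKn.
have q1 : nat_of_ord (inord (a %/ d) : 'I_D.+1) = (a %/ d)%N := inordK hq.
by rewrite inordK q1 mulnC divnK// ltn_ord.
Qed.

End parallel_forms.

(** * Decomposition through one form *)

Section decomposition.
Context {R : realType}.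
Local Notation C := R[i].
Variables (k : nat) (p : mpoly.mpoly 4 C) (P : C * C -> R).
Hypothesis pP : is_real_poly2 p P.
Hypothesis hom : homogeneous (2 * k) (fun z => (P z)%:C).
Hypothesis par_p : parallel p.
Hypothesis np : forall z1 z2, ev p z1 z2 0 0 = 0.

Local Notation cmp := (zcomp k p).
Let evc := ev_zcomp pP hom.
Let csz := @zcomp_size R k p.
Let n := (2 * k).+1.

(** At z = (x, 1); the second derivative comes from Euler's identity. *)
Lemma ev_dz x w1 w2 : ev (dz1 p) x 1 w1 w2 = \sum_(a < n) (cmp a w1 w2)^`().[x] /\
  ev (dz2 p) x 1 w1 w2 = \sum_(a < n) (a%:R * (cmp a w1 w2).[x] - x * (cmp a w1 w2)^`().[x]).
Proof.
have aff (z : C) : cder (fun s : R => z + s%:C * 1) 0 1 by exact: cder_affine.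
have cs (z : C) : cder (fun s : R => z) 0 0 by exact: cder_cst.
have f2 (a : nat) : form2 a (cmp a w1 w2) x 1 = a%:R * (cmp a w1 w2).[x] - x * (cmp a w1 w2)^`().[x].
  have := form_euler a (cmp a w1 w2) x 1; rewrite mul1r form1_x1// form_x1// => <-.
  by rewrite addrC addKr.
split.
  have h1 := cder_ev p (aff x) (cs 1) (cs w1) (cs w2).
  have h2 : cder (fun s : R => \sum_(a < n) form a (cmp a w1 w2) (x + s%:C * 1) 1) 0
     (\sum_(a < n) (form1 a (cmp a w1 w2) (x + 0%:C * 1) 1 * 1 + form2 a (cmp a w1 w2) (x + 0%:C * 1) 1 * 0)).
    by apply: cder_sum => a _; exact: cder_form.
  have := cder_uniq (cder_ext (fun s => evc _ _ _ _) h1) h2.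
  rewrite !mul0r !addr0 !mulr0 !addr0 mulr1 => ->; apply: eq_bigr => a _.
  by rewrite mulr1 mulr0 addr0 form1_x1.
have h1 := cder_ev p (cs x) (aff 1) (cs w1) (cs w2).
have h2 : cder (fun s : R => \sum_(a < n) form a (cmp a w1 w2) x (1 + s%:C * 1)) 0
   (\sum_(a < n) (form1 a (cmp a w1 w2) x (1 + 0%:C * 1) * 0 + form2 a (cmp a w1 w2) x (1 + 0%:C * 1) * 1)).
  by apply: cder_sum => a _; exact: cder_form.
have := cder_uniq (cder_ext (fun s => evc _ _ _ _) h1) h2.
rewrite !mul0r !addr0 !mulr0 !addr0 mulr1 add0r => ->; apply: eq_bigr => a _.
by rewrite mulr1 mulr0 add0r f2.
Qed.

Lemma exp_inj : injective (fun a : 'I_n => (2 * k - a)%N).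
Proof. by move=> a b E; apply: val_inj; move: E (ltn_ord a) (ltn_ord b); rewrite /n /=; lia. Qed.

Lemma par_alg (s t a b x f df g dg : C) :
  t * (s * (b * df * g - a * f * dg)) =
  t * df * (b * (s * g) - x * (s * dg)) - (a * (t * f) - x * (t * df)) * (s * dg).
Proof. by ring. Qed.

(** Scaling w by t and w' by s in [parallel] separates the bidegrees, since the
component of degree a is homogeneous of degree 2k - a in w. *)
Lemma par_zcomp (a b : 'I_n) w1 w2 w1' w2' : par a (cmp a w1 w2) b (cmp b w1' w2').
Proof.
apply: poly_fun_eq => x; rewrite !hornerM !hornerMn ?hornerC.
pose T (a b : 'I_n) := b%:R * (cmp a w1 w2)^`().[x] * (cmp b w1' w2').[x] - a%:R * (cmp a w1 w2).[x] * (cmp b w1' w2')^`().[x].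
suff : T a b = 0 by rewrite /T => /eqP; rewrite subr_eq0 => /eqP.
have le (i : 'I_n) : (i <= 2 * k)%N by rewrite -ltnS ltn_ord.
have key t s : \sum_(a < n) t ^+ (2 * k - a) * (\sum_(b < n) s ^+ (2 * k - b) * T a b) = 0.
  have := par_p x 1 (t * w1) (t * w2) (s * w1') (s * w2').
  have [-> ->] := ev_dz x (t * w1) (t * w2); have [-> ->] := ev_dz x (s * w1') (s * w2').
  move/eqP; rewrite -subr_eq0 => /eqP E; apply: etrans E; rewrite !mulr_suml -sumrB.
  apply: eq_bigr => {}a _; rewrite !mulr_sumr -sumrB; apply: eq_bigr => {}b _.
  rewrite !zcomp_scale// !derivZ !hornerZ; exact: par_alg.
have key2 s := coef_extract exp_inj (fun t => key t s).
exact: (coef_extract exp_inj (fun s => key2 s a)).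
Qed.

(** Scale z by t in [hermitian] and compare coefficients of t^a. *)
Lemma zcomp_herm (a : 'I_n) z1 z2 w1 w2 :
  form a (cmp a w1 w2) z1 z2 = (form (2 * k - a) (cmp (2 * k - a) z1^J z2^J) w1^J w2^J)^J.
Proof.
apply/eqP; rewrite -subr_eq0; apply/eqP; move: a.
have vi : injective (fun a : 'I_n => nat_of_ord a) by exact: val_inj.
apply: (coef_extract vi) => t.
have := hermitian pP (t * z1) (t * z2) w1 w2; rewrite !evc => /eqP; rewrite -subr_eq0 => /eqP E.
apply: etrans E; rewrite rmorph_sum /= [X in _ = _ - X](reindex_inj rev_ord_inj) /= -sumrB.
apply: eq_bigr => a _; rewrite form_scale mulrBr; congr (_ - _).
have -> : (n - a.+1 = 2 * k - a)%N by rewrite /n subSS.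
rewrite !conjM zcomp_scale ?leq_subr// formZ conjM conjX conjcK.
by rewrite subKn// -ltnS ltn_ord.
Qed.

(** The component of degree 2k does not depend on w, and it is p(z, 0) = 0. *)
Lemma zcomp_top w1 w2 : cmp (2 * k) w1 w2 = 0.
Proof.
have top w1' w2' : cmp (2 * k) w1' w2' = cmp (2 * k) 0 0.
  have := @zcomp_scale R k p (2 * k) 0 w1' w2' (leqnn _).
  by rewrite !mul0r subnn expr0 scale1r => <-.
rewrite top; apply: (form_inj (csz _ _ _)) => z1 z2.
have := np z1 z2; rewrite evc (bigD1 (ord_max : 'I_(2 * k).+1))//= big1 ?addr0// => a ai.
have a2 : (a < 2 * k)%N.
  have : nat_of_ord a != (2 * k)%N by apply: contraNneq ai => E; apply/eqP/val_inj.
  by have := ltn_ord a; rewrite ltnS ltn_neqAle => -> ->.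
have := @zcomp_scale R k p a 0 0 0 (ltnW a2); rewrite !mul0r => ->.
by rewrite expr0n subn_eq0 leqNgt a2 /= scale0r form0.
Qed.

Lemma zcomp_bot w1 w2 : cmp 0 w1 w2 = 0.
Proof.
apply: (form_inj (csz _ _ _)) => z1 z2.
by have := zcomp_herm ord0 z1 z2 w1 w2; rewrite /= subn0 zcomp_top form0 conj0.
Qed.

Lemma exp_root (d : nat) (c : C) : (0 < d)%N -> exists t, t ^+ d = c.
Proof. by move=> d0; exists (d.-root c); exact: rootCK. Qed.

(** By [primitive_form] the component of degree a is c_a(w) F^(a/d), with c_a = 0
unless d divides a. Evaluate at a point y where F = 1 and use [zcomp_herm]: c_a(w)
is a constant times the conjugate of F(conj w)^((2k - a)/d). As p <> 0, some a is
such that d divides a and 2k - a, so d divides 2k. *)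
Theorem form_decomposition : ~ (forall z1 z2 w1 w2, ev p z1 z2 w1 w2 = 0) ->
  exists d D (F u : {poly C}), [/\ (0 < d)%N, (size F <= d.+1)%N /\ F != 0, (size u <= D.+1)%N /\ u != 0, (u`_0 = 0 /\ u`_D = 0) /\ (d * D = 2 * k)%N &
    (exists z1 z2, form d F z1 z2 = 1) /\ forall z1 z2 w1 w2, ev p z1 z2 w1 w2 = form D u (form d F z1 z2) (form d F w1^J w2^J)^J].
Proof.
move=> pn0.
have [a0 [v1 [v2 q0]]] : exists (a : 'I_n) w1 w2, cmp a w1 w2 != 0.
  apply: contrapT => H; apply: pn0 => z1 z2 w1 w2; rewrite evc big1// => a _.
  have [->|E] := eqVneq (zcomp k p a w1 w2) 0; first exact: form0.
  by case: H; exists a, w1, w2.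
have a00 : (0 < a0)%N.
  by rewrite lt0n; apply: contraNneq q0 => ->; rewrite zcomp_bot.
have [d [F [d0 F0 sF dec]]] := primitive_form a00 q0 (csz _ _ _).
have [x Fx] : exists x, F.[x] != 0.
  apply: contrapT => H; case/eqP: F0; apply: poly_fun_eq => s; rewrite horner0.
  by apply/eqP/negPn/negP => h; apply: H; exists s.
have [t tE] := exp_root (F.[x]^-1) d0.
pose y1 := t * x; pose y2 := t * 1.
have Fy : form d F y1 y2 = 1 by rewrite form_scale form_x1// tE mulVf.
pose c (a : nat) w1 w2 := form a (cmp a w1 w2) y1 y2.
have cE (a : 'I_n) w1 w2 z1 z2 : form a (cmp a w1 w2) z1 z2 =
   if (d %| a)%N then c a w1 w2 * form d F z1 z2 ^+ (a %/ d) else 0.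
  have [E|nz] := eqVneq (cmp a w1 w2) 0.
    by rewrite /c E !form0 mul0r if_same.
  have [m [e [am E]]] := dec a _ nz (par_zcomp a a0 w1 w2 v1 v2).
  rewrite /c E am dvdn_mulr// mulKn// !formZ !form_exp// Fy expr1n mulr1//.
have cH (a : 'I_n) w1 w2 : c a w1 w2 =
   if (d %| 2 * k - a)%N then (c (2 * k - a)%N y1^J y2^J)^J * (form d F w1^J w2^J)^J ^+ ((2 * k - a) %/ d) else 0.
  have lt : (2 * k - a < n)%N by rewrite /n ltnS leq_subr.
  rewrite /c zcomp_herm (cE (Ordinal lt)) /=; case: ifP => _; last by rewrite conj0.
  by rewrite conjM conjX.
have a0k : (a0 <= 2 * k)%N by rewrite -ltnS ltn_ord.
have [z1 [z2 nz]] : exists z1 z2, form a0 (cmp a0 v1 v2) z1 z2 != 0.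
  apply: contrapT => H; case/eqP: q0; apply: (form_inj (csz _ _ _)) => z1 z2.
  by apply/eqP/negPn/negP => h; apply: H; exists z1, z2.
have da0 : (d %| a0)%N by move: nz; rewrite cE; case: ifP => //; rewrite eqxx.
have da1 : (d %| 2 * k - a0)%N.
  by move: nz; rewrite cE da0 cH; case: ifP => //; rewrite mul0r eqxx.
have dk : (d %| 2 * k)%N by rewrite -(subnKC a0k) dvdn_addr.
pose D := (2 * k %/ d)%N; have dD : (d * D = 2 * k)%N by rewrite mulnC divnK.
pose u : {poly C} := \poly_(m < D.+1) (c (2 * k - d * m)%N y1^J y2^J)^J.
have main z1' z2' w1 w2 : ev p z1' z2' w1 w2 = form D u (form d F z1' z2') (form d F w1^J w2^J)^J.
  rewrite evc -/n /n.
  pose G m := (c (2 * k - d * m)%N y1^J y2^J)^J * (form d F w1^J w2^J)^J ^+ (D - m) * form d F z1' z2' ^+ m.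
  have -> : form D u (form d F z1' z2') (form d F w1^J w2^J)^J = \sum_(m < D.+1) G m.
    by apply: eq_bigr => m _; rewrite coef_poly ltn_ord /G; ring.
  rewrite -(sum_multiples D G d0) dD [RHS]big_mkcond; apply: eq_bigr => a _.
  rewrite cE; case: ifP => // da; rewrite cH.
  have ak : (a <= 2 * k)%N by rewrite -ltnS ltn_ord.
  have aE : (d * (a %/ d) = a)%N by rewrite mulnC divnK.
  rewrite dvdn_sub// /G aE; congr (_ * _ ^+ _ * _).
  have divB m l : (d %| m)%N -> (d %| l)%N -> ((m - l) %/ d = m %/ d - l %/ d)%N.
    by move=> /dvdnP[i ->] /dvdnP[j ->]; rewrite -mulnBl !mulnK.
  exact: divB.
have ucomp m : (d * m <= 2 * k)%N -> (forall w1 w2, cmp (2 * k - d * m) w1 w2 = 0) -> u`_m = 0.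
  by move=> h H; rewrite coef_poly; case: ifP => // _; rewrite /c H form0 conj0.
exists d, D, F, u; split => //.
- split; first exact: size_poly.
  apply/eqP => u0; apply: pn0 => *; by rewrite main u0 form0.
- split=> //; split; apply: ucomp; rewrite ?muln0// ?dD// => w1 w2.
    by rewrite subn0 zcomp_top.
  by rewrite subnn zcomp_bot.
by split=> //; exists y1, y2.
Qed.

End decomposition.

(** * Forms in w and its conjugate *)

Section formc.
Context {R : realType}.
Local Notation C := R[i].
Implicit Types (f g : {poly C}).

Definition formc a f (w : C) := form a f w w^J.

Lemma form1_deriv a f z1 z2 : form1 a.+1 f z1 z2 = form a f^`() z1 z2.
Proof.
rewrite /form1 big_ord_recl /= mulr0n mulr0 mul0r add0r; apply: eq_bigr => i _.
rewrite coef_deriv /bump /= add1n add0n subSS -[z1 ^+ i *+ i.+1]mulr_natr -[f`_i.+1 *+ i.+1]mulr_natr; ring.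
Qed.

(** Dehomogenization of the z2-derivative of the form of degree a. *)
Definition codiff a f : {poly C} := a%:R *: f - 'X * f^`().

Lemma coef_codiff a f i : (codiff a f)`_i = (a%:R - i%:R) * f`_i.
Proof.
rewrite coefB coefZ coefXM mulrBl; congr (_ - _).
by case: i => [|i] /=; rewrite ?mul0r// coef_deriv mulr_natl.
Qed.

Lemma form2_codiff a f z1 z2 : form2 a.+1 f z1 z2 = form a (codiff a.+1 f) z1 z2.
Proof.
rewrite /form2 big_ord_recr /= subnn mulr0n mulr0 addr0; apply: eq_bigr => i _.
have ia : (i <= a.+1)%N by rewrite ltnW// ltnS ltnW.
rewrite coef_codiff -natrB//.
have -> : ((a.+1 - i).-1 = a - i)%N by rewrite -subnS subSS.
by rewrite -[_ *+ (a.+1 - i)]mulr_natl; ring.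
Qed.

Lemma codiff_size a f : (size f <= a.+1)%N -> (size (codiff a f) <= a)%N.
Proof.
move=> sf; apply/leq_sizeP => j; rewrite coef_codiff leq_eqVlt => /orP[/eqP <-|h].
  by rewrite subrr mul0r.
by rewrite nth_default ?mulr0//; apply: leq_trans h.
Qed.

Lemma deriv_size a f : (size f <= a.+1)%N -> (size f^`() <= a)%N.
Proof.
by move=> sf; apply/leq_sizeP => j hj; rewrite coef_deriv nth_default ?mul0rn//; apply: leq_trans sf _.
Qed.

Lemma codiff_deriv a f : (codiff a.+1 f)^`() = codiff a f^`().
Proof.
apply/polyP => i; rewrite coef_deriv !coef_codiff coef_deriv -mulrnAr; congr (_ * _).
by rewrite -!natr1; ring.
Qed.

Lemma wirt_formc a f : wirt (formc a.+1 f) (formc a f^`()) (formc a (codiff a.+1 f)).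
Proof.
move=> x t dx dxx; have := cder_form a.+1 f dxx (cderJ dxx).
by rewrite form1_deriv form2_codiff.
Qed.

Lemma sm1_formc a f : sm1 (formc a f).
Proof.
apply: sm_sum => i; apply: sm_mul.
  by apply: sm_mul; [exact: sm_cst|apply: sm_exp; exact: (sm_X Xid tt)].
by apply: sm_exp; apply: sm_conj; exact: (sm_X Xid tt).
Qed.

(** Both Wirtinger derivatives of a vanishing function vanish; induct on the degree. *)
Lemma formc_inj a f : (size f <= a.+1)%N -> (forall w, formc a f w = 0) -> f = 0.
Proof.
elim: a f => [|a ih] f sf H.
  have := H 0; rewrite /formc conj0 form_z20 expr0 mulr1 => f0.
  by apply/polyP => -[|i]; rewrite coef0 ?f0// nth_default//; exact: leq_trans sf _.
have [e1 e2] := wirt_uniq (wirt_formc a f) (wirt_ext (fun w => esym (H w)) (frefl _) (frefl _) (wirt_cst 0)).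
have f1 := ih _ (deriv_size sf) e1; have f2 := ih _ (codiff_size sf) e2.
move: f2; rewrite /codiff f1 mulr0 subr0 => /eqP.
by rewrite scaler_eq0 pnatr_eq0 /= => /eqP.
Qed.

Lemma formc_scale a f (t : R) w : formc a f (t%:C * w) = t%:C ^+ a * formc a f w.
Proof. by rewrite /formc conjM conjR form_scale. Qed.

Lemma wirtX n : wirt (fun w : C => w ^+ n) (fun w => n%:R * w ^+ n.-1) (fun=> 0).
Proof.
move=> x t dx dxx; apply: cder_eq (cderX n dxx) _.
by rewrite mul0r addr0.
Qed.

Lemma wirt_pow (h A B : C -> C) n : wirt h A B ->
  wirt (fun w => h w ^+ n) (fun w => n%:R * h w ^+ n.-1 * A w) (fun w => n%:R * h w ^+ n.-1 * B w).
Proof.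
move=> hf x t dx dxx; apply: cder_eq (cderX n (hf x t dx dxx)) _.
by ring.
Qed.

Lemma sm1_nonneg0 (f : C -> C) : sm1 f -> (forall w, w != 0 -> 0 <= Re (f w)) -> forall w, 0 <= Re (f w).
Proof.
move=> sf H w; have [->|] := eqVneq w 0; last exact: H.
rewrite leNgt; apply/negP => f0; have e0 : 0 < - Re (f 0) by rewrite oppr_gt0.
have [d d0 Hd] := sm_cont sf 0 e0.
have n0 : ((d / 2)%:C : C) != 0 by apply/eqP => -[] /eqP; rewrite gt_eqF// divr_gt0.
have : normc (f (d / 2)%:C - f 0) < - Re (f 0).
  apply: (Hd) => i; rewrite /Xid subr0 normcR ger0_norm ?divr_ge0 ?ltW//; lra.
have := H _ n0; have := Re_le_normc (f (d / 2)%:C - f 0); rewrite ReD ReN.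
move=> h1 h2 h3; have := ler_norm (Re (f (d / 2)%:C) - Re (f 0)); lra.
Qed.

Lemma sm1_of_wirt (f A B : C -> C) : sm1 f -> wirt f A B -> sm1 A /\ sm1 B.
Proof.
move=> /sm1_wirt[A' [B' [sA sB h]]] h'; have [e1 e2] := wirt_uniq h h'.
by split; [exact: sm_ext sA|exact: sm_ext sB].
Qed.

Lemma lap_ge0 (v : C -> R) A A1 B : sm1 (fun z => (v z)%:C) -> wirt (fun z => (v z)%:C) A (fun z => (A z)^J) ->
  wirt A A1 B -> subharmonic v -> forall z, 0 <= Re (B z).
Proof.
move=> s1 w1 w2; have [sA _] := sm1_of_wirt s1 w1; have [sA1 sB] := sm1_of_wirt sA w2.
exact: lap_of_subharmonic s1 sA sA1 sB w1 w2.
Qed.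

Lemma lap_subharmonic (v : C -> R) A A1 B : sm1 (fun z => (v z)%:C) -> wirt (fun z => (v z)%:C) A (fun z => (A z)^J) ->
  wirt A A1 B -> (forall z, 0 <= Re (B z)) -> subharmonic v.
Proof.
move=> s1 w1 w2; have [sA _] := sm1_of_wirt s1 w1; have [sA1 sB] := sm1_of_wirt sA w2.
exact: subharmonic_of_lap s1 sA sA1 sB w1 w2.
Qed.

Lemma sm1_comp (f g : C -> C) : sm1 f -> sm1 g -> sm1 (fun w => f (g w)).
Proof. by move=> sf sg; apply: (sm_comp (tau := g) _ sf) => -[]. Qed.

End formc.

Section laplacian_of_form.
Context {R : realType}.
Local Notation C := R[i].
Variables (D : nat) (u : {poly C}) (U : C -> R).
Hypothesis su : (size u <= D.+1)%N.
Hypothesis un0 : u != 0.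
Hypothesis u0 : u`_0 = 0.
Hypothesis uD : u`_D = 0.
Hypothesis UE : forall s, (U s)%:C = formc D u s.

Lemma D_ge2 : (1 < D)%N.
Proof.
rewrite ltnNge; apply/negP => D1; case/eqP: un0; apply/polyP => i; rewrite coef0.
have [iD|iD] := leqP i D; last by rewrite nth_default//; exact: leq_trans su _.
have : i = 0%N \/ i = D by move: iD D1; lia.
by case=> ->.
Qed.

Let n := D.-2.
Let Dn : D = n.+2. Proof. by rewrite /n; move: D_ge2; case: D => [|[]]. Qed.

(** d^2 U / ds d(conj s) as a form of degree D - 2. *)
Definition lapl : {poly C} := codiff D.-1 u^`().

Let A := formc n.+1 u^`().
Let N := formc n lapl.

Lemma wirtU : wirt (fun s => (U s)%:C) A (fun s => (A s)^J).
Proof.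
apply: wirt_real; apply: wirt_ext (wirt_formc n.+1 u) => // s.
by rewrite UE Dn.
Qed.

Lemma wirtA : wirt A (formc n u^`()^`()) N.
Proof. by rewrite /N /lapl Dn; exact: wirt_formc. Qed.

Lemma lapl_size : (size lapl <= n.+1)%N.
Proof.
rewrite /lapl Dn /=; apply: codiff_size; apply: deriv_size.
by move: su; rewrite Dn.
Qed.

Lemma lapl_neq0 : lapl != 0.
Proof.
apply: contraNneq un0 => L0; apply/eqP/polyP => i; rewrite coef0.
case: i => [//|i]; have [iD|iD] := ltnP i.+1 D; last first.
  move: iD; rewrite leq_eqVlt => /orP[/eqP <- //|iD].
  by rewrite nth_default//; exact: leq_trans su _.
have := congr1 (fun f : {poly C} => f`_i) L0; rewrite /= /lapl coef_codiff coef_deriv coef0 => /eqP.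
rewrite mulf_eq0 mulrn_eq0 /= => /orP[|/eqP//].
rewrite subr_eq0 eqr_nat => /eqP E; move: iD; rewrite -E; lia.
Qed.

(** The derivatives d/ds and d/d(conj s) of a form commute, and U is real. *)
Lemma N_real s : N s = (Re (N s))%:C.
Proof.
have h1 : wirt (fun s => (U s)%:C) A (formc n.+1 (codiff D u)).
  rewrite Dn; apply: wirt_ext (wirt_formc n.+1 u) => // x; by rewrite UE Dn.
have [_ E] := wirt_uniq wirtU h1.
have h2 := wirt_ext (fun s => esym (E s)) (frefl _) (frefl _) (wirt_formc n (codiff D u)).
have [e1 _] := wirt_uniq (wirt_conj wirtA) h2.
have Nr : (N s)^J = N s by rewrite e1 /N /lapl Dn -codiff_deriv.
by apply: complexP => //=; move: Nr; case: (N s) => a b [] /=; lra.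
Qed.

Lemma sm1U : sm1 (fun s => (U s)%:C).
Proof. by apply: sm_ext (sm1_formc D u) => s; rewrite UE. Qed.

Variable d : nat.
Hypothesis d0 : (0 < d)%N.
Hypothesis sub : subharmonic (fun w : C => U (w ^+ d)).

(** The Laplacian of U(w^d) is N(w^d) |d w^(d-1)|^2, up to the factor 4; roots exist. *)
Lemma N_ge0 s : 0 <= Re (N s).
Proof.
apply: (@sm1_nonneg0 _ N); first exact: sm1_formc.
move=> {}s sn0; have [w ws] := exp_root s d0.
have w1 := wirt_real (wirt_comp wirtU (wirtX d)).
have w2 := wirtM (wirt_comp wirtA (wirtX d)) (wirtM (wirt_cst d%:R) (wirtX d.-1)).
have su1 : sm1 (fun w : C => (U (w ^+ d))%:C) by apply: (sm1_comp sm1U); apply: sm_exp; exact: (sm_X Xid tt).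
have := lap_ge0 su1 w1 w2 sub w; rewrite /= !ws.
set g := d%:R * w ^+ d.-1.
have -> : (N s * g^J * g + A s * (0 * w ^+ d.-1 + d%:R * 0)) = N s * (normc g ^+ 2)%:C.
  by rewrite mul0r mulr0 addr0 mulr0 addr0 -mulcJ; ring.
have ng : 0 < normc g ^+ 2.
  rewrite exprn_gt0// normc_gt0 /g mulf_neq0 ?pnatr_eq0 -?lt0n// expf_neq0//.
  by apply: contraNneq sn0 => E; rewrite -ws E expr0n gtn_eqF.
by rewrite ReM /= mulr0 subr0 pmulr_lge0.
Qed.

End laplacian_of_form.

(** * Derivatives of homogeneous functions *)

Section bump_value.
Context {R : realType}.
Local Notation C := R[i].

(** Value of the mixed derivative of al - B be q + B^2 ga q^2, with q = |S|^2, at a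
zero of S: q and its first derivatives vanish there, so only the mixed derivative
|S1|^2 + |S2|^2 of q survives. *)
Lemma bump_at_zero (al be ga S al1 al2 be1 be2 ga1 ga2 al11 al12 S1 S2 H A A1 Cc : C -> C) (B w : C) :
  sm1 be -> sm1 ga -> sm1 S ->
  wirt al al1 al2 -> wirt be be1 be2 -> wirt ga ga1 ga2 -> wirt S S1 S2 ->
  wirt al1 al11 al12 ->
  (forall z, H z = al z - B * (be z * (S z * (S z)^J)) + B ^+ 2 * (ga z * ((S z * (S z)^J) * (S z * (S z)^J)))) ->
  wirt H A (fun z => (A z)^J) -> wirt A A1 Cc -> S w = 0 ->
  Cc w = al12 w - B * be w * (S1 w * (S1 w)^J + S2 w * (S2 w)^J).
Proof.
move=> sbe sga sS wal wbe wga wS wal1 HE wH wA Sw.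
have [_ ] := sm1_of_wirt sbe wbe; have [+ _] := sm1_of_wirt sbe wbe.
move=> /sm1_wirt[be11 [be12 [_ _ wbe1]]] _.
have [/sm1_wirt[ga11 [ga12 [_ _ wga1]]] _] := sm1_of_wirt sga wga.
have [/sm1_wirt[S11 [S12 [_ _ wS1]]] /sm1_wirt[S21 [S22 [_ _ wS2]]]] := sm1_of_wirt sS wS.
have wSJ := wirt_conj wS; have wS2J := wirt_conj wS2.
have wq := wirtM wS wSJ.
have wq1 := wirtD (wirtM wS1 wSJ) (wirtM wS wS2J).
have wnB := wirt_cst (- B); have wB2 := wirt_cst (B ^+ 2).
have wX := wirtD (wirtD wal (wirtM wnB (wirtM wbe wq))) (wirtM wB2 (wirtM wga (wirtM wq wq))).
have HE' z : al z + - B * (be z * (S z * (S z)^J)) + B ^+ 2 * (ga z * ((S z * (S z)^J) * (S z * (S z)^J))) = H z.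
  by rewrite HE mulNr.
have [EA _] := wirt_uniq (wirt_ext HE' (frefl _) (frefl _) wX) wH.
have wA' := wirtD (wirtD wal1 (wirtD (wirtM (wirt_cst 0) (wirtM wbe wq)) (wirtM wnB (wirtD (wirtM wbe1 wq) (wirtM wbe wq1)))))
   (wirtD (wirtM (wirt_cst 0) (wirtM wga (wirtM wq wq))) (wirtM wB2 (wirtD (wirtM wga1 (wirtM wq wq)) (wirtM wga (wirtD (wirtM wq1 wq) (wirtM wq wq1)))))).
have [_ EC] := wirt_uniq (wirt_ext EA (frefl _) (frefl _) wA') wA.
rewrite -EC Sw conj0 !(mul0r, mulr0, addr0, add0r).
by ring.
Qed.

Lemma wirt_rpow (e : nat) : exists a11, [/\
   wirt (fun w : C => (w * w^J) ^+ e.+1) (fun w => e.+1%:R * w ^+ e * w^J ^+ e.+1) (fun w => e.+1%:R * w ^+ e.+1 * w^J ^+ e) &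
   wirt (fun w : C => e.+1%:R * w ^+ e * w^J ^+ e.+1) a11 (fun w => e.+1%:R ^+ 2 * (w * w^J) ^+ e)].
Proof.
have wJ n : wirt (fun w : C => w^J ^+ n) (fun=> 0) (fun w => n%:R * w^J ^+ n.-1).
  apply: wirt_ext (wirt_conj (wirtX n)) => w; rewrite ?conjX ?conj0//.
  by rewrite conjM conj_nat conjX.
exists (fun w => e.+1%:R * (e%:R * w ^+ e.-1) * w^J ^+ e.+1); split.
  apply: wirt_ext (wirtM (wirtX e.+1) (wJ e.+1)) => w /=; first by rewrite exprMn.
    by rewrite mulr0 addr0.
  by rewrite mul0r add0r mulrCA mulrA.
apply: wirt_ext (wirtM (wirtM (wirt_cst e.+1%:R) (wirtX e)) (wJ e.+1)) => w //=.
  by rewrite mul0r add0r mulr0 addr0.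
rewrite mul0r mulr0 addr0 mul0r add0r exprMn expr2; ring.
Qed.

Lemma sm1_rpow e : sm1 (fun w : C => (w * w^J) ^+ e).
Proof. by apply: sm_exp; apply: sm_mul; [|apply: sm_conj]; exact: (sm_X Xid tt). Qed.

(** A derivative of a function of degree n + 1 is homogeneous of degree n. *)
Lemma wirt_scaleinv (f A B : C -> C) (n : nat) : wirt f A B ->
  forall t : R, t != 0 -> (forall w, f (t%:C * w) = t%:C ^+ n.+1 * f w) ->
  forall w, A (t%:C * w) = t%:C ^+ n * A w /\ B (t%:C * w) = t%:C ^+ n * B w.
Proof.
move=> wf t t0 hf w.
have tc : (t%:C : C) != 0 by apply/eqP => -[] /eqP; rewrite (negbTE t0).
have wt : wirt (fun w : C => t%:C * w) (fun=> t%:C) (fun=> 0).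
  apply: wirt_ext (wirtM (wirt_cst t%:C) wirt_id) => x //=; rewrite ?mul0r ?add0r ?mulr1 ?mulr0 ?addr0//.
have h1 := wirt_comp wf wt.
have h2 := wirt_ext (fun w => esym (hf w)) (frefl _) (frefl _) (wirtM (wirt_cst (t%:C ^+ n.+1)) wf).
have [e1 e2] := wirt_uniq h1 h2.
split; apply: (mulIf tc); [rewrite e1|have := e2 w; rewrite conjR => ->]; rewrite mul0r add0r exprSr; ring.
Qed.

Lemma wirt_euler (f A B : C -> C) (n : nat) : wirt f A B ->
  (forall (t : R) w, f (t%:C * w) = t%:C ^+ n * f w) ->
  forall w, A w * w + B w * w^J = n%:R * f w.
Proof.
move=> wf hf w.
have h0 : cder (fun t : R => t%:C * w) 1 w.
  by apply: cder_eq (cderM (cder_real 1) (cder_cst w 1)) _; ring.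
have h1 := wf _ _ _ h0; rewrite mul1r in h1.
have h2 : cder (fun t : R => f (t%:C * w)) 1 (n%:R * f w).
  apply: cder_ext (fun t => esym (hf t w)) _.
  apply: cder_eq (cderM (cderX n (cder_real 1)) (cder_cst (f w) 1)) _.
  by rewrite expr1n; ring.
exact: cder_uniq h1 h2.
Qed.

Lemma cis_polar (w : C) : exists2 t : R, - pi <= t <= pi & w = (normc w)%:C * cis t.
Proof.
have [->|w0] := eqVneq w 0.
  by exists 0; rewrite ?oppr_le0 ?pi_ge0// normc0 mul0r.
have nw : 0 < normc w by rewrite normc_gt0.
pose x := Re w / normc w; pose y := Im w / normc w.
have xy : x ^+ 2 + y ^+ 2 = 1.
  rewrite /x /y !expr_div_n -mulrDl -normc_sqr divff// expf_neq0// gt_eqF//.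
have x1 : -1 <= x <= 1 by rewrite -ler_norml -(@ler_pXn2r _ 2)// ?nnegrE// expr1n real_normK ?num_real// -xy lerDl sqr_ge0.
have wE (a b : R) : x = a -> y = b -> w = (normc w)%:C * (a +i* b).
  move=> <- <-; apply: complexP => /=; rewrite !mul0r ?subr0 ?addr0 /x /y mulrC divfK// gt_eqF//.
have sy : sin (acos x) = `|y|.
  rewrite sin_acos//; have -> : 1 - x ^+ 2 = y ^+ 2 by rewrite -xy; ring.
  by rewrite sqrtr_sqr.
have [y0|y0] := leP 0 y.
  exists (acos x).
    by rewrite acos_lepi// andbT; apply: le_trans (acos_ge0 x1); rewrite oppr_le0 pi_ge0.
  by apply: wE; rewrite ?acosK// sy ger0_norm.
exists (- acos x).
  rewrite lerNl opprK acos_lepi//=; apply: le_trans (pi_ge0 R); rewrite oppr_le0; exact: acos_ge0.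
by apply: wE; rewrite ?cosN ?sinN ?acosK// sy ltr0_norm// opprK.
Qed.

Lemma cont_cis (f : C -> C) : sm1 f -> continuous (fun t : R => Re (f (cis t))).
Proof.
move=> /sm1_wirt[A [B [_ _ wf]]]; apply: (@cder_continuous _ (fun t => f (cis t))) => t.
by exists (A (cis t) * (Ci * cis t) + B (cis t) * (Ci * cis t)^J); apply: wf; exact: cder_cis.
Qed.

(** max(g, -f) is positive on the circle, hence at least some mu > 0, and f is
bounded by some K; take c = mu / K. *)
Lemma circle_compare (f g : C -> C) : sm1 f -> sm1 g -> (forall t : R, 0 <= Re (g (cis t))) ->
  (forall t : R, Re (g (cis t)) = 0 -> Re (f (cis t)) < 0) ->
  exists2 c : R, 0 < c & forall t : R, - pi <= t <= pi -> c * Re (f (cis t)) <= Re (g (cis t)).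
Proof.
move=> sf sg g0 fg.
have cf := cont_cis sf; have cg := cont_cis sg.
have pp : - pi <= pi :> R by have := pi_ge0 R; lra.
pose phi t := Num.max (Re (g (cis t))) (- Re (f (cis t))).
have cphi : continuous phi.
  by move=> t; apply: (@continuous_max _ _ (fun t => Re (g (cis t))) (fun t => - Re (f (cis t)))); [exact: cg|apply: continuousN; exact: cf].
have [t0 t0in Hmin] := EVT_min pp (continuous_subspaceT cphi).
have [t1 t1in Hmax] := EVT_max pp (continuous_subspaceT cf).
have mu0 : 0 < phi t0.
  rewrite lt_max; have := g0 t0; rewrite le_eqVlt => /orP[/eqP E|->//].
  by rewrite oppr_gt0 fg ?orbT.
pose K := 1 + `|Re (f (cis t1))|.
have K0 : 0 < K by rewrite /K; have := normr_ge0 (Re (f (cis t1))); lra.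
exists (phi t0 / K); first exact: divr_gt0.
move=> t tin; have c0 : 0 < phi t0 / K by exact: divr_gt0.
have h1 : phi t0 <= phi t by apply: Hmin; rewrite in_itv.
have h2 : Re (f (cis t)) <= K.
  have := Hmax t; rewrite in_itv => /(_ tin) h; apply: le_trans h _.
  by rewrite /K; have := ler_norm (Re (f (cis t1))); lra.
have [fp|fp] := leP 0 (Re (f (cis t))); last first.
  apply: le_trans (g0 t); rewrite pmulr_rle0//; exact: ltW.
have h3 : phi t0 <= Re (g (cis t)).
  have /orP[//|h] : (phi t0 <= Re (g (cis t))) || (phi t0 <= - Re (f (cis t))) by rewrite -le_max; exact: h1.
  lra.
apply: le_trans h3; rewrite mulrAC ler_pdivrMr// ler_wpM2l// ltW//.
Qed.

Lemma onepmulcJ (w : C) : 1 + w * w^J = (1 + normc w ^+ 2)%:C.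
Proof. by rewrite mulcJ rmorphD. Qed.

Definition tauc (w : C) : C := (1 + w * w^J)^-1.

Lemma taucE w : tauc w = ((1 + normc w ^+ 2)^-1)%:C.
Proof. by rewrite /tauc onepmulcJ fmorphV. Qed.

Lemma wirt_tauc : wirt tauc (fun w => - (w^J * tauc w ^+ 2)) (fun w => - (w * tauc w ^+ 2)).
Proof.
move=> x t dx dxx.
have n0 : 1 + x t * (x t)^J != 0.
  by rewrite onepmulcJ; apply/eqP => -[] /eqP; rewrite gt_eqF// ltr_pwDl// sqr_ge0.
apply: cder_eq (cderV n0 (cderD (cder_cst 1 t) (cderM dxx (cderJ dxx)))) _.
by rewrite /tauc -exprVn; ring.
Qed.

Lemma wirt_weight (j : nat) : exists r11, wirt (fun w => tauc w ^+ j.+2)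
    (fun w => - (j.+2%:R * w^J * tauc w ^+ j.+3)) (fun w => - (j.+2%:R * w * tauc w ^+ j.+3)) /\
  wirt (fun w : C => - (j.+2%:R * w^J * tauc w ^+ j.+3)) r11
    (fun w => j.+2%:R * (j.+3%:R * (w * w^J) * tauc w ^+ j.+4 - tauc w ^+ j.+3)).
Proof.
have wJ : wirt (fun w : C => w^J) (fun=> 0) (fun=> 1).
  by apply: wirt_ext (wirt_conj wirt_id) => w //; [exact: conj0|exact: conj1].
exists (fun w => j.+2%:R * j.+3%:R * w^J ^+ 2 * tauc w ^+ j.+4); split.
  apply: wirt_ext (wirt_pow j.+2 wirt_tauc) => // w /=; rewrite !exprS; ring.
apply: wirt_ext (wirtM (wirtM (wirt_cst (- j.+2%:R)) wJ) (wirt_pow j.+3 wirt_tauc)) => w /=.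
- by rewrite -!mulNr.
- rewrite !exprS; ring.
rewrite !exprS; ring.
Qed.

Lemma sm1_tauc : sm1 tauc.
Proof. exact: (sm_inv (sm_X Xid tt)). Qed.

End bump_value.

(** * A bump dominated by a Laplacian *)

Section bump.
Context {R : realType}.
Local Notation C := R[i].
Variables (n : nat) (L : {poly C}).
Let N := formc n L.
Hypothesis sL : (size L <= n.+1)%N.
Hypothesis L0 : L != 0.
Hypothesis Nreal : forall s, N s = (Re (N s))%:C.
Hypothesis N0 : forall s, 0 <= Re (N s).

(** For odd n the function N is odd, and nonnegative, hence 0. *)
Lemma formc_even : exists m, n = m.*2.
Proof.
exists n./2; have := odd_double_half n; case: (boolP (odd n)) => [on|//] _.
case/eqP: L0; apply: (formc_inj sL) => w; rewrite -/N Nreal.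
have E : N (- w) = - N w.
  have -> : - w = (-1 : R)%:C * w by rewrite rmorphN mulN1r.
  rewrite /N formc_scale rmorphN -signr_odd on expr1 mulN1r//.
have := N0 (- w); rewrite E ReN oppr_ge0 => h1.
by congr (_ %:C); apply/eqP; rewrite eq_le h1 N0.
Qed.

Lemma realify (x : C) (H n1 n2 n3 r t2 t3 t4 : R) :
  x * t2%:C - n1%:C * t3%:C * (n2%:C * H%:C) + H%:C * (n1%:C * (n3%:C * r%:C * t4%:C - t3%:C)) =
  t2%:C * x + (- (n1 * t3 * (n2 * H)) + H * (n1 * (n3 * r * t4 - t3)))%:C.
Proof. by rewrite !(rmorphD, rmorphN, rmorphM) /=; ring. Qed.

(** See the introduction for the choice of h = (hr)%:C and of the weight; s is the
product of the X - xi over the distinct roots xi of L, and S its form in w and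
conj w. Distinctness of the roots makes s' nonzero at each of them, so B can be
chosen with B |s'(xi)|^2 > (E+1)^2. *)
Lemma exists_bump : exists Ht : C -> R, exists A A1 B, [/\ sm1 (fun s => (Ht s)%:C), Ht 0 = 0,
  forall s, s != 0 -> 0 < Ht s,
  wirt (fun s => (Ht s)%:C) A (fun s => (A s)^J) /\ wirt A A1 B &
  forall s, Re (B s) <= Re (N s)].
Proof.
have [m nm] := formc_even.
have [r0 Er] := closed_field_poly_normal L.
pose rs := undup r0.
have rsP x : root L x -> x \in rs.
  rewrite Er rootZ ?lead_coef_eq0// root_prod_XsubC mem_undup//.
pose s : {poly C} := \prod_(x <- rs) ('X - x%:P).
pose si := size rs.
have ss : (size s <= si.+1)%N by rewrite size_prod_XsubC.
have ssep : separable_poly s by rewrite separable_prod_XsubC undup_uniq.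
have sroot x : x \in rs -> s.[x] = 0.
  by move=> xr; apply/eqP; rewrite -[_ == 0]/(root s x) root_prod_XsubC.
have sder x : x \in rs -> s^`().[x] != 0.
  by move=> /sroot/eqP sx; move: ssep; rewrite separable_poly.unlock => cs; exact: (coprimep_root cs sx).
pose j' := si.*2. pose j := j'.+2.
(* h has degree 2E + 2, which exceeds the degree of U by 2j *)
pose E := (m + j)%N.
have siE0 : (si <= E)%N by rewrite /E /j /j'; lia.
have jE : (j'.+3 <= 2 * E.+1)%N by rewrite /E /j; lia.
pose Q (x : C) : R := E.+1%:R ^+ 2 / normc (s^`().[x]) ^+ 2.
have Q0 x : 0 <= Q x by rewrite /Q divr_ge0// sqr_ge0.
(* one constant that is large enough at every root *)
pose B : R := 1 + \sum_(x <- rs) Q x.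
have B0 : 0 < B by rewrite ltr_pwDl// sumr_ge0.
have BQ x : x \in rs -> E.+1%:R ^+ 2 < B * normc (s^`().[x]) ^+ 2.
  move=> xr; rewrite -ltr_pdivrMr ?exprn_gt0 ?normc_gt0 ?sder// -/(Q x) /B.
  rewrite (big_rem x)//= addrCA ltrDl ltr_pwDl// sumr_ge0//.
pose S := formc si s.
pose q w := S w * (S w)^J.
pose be := fun w : C => (w * w^J) ^+ (E.+1 - si).
pose ga := fun w : C => (w * w^J) ^+ (E.+1 - si.*2).
pose h : C -> C := fun w => (w * w^J) ^+ E.+1 - B%:C * (be w * (S w * (S w)^J)) + B%:C ^+ 2 * (ga w * ((S w * (S w)^J) * (S w * (S w)^J))).
pose hr (w : C) : R := normc w ^+ 2 ^+ E.+1 - B * (normc w ^+ 2 ^+ (E.+1 - si) * normc (S w) ^+ 2)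
   + B ^+ 2 * (normc w ^+ 2 ^+ (E.+1 - si.*2) * (normc (S w) ^+ 2 * normc (S w) ^+ 2)).
have hE w : (hr w)%:C = h w.
  by rewrite /h /be /ga /hr !mulcJ !(rmorphD, rmorphM, rmorphXn, rmorphN, rmorphB).
have si2 : (si.*2 <= E.+1)%N by rewrite /E /j /j'; lia.
have hr0 : hr 0 = 0.
  have e1 : (E.+1 - si == 0)%N = false by apply/negbTE; rewrite /E /j /j'; lia.
  have e2 : (E.+1 - si.*2 == 0)%N = false by apply/negbTE; rewrite /E /j /j'; lia.
  by rewrite /hr normc0 [0 ^+ 2]expr0n /= !expr0n /= e1 e2 !(mul0r, mulr0) subr0 addr0.
have hrpos w : w != 0 -> 0 < hr w.
  move=> w0; have nw : 0 < normc w ^+ 2 by rewrite exprn_gt0// normc_gt0.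
  set r := normc w ^+ 2 in nw; pose y := B * normc (S w) ^+ 2; pose x := r ^+ si.
  have -> : hr w = r ^+ (E.+1 - si.*2) * (x ^+ 2 - x * y + y ^+ 2).
    rewrite /hr -/r /x /y.
    have -> : r ^+ E.+1 = r ^+ (E.+1 - si.*2) * (r ^+ si) ^+ 2.
      by rewrite -exprM -exprD; congr (_ ^+ _); lia.
    have -> : r ^+ (E.+1 - si) = r ^+ (E.+1 - si.*2) * r ^+ si.
      by rewrite -exprD; congr (_ ^+ _); lia.
    ring.
  apply: mulr_gt0; first exact: exprn_gt0.
  have x0 : 0 < x by rewrite exprn_gt0.
  have -> : x ^+ 2 - x * y + y ^+ 2 = (y - x / 2) ^+ 2 + 3 / 4 * x ^+ 2 by field.
  have x2 : 0 < x ^+ 2 by exact: exprn_gt0.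
  by have := sqr_ge0 (y - x / 2); lra.
have smS : sm1 S by exact: sm1_formc.
have sbe : sm1 be by exact: sm1_rpow.
have sga : sm1 ga by exact: sm1_rpow.
have sh : sm1 h.
  apply: sm_add; first apply: sm_add.
  - exact: sm1_rpow.
  - by apply: sm_opp; apply: sm_mul; [exact: sm_cst|apply: sm_mul => //; apply: sm_mul => //; exact: sm_conj].
  - by apply: sm_mul; [exact: (sm_cst _ (B%:C ^+ 2))|apply: sm_mul => //; apply: sm_mul; apply: sm_mul => //; exact: sm_conj].
have shr : sm1 (fun w => (hr w)%:C) by apply: sm_ext sh => w; rewrite hE.
have [h1 [h2' [sh1 _ /wirt_real wh]]] := sm1_wirt shr.
have [h11 [h12 [_ sh12 wh1]]] := sm1_wirt sh1.
have hscale (t : R) w : (hr (t%:C * w))%:C = t%:C ^+ (2 * E.+1) * (hr w)%:C.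
  rewrite !hE /h /be /ga /S formc_scale !conjM !conjX !conjR.
  have e1 : (2 * E.+1 = 2 * (E.+1 - si) + (si + si))%N by lia.
  have e2 : (2 * E.+1 = 2 * (E.+1 - si.*2) + (si + si) + (si + si))%N by lia.
  have -> : (t%:C * w * (t%:C * w^J)) ^+ E.+1 = t%:C ^+ (2 * E.+1) * (w * w^J) ^+ E.+1 :> C.
    by rewrite mulrACA exprMn -expr2 -exprM.
  have -> : (t%:C * w * (t%:C * w^J)) ^+ (E.+1 - si) * (t%:C ^+ si * formc si s w * (t%:C ^+ si * (formc si s w)^J)) =
     t%:C ^+ (2 * E.+1) * ((w * w^J) ^+ (E.+1 - si) * (formc si s w * (formc si s w)^J)) :> C.
    by rewrite mulrACA exprMn -expr2 -exprM e1 !exprD; ring.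
  have -> : (t%:C * w * (t%:C * w^J)) ^+ (E.+1 - si.*2) * ((t%:C ^+ si * formc si s w * (t%:C ^+ si * (formc si s w)^J)) * (t%:C ^+ si * formc si s w * (t%:C ^+ si * (formc si s w)^J))) =
     t%:C ^+ (2 * E.+1) * ((w * w^J) ^+ (E.+1 - si.*2) * ((formc si s w * (formc si s w)^J) * (formc si s w * (formc si s w)^J))) :> C.
    by rewrite mulrACA exprMn -expr2 -exprM e2 !exprD; ring.
  ring.
have hscale' (t : R) w : (hr (t%:C * w))%:C = t%:C ^+ (2 * E).+2 * (hr w)%:C.
  by rewrite hscale mulnS.
have h12s (t : R) w : t != 0 -> h12 (t%:C * w) = t%:C ^+ (2 * E) * h12 w.
  move=> t0; have a1 w' := (wirt_scaleinv wh t0 (hscale' t) w').1.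
  exact: (wirt_scaleinv wh1 t0 a1 w).2.
have h0 w : 0 <= hr w.
  by have [->|/hrpos/ltW//] := eqVneq w 0; rewrite hr0.
have neg w : w != 0 -> N w = 0 -> Re (h12 w) < 0.
  move=> w0 Nw.
  have wJ0 : w^J != 0 by rewrite -normc_gt0 normc_conj normc_gt0.
  pose xi := w / w^J.
  have xr : xi \in rs.
    apply: rsP; rewrite rootE; apply/eqP; move: Nw; rewrite /N /formc form_div// => /eqP.
    by rewrite mulf_eq0 expf_eq0 (negbTE wJ0) andbF /= => /eqP.
  have [si' Esi] : exists si', si = si'.+1 by exists si.-1; rewrite prednK// lt0n size_eq0; apply: contraTneq xr => ->; rewrite in_nil.
  have Sw : S w = 0 by rewrite /S /formc form_div// sroot// mulr0.
  have wS : wirt S (formc si' s^`()) (formc si' (codiff si'.+1 s)) by rewrite /S Esi; exact: wirt_formc.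
  have [a11 [wal wal1]] := @wirt_rpow R E.
  have [be1 [be2 [_ _ wbe]]] := sm1_wirt sbe.
  have [ga1 [ga2 [_ _ wga]]] := sm1_wirt sga.
  rewrite (bump_at_zero (B := B%:C) sbe sga smS wal wbe wga wS wal1 hE wh wh1 Sw).
  have nw : 0 < normc w ^+ 2 by rewrite exprn_gt0// normc_gt0.
  rewrite !mulcJ /be mulcJ.
  have -> : normc (formc si' s^`() w) ^+ 2 = (normc w ^+ 2) ^+ si' * normc (s^`().[xi]) ^+ 2.
    rewrite /formc form_div//; last by apply: deriv_size; rewrite -Esi.
    by rewrite normcM normcX normc_conj exprMn -!exprM mulnC.
  have -> : (E.+1 - si = E - si')%N by rewrite Esi subSS.
  set r := normc w ^+ 2 in nw *; set Y := normc (formc si' _ w) ^+ 2.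
  have Y0 : 0 <= Y by exact: sqr_ge0.
  have -> : E.+1%:R ^+ 2 * (r%:C) ^+ E - B%:C * r%:C ^+ (E - si') * ((r ^+ si' * normc (s^`().[xi]) ^+ 2)%:C + Y%:C)
     = (E.+1%:R ^+ 2 * r ^+ E - B * r ^+ (E - si') * (r ^+ si' * normc (s^`().[xi]) ^+ 2 + Y))%:C :> C.
    by rewrite !(rmorphB, rmorphD, rmorphM, rmorphXn) /= rmorph_nat.
  have Bx := BQ _ xr; have p1 : 0 < r ^+ (E - si') by exact: exprn_gt0.
  have p2 : 0 < r ^+ si' by exact: exprn_gt0.
  rewrite /=.
  have -> : r ^+ E = r ^+ (E - si') * r ^+ si' :> R.
    have siE : (si' <= E)%N by apply: leq_trans siE0; rewrite Esi.
    by rewrite -exprD subnK.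
  have -> : E.+1%:R ^+ 2 * (r ^+ (E - si') * r ^+ si') - B * r ^+ (E - si') * (r ^+ si' * normc s^`().[xi] ^+ 2 + Y)
     = - (r ^+ (E - si') * (r ^+ si' * (B * normc s^`().[xi] ^+ 2 - E.+1%:R ^+ 2) + B * Y)) by ring.
  rewrite oppr_lt0 mulr_gt0// ltr_pwDl// ?mulr_gt0 ?subr_gt0// mulr_ge0// ltW//.
have cis0 (t : R) : cis t != 0 by rewrite -normc_gt0 normc_cis.
have [c c0 Hc] : exists2 c : R, 0 < c & forall t : R, - pi <= t <= pi -> c * Re (h12 (cis t)) <= Re (N (cis t)).
  apply: circle_compare => //; first exact: sm1_formc.
  by move=> t Nt; apply: neg => //; rewrite Nreal Nt.
have cmpN w : w != 0 -> c * Re (h12 w) <= (normc w ^+ 2) ^+ j * Re (N w).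
  move=> w0; have nw : 0 < normc w by rewrite normc_gt0.
  (* both sides are homogeneous of degree 2E; compare them on the circle *)
  have [t tin Ew] := cis_polar w.
  rewrite {1 3}Ew h12s ?gt_eqF// /N formc_scale -!rmorphXn !ReM /= !mul0r !subr0.
  have -> : normc w ^+ 2 ^+ j * (normc w ^+ n * Re (formc n L (cis t))) = normc w ^+ (2 * E) * Re (N (cis t)).
    by rewrite mulrA -exprM -exprD; congr (_ ^+ _ * _); rewrite nm /E; lia.
  by rewrite mulrCA ler_pM2l ?exprn_gt0// Hc.
have cmpN' w : c * Re (h12 w) <= (normc w ^+ 2) ^+ j * Re (N w).
  pose G w := (w * w^J) ^+ j * N w + - c%:C * h12 w.
  have RG w' : Re (G w') = (normc w' ^+ 2) ^+ j * Re (N w') - c * Re (h12 w').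
    by rewrite /G mulcJ -rmorphXn -rmorphN ReD !ReM /= !mul0r !subr0 mulNr.
  rewrite -subr_ge0 -RG; apply: (@sm1_nonneg0 _ G).
    apply: sm_add; first by apply: sm_mul; [exact: sm1_rpow|exact: sm1_formc].
    by apply: sm_mul => //; exact: (sm_cst _ (- c%:C)).
  by move=> w' w0; rewrite RG subr_ge0 cmpN.
have [r11 [wr wr1]] := @wirt_weight R j'.
pose tr (w : C) : R := (1 + normc w ^+ 2)^-1.
have tr0 w : 0 < tr w by rewrite invr_gt0 ltr_pwDl// sqr_ge0.
have trw w : 0 <= normc w ^+ 2 * tr w <= 1.
  apply/andP; split; first by apply: mulr_ge0; [exact: sqr_ge0|exact: ltW (tr0 w)].
  by rewrite /tr ler_pdivrMr ?ltr_pwDl ?sqr_ge0// mul1r lerDr.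
pose Ht w := c * (hr w * tr w ^+ j).
have HtE w : (Ht w)%:C = c%:C * ((hr w)%:C * tauc w ^+ j).
  by rewrite taucE -rmorphXn -!rmorphM.
have wHt := wirt_real (wirt_ext (fun w => esym (HtE w)) (frefl _) (frefl _) (wirtM (wirt_cst c%:C) (wirtM wh wr))).
have wHt1 := wirtD (wirtM (wirt_cst 0) (wirtM wh wr)) (wirtM (wirt_cst c%:C) (wirtD (wirtM wh1 wr) (wirtM wh wr1))).
exists Ht; eexists; eexists; eexists; split; last 2 first.
- by split; [exact: wHt|exact: wHt1].
- move=> w /=.
  have eul := wirt_euler wh hscale w.
  rewrite !taucE -/(tr w) mulcJ.
  set t := tr w; set H := hr w; set r := normc w ^+ 2.
  rewrite !mul0r !add0r.
  pose Kc : C := j'.+2%:R * (j'.+3%:R * r%:C * t%:C ^+ j'.+4 - t%:C ^+ j'.+3).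
  have -> : h12 w * t%:C ^+ j'.+2 + h1 w * - (j'.+2%:R * w * t%:C ^+ j'.+3) +
     ((h1 w)^J * - (j'.+2%:R * w^J * t%:C ^+ j'.+3) + H%:C * (j'.+2%:R * (j'.+3%:R * r%:C * t%:C ^+ j'.+4 - t%:C ^+ j'.+3)))
    = h12 w * t%:C ^+ j'.+2 - j'.+2%:R * t%:C ^+ j'.+3 * (h1 w * w + (h1 w)^J * w^J) + H%:C * Kc by rewrite /Kc; ring.
  rewrite eul /Kc.
  pose K : R := - (j'.+2%:R * t ^+ j'.+3 * ((2 * E.+1)%:R * H)) + H * (j'.+2%:R * (j'.+3%:R * r * t ^+ j'.+4 - t ^+ j'.+3)).
  have -> : h12 w * t%:C ^+ j'.+2 - j'.+2%:R * t%:C ^+ j'.+3 * ((2 * E.+1)%:R * H%:C) + H%:C * (j'.+2%:R * (j'.+3%:R * r%:C * t%:C ^+ j'.+4 - t%:C ^+ j'.+3))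
    = (t ^+ j'.+2)%:C * h12 w + K%:C.
    have natC k : (k%:R : C) = (k%:R : R)%:C by rewrite rmorph_nat.
    rewrite !natC -!rmorphXn; exact: realify.
  rewrite !(ReM, ReD) /= !mul0r !subr0.
  have K0 : K <= 0.
    have -> : K = H * t ^+ j'.+3 * j'.+2%:R * (j'.+3%:R * (r * t) - 1 - (2 * E.+1)%:R) by rewrite /K !exprS; ring.
    apply: mulr_ge0_le0.
      apply: mulr_ge0; last exact: ler0n.
      by apply: mulr_ge0; [exact: h0|apply: exprn_ge0; exact: ltW (tr0 w)].
    have /andP[_ rt] := trw w.
    have : (j'.+3%:R : R) * (r * t) <= j'.+3%:R * 1 by rewrite ler_wpM2l.
    have : (j'.+3%:R : R) <= (2 * E.+1)%:R by rewrite ler_nat.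
    lra.
  have t0 : 0 < t := tr0 w.
  rewrite mulrDr; apply: le_trans (_ : c * (t ^+ j'.+2 * Re (h12 w)) <= _).
    by rewrite gerDl pmulr_rle0.
  rewrite mulrCA; apply: le_trans (_ : t ^+ j'.+2 * (r ^+ j * Re (N w)) <= _).
    by rewrite ler_wpM2l ?cmpN'// exprn_ge0// ltW.
  rewrite mulrA -exprMn [t * r]mulrC ler_piMl//.
  by have /andP[a1 a2] := trw w; rewrite exprn_ile1.
- apply: sm_ext (fun w => esym (HtE w)) _.
  apply: sm_mul; first exact: (sm_cst _ c%:C).
  by apply: sm_mul => //; apply: sm_exp; exact: sm1_tauc.
- by rewrite /Ht hr0 mul0r mulr0.
- move=> w w0; apply: mulr_gt0 => //; apply: mulr_gt0; first exact: hrpos.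
  exact: exprn_gt0 (tr0 w).
Qed.

End bump.

(** * Lines, composition with a form, and the theorem *)

Section assembly.
Context {R : realType}.
Local Notation C := R[i].

Lemma Ck_cst0 n : Ck_on setT n (fun _ : C => 0 : R).
Proof.
have rl v z : rline (fun _ : C => 0 : R) v z = cst 0 by [].
have rd v : rderive v (fun _ : C => 0 : R) = (fun _ : C => 0 : R).
  by apply/funext => z; rewrite /rderive rl derive_cst.
elim: n => [|n ih] /=; split => //.
- by move=> z _; exact: cst_continuous.
- by move=> z _; exact: cst_continuous.
move=> v; split; last by rewrite rd.
by move=> z _; rewrite /rderivable rl; exact: derivable_cst.
Qed.

Lemma pluriharmonic0 : pluriharmonic (fun _ : C * C => 0 : R).
Proof.
move=> a b; split; first exact: Ck_cst0.
have rd v : rderive v (fun _ : C => 0 : R) = (fun _ : C => 0 : R).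
  apply/funext => z; rewrite /rderive.
  have -> : rline (fun _ : C => 0 : R) v z = cst 0 by [].
  by rewrite derive_cst.
by move=> z _; rewrite !rd addr0.
Qed.

Lemma wirt_horner (G : {poly C}) : wirt (fun w => G.[w]) (fun w => G^`().[w]) (fun=> 0).
Proof.
elim/poly_ind: G => [|G c ih].
  by apply: wirt_ext (wirt_cst 0) => w; rewrite ?deriv0 ?horner0.
apply: wirt_ext (wirtD (wirtM ih wirt_id) (wirt_cst c)) => w //=.
- by rewrite !hornerE.
- by rewrite derivD derivM derivX derivC !hornerE.
by rewrite mul0r mulr0 !addr0.
Qed.

Lemma sm1_horner (G : {poly C}) : sm1 (fun w => G.[w]).
Proof.
elim/poly_ind: G => [|G c ih]; first by apply: sm_ext (sm_cst _ 0) => w; rewrite horner0.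
apply: sm_ext (sm_add (sm_mul ih (sm_X Xid tt)) (sm_cst _ c)) => w.
by rewrite !hornerE.
Qed.

Lemma form_line d (F : {poly C}) (a b : C * C) : exists G : {poly C}, forall w,
  form d F (a + w *: b).1 (a + w *: b).2 = G.[w].
Proof.
exists (\sum_(i < d.+1) F`_i *: ((a.1%:P + b.1 *: 'X) ^+ i * (a.2%:P + b.2 *: 'X) ^+ (d - i))) => w.
rewrite horner_sum; apply: eq_bigr => i _; rewrite hornerZ hornerM !horner_exp !hornerD !hornerZ !hornerX !hornerC /= mulrA.
by congr (_ * _ ^+ _ * _ ^+ _); rewrite [_ * w]mulrC.
Qed.

Lemma sm2_form d (F : {poly C}) : sm2 (fun z => form d F z.1 z.2).
Proof.
apply: sm_sum => i; apply: sm_mul.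
  by apply: sm_mul; [exact: sm_cst|apply: sm_exp; exact: (sm_X X2 true)].
by apply: sm_exp; exact: (sm_X X2 false).
Qed.

Definition mform d (f : {poly C}) : mpoly.mpoly 2 C :=
  \sum_(i < d.+1) mpoly.mpolyC 2 f`_i * mpoly.mpolyX C (mpoly.mnm1 ord0) ^+ i * mpoly.mpolyX C (mpoly.mnm1 (inord 1)) ^+ (d - i).

Lemma mformE d f (x y : C) : mpoly.meval (tnth [tuple x; y]) (mform d f) = form d f x y.
Proof.
rewrite /mform raddf_sum /=; apply: eq_bigr => i _.
rewrite !mpoly.mevalM !rmorphXn /= mpoly.mevalC !mpoly.mevalXU !(tnth_nth 0) /= inordK//.
Qed.

(** On a complex line a form is a polynomial G, and the Laplacian of V(G) is that of
V at G times |G'|^2. *)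
Lemma psh_form (V : C -> R) A A1 B d (F : {poly C}) :
  sm1 (fun s => (V s)%:C) -> wirt (fun s => (V s)%:C) A (fun s => (A s)^J) -> wirt A A1 B ->
  (forall s, 0 <= Re (B s)) -> plurisubharmonic (fun z => V (form d F z.1 z.2)).
Proof.
move=> sV wV wA B0; split.
  apply: sm2_usc; apply: (sm_comp (tau := fun z : C * C => form d F z.1 z.2) _ sV) => -[].
  exact: sm2_form.
move=> a b; have [G GE] := form_line d F a b.
have -> : (fun w => V (form d F (a + w *: b).1 (a + w *: b).2)) = (fun w => V G.[w]).
  by apply/funext => w; rewrite GE.
have wG := wirt_horner G; have wG' := wirt_horner G^`().
apply: (lap_subharmonic _ (wirt_real (wirt_comp wV wG)) (wirtM (wirt_comp wA wG) wG')).
  by apply: (sm1_comp sV); exact: sm1_horner.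
move=> w; rewrite mulr0 addr0 -mulrA [_^J * _]mulrC mulcJ ReM /= mulr0 subr0.
by rewrite mulr_ge0// sqr_ge0.
Qed.

(** Normalized directions: (x, 1) for the roots x, and (1, 0) when the degree of F is
less than d, i.e. when z2 divides the form. Distinct ones span distinct lines. *)
Definition zero_dirs d (F : {poly C}) (r : seq C) : seq (C * C) :=
  [seq (x, 1) | x <- undup r] ++ (if F`_d == 0 then [:: (1, 0)] else [::]).

Lemma zero_dirsP d F r v : v \in zero_dirs d F r -> (exists x, x \in r /\ v = (x, 1)) \/ (F`_d = 0 /\ v = (1, 0)).
Proof.
rewrite mem_cat => /orP[/mapP[x xr ->]|]; first by left; exists x; rewrite -mem_undup.
by case: eqP => // Fd; rewrite inE => /eqP ->; right.
Qed.

Lemma zero_dirs_uniq d F r : uniq (zero_dirs d F r).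
Proof.
rewrite cat_uniq map_inj_uniq ?undup_uniq /=; last by move=> x y [].
case: ifP => _ //=; rewrite orbF andbT; apply/mapP => -[x _ []] _ /eqP.
by rewrite eq_sym oner_eq0.
Qed.

(** The point 0 lies on one of the lines because there is at least one, as d > 0. *)
Lemma form_zero d (F : {poly C}) : (0 < d)%N -> (size F <= d.+1)%N -> F != 0 ->
  exists N (L : 'I_N -> set (C * C)), [/\ injective L, forall j, is_line_through_0 (L j) &
    [set z | form d F z.1 z.2 = 0] = \bigcup_(j in [set: 'I_N]) L j].
Proof.
move=> d0 sF F0; have [r Er] := closed_field_poly_normal F.
have lc : lead_coef F != 0 by rewrite lead_coef_eq0.
have rP x : (F.[x] == 0) = (x \in r) by rewrite -[_ == 0]/(root F x) Er rootZ// root_prod_XsubC.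
pose rl := zero_dirs d F r.
exists (size rl), (fun j => range (fun w : C => w *: nth 0 rl j)).
have dirs (j : 'I_(size rl)) : nth 0 rl j \in rl by exact: mem_nth.
split.
- move=> i j E.
  have : nth 0 rl i = nth 0 rl j.
    have : range (fun w : C => w *: nth 0 rl j) (nth 0 rl i) by rewrite -E; exists 1 => //; rewrite scale1r.
    case=> w _; have [[x [_ ->]]|[_ ->]] := zero_dirsP (dirs i);
      have [[y [_ ->]]|[_ ->]] := zero_dirsP (dirs j); rewrite /= => -[].
    + move=> e1 e2; have {}e1 : w * y = x := e1; have {}e2 : w * 1 = 1 := e2.
      by rewrite -e1 -[w]mulr1 e2 mul1r.
    + move=> _ e2; have {}e2 : w * 0 = 1 := e2.
      by move: e2; rewrite mulr0 => /eqP; rewrite eq_sym oner_eq0.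
    + move=> e1 e2; have {}e1 : w * y = 1 := e1; have {}e2 : w * 1 = 0 := e2.
      by move: e1; rewrite -[w]mulr1 e2 mul0r => /eqP; rewrite eq_sym oner_eq0.
    + by [].
  by move/eqP; rewrite nth_uniq ?zero_dirs_uniq// => /eqP/val_inj.
- move=> j; exists (nth 0 rl j) => //.
  have [[x [_ ->]]|[_ ->]] := zero_dirsP (dirs j); apply/eqP => -[].
    by move=> _ /eqP; rewrite oner_eq0.
  by move=> /eqP; rewrite oner_eq0.
have inL v w : v \in rl -> (\bigcup_(j in [set: 'I_(size rl)]) range (fun w : C => w *: nth 0 rl j)) (w *: v).
  move=> vr; have hi : (index v rl < size rl)%N by rewrite index_mem.
  by exists (Ordinal hi) => //; exists w => //=; rewrite nth_index.
have xin x : x \in r -> (x, 1) \in rl by move=> xr; rewrite mem_cat map_f// mem_undup.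
have infin : F`_d = 0 -> (1, 0) \in rl by move=> Fd; rewrite mem_cat Fd eqxx inE eqxx orbT.
apply/seteqP; split => [[z1 z2] /= Fz|z [j _ [w _ <-]]] /=; last first.
  have [[x [xr ->]]|[Fd ->]] := zero_dirsP (dirs j).
    rewrite /= form_scale form_x1//; apply/eqP; rewrite mulf_eq0 rP xr orbT//.
  by rewrite /= form_scale form_z20 Fd mul0r mulr0.
have [z20|z20] := eqVneq z2 0; last first.
  have -> : (z1, z2) = z2 *: (z1 / z2, 1) :> C * C by congr pair; rewrite /GRing.scale /= ?mulr1// mulrCA divff// mulr1.
  apply/inL/xin; rewrite -rP; move: Fz; rewrite form_div// => /eqP.
  by rewrite mulf_eq0 expf_eq0 (negbTE z20) andbF.
move: Fz; rewrite z20 form_z20 => /eqP; rewrite mulf_eq0 => /orP[/eqP Fd|].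
  have -> : (z1, 0) = z1 *: (1, 0) :> C * C by congr pair; rewrite /GRing.scale /= ?mulr1 ?mulr0.
  exact/inL/infin.
rewrite expf_eq0 => /andP[_ /eqP ->].
have [v vr] : exists v, v \in rl.
  have [Fd|Fd] := eqVneq F`_d 0; first by exists (1, 0); exact: infin.
  case: r Er rP @rl dirs inL xin infin => [|x r] Er rP rl dirs inL xin infin; last by exists (x, 1); apply: xin; rewrite inE eqxx.
  by case/eqP: Fd; rewrite Er big_nil coefZ coef1 gtn_eqF// mulr0.
have -> : (0, 0) = 0 *: v :> C * C by rewrite scale0r.
exact: inL.
Qed.

End assembly.

Theorem theorem2p4 (R : realType) (k : nat) (p : mpoly.mpoly 4 R[i])
    (P : R[i] * R[i] -> R) :
  (0 < k)%N ->
  is_real_poly2 p P ->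
  plurisubharmonic P ->
  ~ pluriharmonic P ->
  homogeneous (2 * k) (fun z => (P z)%:C) ->
  no_pluriharmonic_terms p ->
  propertyB P ->
  exists (U : R[i] -> R) (F : R[i] * R[i] -> R[i]),
    [/\ exists u, is_real_poly1 u U,
        subharmonic U,
        exists d : nat, homogeneous d (fun w : R[i] => (U w)%:C),
        (exists f, is_holo_poly2 f F) /\ (exists d : nat, homogeneous d F) &
        forall z1 z2 : R[i], P (z1, z2) = U (F (z1, z2))] /\
    exists (N : nat) (L : 'I_N -> set (R[i] * R[i])),
      [/\ injective L,
          forall j, is_line_through_0 (L j),
          F @^-1` [set 0] = \bigcup_(j in [set: 'I_N]) L j &
          exists H : R[i] * R[i] -> R,
            [/\ smooth H,
                forall z, 0 <= H z,
                H @^-1` [set 0] = \bigcup_(j in [set: 'I_N]) L j &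
                forall delta : R, 0 < delta -> delta <= 1 ->
                  plurisubharmonic (fun z => P z - delta * H z)]].
Proof.
move=> k0 pP psh nplur hom np propB.
have par_p := parallel_of_propertyB pP psh np propB.
have evP z : (P z)%:C = evr p z := (real_polyP _ _).1 pP z.
have pn0 : ~ (forall z1 z2 w1 w2, ev p z1 z2 w1 w2 = 0).
  move=> E; apply: nplur; suff -> : P = (fun=> 0) by exact: pluriharmonic0.
  apply/funext => z; apply: (@complexI R); rewrite evP /evr E//.
have [d [D [F [u [d0 [sF F0] [su un0] [[u0 uD] dD] [[y1 [y2 Fy]] main]]]]]] :=
  form_decomposition pP hom par_p (noplur_vanish np) pn0.
pose Phi (z : R[i] * R[i]) := form d F z.1 z.2.
pose U s : R := Re (formc D u s).
have PU z : (P z)%:C = formc D u (Phi z) by rewrite evP /evr main !conjcK.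
have UE s : (U s)%:C = formc D u s.
  have [t ts] := exp_root s d0.
  have <- : Phi (t * y1, t * y2) = s by rewrite /Phi /= form_scale Fy mulr1.
  by rewrite /U -PU.
have PE z : P z = U (Phi z) by apply: (@complexI R); rewrite PU UE.
have sub : subharmonic (fun w : R[i] => U (w ^+ d)).
  have := psh.2 0 (y1, y2); congr subharmonic; apply/funext => w.
  rewrite PE add0r; congr U; by rewrite /Phi /= form_scale Fy mulr1.
have wU := wirtU su un0 u0 uD UE; have wA := wirtA su un0 u0 uD.
have Nge0 := N_ge0 su un0 u0 uD UE d0 sub.
have Nreal := N_real su un0 u0 uD UE.
have sU : sm1 (fun s => (U s)%:C) := sm1U UE.
have [Ht [B0 [B1 [B [sHt Ht0 Htp [wHt wB] BN]]]]] :=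
  exists_bump (lapl_size su un0 u0 uD) (lapl_neq0 su un0 u0 uD) Nreal Nge0.
have [N [L [Linj Lline FL]]] := form_zero d0 sF F0.
exists U, Phi; split; first split.
- exists (mform D u) => w; by rewrite mformE UE.
- exact: lap_subharmonic sU wU wA Nge0.
- by exists D => t w t0; rewrite !UE; exact: formc_scale.
- split; first by exists (mform d F) => z; rewrite mformE.
  by exists d => t z t0; exact: form_scale.
- by move=> z1 z2; exact: PE.
exists N, L; split => //.
have Ht_ge0 s : 0 <= Ht s by have [->|/Htp/ltW//] := eqVneq s 0; rewrite Ht0.
exists (fun z => Ht (Phi z)); split.
- apply: sm2_smooth; apply: (sm_comp (tau := Phi) _ sHt) => -[]; exact: sm2_form.
- by move=> z; exact: Ht_ge0.
- rewrite -FL; apply/seteqP; split => z /= => [Hz|Fz]; last by rewrite -[form _ _ _ _]/(Phi z) in Fz; rewrite Fz.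
  by apply/eqP/negPn/negP => /Htp; rewrite Hz ltxx.
move=> delta delta0 delta1.
have -> : (fun z => P z - delta * Ht (Phi z)) = (fun z => (fun s => U s - delta * Ht s) (Phi z)).
  by apply/funext => z; rewrite PE.
have VE s : (U s)%:C + (- delta%:C) * (Ht s)%:C = (U s - delta * Ht s)%:C.
  by rewrite rmorphB rmorphM mulNr.
have wV := wirt_real (wirt_ext VE (frefl _) (frefl _) (wirtD wU (wirtM (wirt_cst (- delta%:C)) wHt))).
have wV1 := wirtD wA (wirtD (wirtM (wirt_cst 0) wHt) (wirtM (wirt_cst (- delta%:C)) wB)).
apply: (@psh_form _ (fun s => U s - delta * Ht s) _ _ _ d F _ wV wV1).
- apply: sm_ext VE _; apply: sm_add => //; apply: sm_mul => //; exact: (sm_cst _ (- delta%:C)).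
move=> s; rewrite !mul0r !add0r mulNr ReD ReN ReM /= mul0r subr0 subr_ge0.
have [Bs|Bs] := leP (Re (B s)) 0.
  by apply: le_trans (Nge0 s); rewrite pmulr_rle0.
by apply: le_trans (BN s); rewrite ler_piMl// ltW.
Qed.
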